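(* Assume that there exists $\xi_0\in\mathbb{R}^p$ such that the function $t\mapsto f(t,\xi_0)$ is locally integrable and that $F_t$ is radially unbounded, locally uniformly in $t$. Furthermore, assume that, for all compact sets $T\subset\mathbb{R}_+$ and $K\subset\mathbb{R}^p$, there exist $\lambda\in L^1_{\rm loc}(\mathbb{R}_+,\mathbb{R}_+)$ and $\varepsilon>0$ such that $$\|f(t,\xi)-f(t,\zeta)\|\le\lambda(t)\|\xi-\zeta\|\quad\text{for all }\xi,\zeta\in K\text{ and all }t\ge0$$ and $$\|F(t,\xi)-F(t,\zeta)\|\ge\varepsilon\|\xi-\zeta\|\quad\text{for all }\xi,\zeta\in K\text{ and all }t\in T.$$ Then, for all $v\in L^\infty_{\rm loc}(\mathbb{R}_+,\mathbb{R}^{m_{\rm e}})$, $t_0\ge0$ and $x^0\in\mathbb{R}^n$, the following hold: (1) There exists $(v,x,y)\in\tilde{\mathcal B}(S^f,t_0)$ such that $x(t_0)=x^0$. (2) If $(v,x,y)\in\tilde{\mathcal B}(S^f,t_0)$ has bounded maximal interval of definition $[t_0,\tau)$, where $t_0<\tau<\infty$, then $\int_{t_0}^\tau\|Bf(t,y(t))\|\,dt=\infty$, $y\notin L^\infty([t_0,\tau),\mathbb{R}^p)$ and $\|x(t)\|\to\infty$ as $t\uparrow\tau$. In particular, (L) has the blow-up property. Moreover, (L) has the uniqueness property.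
   Context: Setting. $\mathbb{R}_+=[0,\infty)$; norms on $\mathbb{R}^k$ are Euclidean and matrix norms are the induced operator norms. Let $n,m,m_{\rm e},p$ be positive integers, $A\in\mathbb{R}^{n\times n}$, $B\in\mathbb{R}^{n\times m}$, $B_{\rm e}\in\mathbb{R}^{n\times m_{\rm e}}$, $C\in\mathbb{R}^{p\times n}$, $D\in\mathbb{R}^{p\times m}$, $D_{\rm e}\in\mathbb{R}^{p\times m_{\rm e}}$, and let $f:\mathbb{R}_+\times\mathbb{R}^p\to\mathbb{R}^m$ be a Caratheodory function, i.e. $f(t,\cdot)$ is continuous for every $t\ge0$ and $f(\cdot,\xi)$ is measurable for every $\xi\in\mathbb{R}^p$. The Lur'e system $S^f$, also called (L), is $$\dot x(t)=Ax(t)+Bf(t,y(t))+B_{\rm e}v(t),\qquad y(t)=Cx(t)+Df(t,y(t))+D_{\rm e}v(t).$$ Write $(f\circ y)(t):=f(t,y(t))$ and $F_t(\xi):=F(t,\xi):=\xi-Df(t,\xi)$ for $t\ge0$, $\xi\in\mathbb{R}^p$. Trajectories. For $0\le t_0<\tau\le\infty$, a pre-trajectory of (L) on $[t_0,\tau)$ is a triple $(v,x,y)\in L^\infty_{\rm loc}(\mathbb{R}_+,\mathbb{R}^{m_{\rm e}})\times W^{1,1}_{\rm loc}([t_0,\tau),\mathbb{R}^n)\times L^1_{\rm loc}([t_0,\tau),\mathbb{R}^p)$ such that $f\circ y\in L^1_{\rm loc}([t_0,\tau),\mathbb{R}^m)$ and both equations of (L) hold for a.e. $t\in[t_0,\tau)$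 (''loc'' refers to compact subintervals of $[t_0,\tau)$; elements of $W^{1,1}_{\rm loc}$ are identified with locally absolutely continuous functions, and elements of $L^1_{\rm loc}$ are identified if equal a.e.). It is maximally defined if there is no pre-trajectory $(v,\tilde x,\tilde y)$ on some $[t_0,\tilde\tau)$ with $\tilde\tau>\tau$ and $(\tilde x,\tilde y)|_{[t_0,\tau)}=(x,y)$. $\tilde{\mathcal B}(S^f,t_0)$ denotes the set of all maximally defined pre-trajectories with initial time $t_0$ (defined on $[t_0,\tau)$ for some $\tau\in(t_0,\infty]$). Blow-up property. (L) has the blow-up property if, for every $t_0\ge 0$ and every $(v,x,y)\in\tilde{\mathcal B}(S^f,t_0)$ with bounded interval of definition $[t_0,\tau)$, $\tau<\infty$, one has $\limsup_{t\uparrow\tau}\|x(t)\|+\int_{t_0}^\tau(\|y(s)\|+\|f(s,y(s))\|)\,ds=\infty$. Uniqueness property. (L) has the uniqueness property if, for every $v\in L^\infty_{\rm loc}(\mathbb{R}_+,\mathbb{R}^{m_{\rm e}})$ and every $t_0\ge0$, any two pre-trajectories $(v,x,y)$ and $(v,\tilde x,\tilde y)$ on $[t_0,\tau)$ and $[t_0,\tilde\tau)$, respectively, where $t_0<\tau\le\tilde\tau\le\infty$, coincide on $[t_0,\tau)$ if $x(t_0)=\tilde x(t_0)$. Radial unboundedness. $F_t$ is radially unbounded, locally uniformly in $t$, if for all $\rho>0$ and all compact $T\subset\mathbb{R}_+$ there exists $\sigma\ge0$ such that $\|F_t(\xi)\|\ge\rho$ for all $t\in T$ and all $\xi$ with $\|\xi\|\ge\sigma$.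 *)

(* Defs.v *)
From HB Require Import structures.
From mathcomp Require Import all_boot all_order all_algebra.
From mathcomp Require Import all_classical all_reals all_analysis.

Set Implicit Arguments.
Unset Strict Implicit.
Unset Printing Implicit Defensive.
Import Order.TTheory GRing.Theory Num.Theory.
Import numFieldNormedType.Exports.
Local Open Scope classical_set_scope.
Local Open Scope ring_scope.

(* The line with the (complete) sigma-algebra of Lebesgue measurable sets, as
   opposed to [measurableTypeR R], which carries the Borel sets.  It is
   convertible to [R]. *)
Notation lebesgueR R := (caratheodory_type ((@wlength R idfun)^*)%mu).

Definition leb (R : realType) : {measure set (lebesgueR R) -> \bar R} :=
  @completed_lebesgue_measure R.
Arguments leb {R}.

(* The Euclidean norm; the library norm on matrices is the max norm. *)
Definition enorm (R : realType) (k : nat) (z : 'cV[R]_k) : R :=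
  Num.sqrt (\sum_i z i 0 ^+ 2).

Section FunctionSpaces.
Context {R : realType} {k : nat}.
Implicit Types (D J : set R) (g : R -> 'cV[R]_k).

Definition vmeasurable D g : Prop :=
  forall i, measurable_fun (D : set (lebesgueR R)) (fun t => g t i 0).

Definition L1 D g : Prop :=
  vmeasurable D g /\ (\int[leb]_(t in D) (enorm (g t))%:E < +oo)%E.

Definition Linfty D g : Prop :=
  vmeasurable D g /\
  exists M : R, {ae @leb R, forall t, D t -> enorm (g t) <= M}.

Definition locally (P : set R -> (R -> 'cV[R]_k) -> Prop) J g : Prop :=
  forall a b : R, `[a, b]%classic `<=` J -> P `[a, b]%classic g.

Definition abs_continuous D g : Prop :=
  forall e : R, 0 < e -> exists2 d : R, 0 < d &
    forall (N : nat) (a b : 'I_N -> R),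
      (forall i, [/\ D (a i), D (b i) & a i <= b i]) ->
      (forall i j, i != j -> b i <= a j \/ b j <= a i) ->
      \sum_i (b i - a i) < d ->
      \sum_i enorm (g (b i) - g (a i)) < e.

End FunctionSpaces.

Definition Rplus {R : realType} : set R := `[0, +oo[%classic.

(* [t0, tau), where tau may be +oo *)
Definition time_interval {R : realType} (t0 : R) (tau : \bar R) : set R :=
  [set t | t0 <= t /\ (t%:E < tau)%E].

Definition caratheodory_fun {R : realType} {m p : nat}
    (f : R -> 'cV[R]_p -> 'cV[R]_m) : Prop :=
  (forall t, 0 <= t -> continuous (f t)) /\
  (forall xi, vmeasurable Rplus (fun t => f t xi)).

(* Only the values of the nonlinearity at nonnegative times are relevant. *)
Record lure (R : realType) (n m me p : nat) := Lure {
  lA : 'M[R]_n ;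
  lB : 'M[R]_(n, m) ;
  lBe : 'M[R]_(n, me) ;
  lC : 'M[R]_(p, n) ;
  lD : 'M[R]_(p, m) ;
  lDe : 'M[R]_(p, me) ;
  lf : R -> 'cV[R]_p -> 'cV[R]_m ;
  lf_caratheodory : caratheodory_fun lf }.

Section Lure.
Context {R : realType} {n m me p : nat}.
Variable S : lure R n m me p.
Implicit Types (v : R -> 'cV[R]_me) (x : R -> 'cV[R]_n) (y : R -> 'cV[R]_p).

Definition lF (t : R) (xi : 'cV[R]_p) : 'cV[R]_p := xi - lD S *m lf S t xi.

(* Signals on [t0, tau) are total functions of which only the restriction to
   [t0, tau) matters; v is given on the whole of R_+. *)
Definition pretrajectory (t0 : R) (tau : \bar R) v x y : Prop :=
  let J := time_interval t0 tau in
  [/\ 0 <= t0 /\ (t0%:E < tau)%E,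
      locally Linfty Rplus v,
      locally abs_continuous J x,
      locally L1 J y /\ locally L1 J (fun t => lf S t (y t)) &
      {ae @leb R, forall t, J t ->
         is_derive t 1 x (lA S *m x t + lB S *m lf S t (y t) + lBe S *m v t) /\
         y t = lC S *m x t + lD S *m lf S t (y t) + lDe S *m v t}].

(* Equality of the state/output pairs on [t0, tau): everywhere for the
   (continuous) state, almost everywhere for the output. *)
Definition coincide (t0 : R) (tau : \bar R) x y x' y' : Prop :=
  (forall t, time_interval t0 tau t -> x t = x' t) /\
  {ae @leb R, forall t, time_interval t0 tau t -> y t = y' t}.

Definition maximal_trajectory (t0 : R) (tau : \bar R) v x y : Prop :=
  pretrajectory t0 tau v x y /\
  ~ exists (tau' : \bar R) x' y',
      [/\ (tau < tau')%E, pretrajectory t0 tau' v x' y' &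
          coincide t0 tau x' y' x y].

Definition blow_up_property : Prop :=
  forall (t0 tau : R) v x y, maximal_trajectory t0 tau%:E v x y ->
    (limf_esup (fun t => (enorm (x t))%:E) (tau^'-) +
     \int[leb]_(s in `[t0, tau[%classic)
       (enorm (y s) + enorm (lf S s (y s)))%:E = +oo)%E.

Definition uniqueness_property : Prop :=
  forall v (t0 : R) (tau tau' : \bar R) x y x' y',
    (tau <= tau')%E ->
    pretrajectory t0 tau v x y -> pretrajectory t0 tau' v x' y' ->
    x t0 = x' t0 -> coincide t0 tau x y x' y'.

End Lure.

Definition radially_unbounded_loc_unif {R : realType} {p q : nat}
    (F : R -> 'cV[R]_p -> 'cV[R]_q) : Prop :=
  forall (rho : R) (T : set R), 0 < rho -> compact T -> T `<=` Rplus ->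
    exists2 sigma : R, 0 <= sigma &
      forall t xi, T t -> sigma <= enorm xi -> rho <= enorm (F t xi).

(* Main.v *)
Require Import Defs.
From HB Require Import structures.
From mathcomp Require Import all_boot all_order all_algebra.
From mathcomp Require Import all_classical all_reals all_analysis.
From mathcomp Require Import measurable_realfun.
From mathcomp Require Import zify ring lra.

(** The output equation reads [F_t (y t) = C x + De v].  If every [F_t] is a
    bijection, it can be solved for [y], and the system becomes the
    differential equation
      [x' = A x + B f (t, F_t^-1 (C x + De v)) + Be v],
    whose right-hand side turns out to satisfy local Caratheodory-Lipschitz
    conditions with integrable bounds.  Everything then follows from the
    classical theory of such equations, applied to [closed_loop].

    Bijectivity of [F_t].  The lower bound on [F_t] gives injectivity.
    Surjectivity is the topological core: a continuous injective radially
    unbounded self-map of a Euclidean space is onto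
    ([continuous_injective_surjective]).  It is obtained by joining
    [F_t - z] near the origin, through a homotopy without zeros, to the odd map
    [xi |-> F_t xi - F_t (- xi)] far away, and applying the Borsuk theorem that
    a continuous map of a ball which is odd on the boundary has a zero
    ([odd_boundary_zero]).  The latter comes from a Tucker lemma [tucker],
    proved by counting alternating simplices modulo 2 in iterated barycentric
    subdivisions of the cross-polytope.

    Regularity of the closed loop.  For [t <= T] and bounded [z] the points
    [F_t^-1 z] stay in one ball, by radial unboundedness.  On that ball
    [f (t, F_t^-1 z)] is Lipschitz in [z] with constant [lambda t / eps], and it
    is dominated by the integrable function [|f (t, xi0)| + c * lambda t]
    ([output_bounds]).  Measurability in [t] holds because both [f] and the
    inverse of [F] can be written, by these Lipschitz bounds, as countable
    infima over rational points ([vmeasurable_comp], [vmeasurable_inverse]).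

    Solutions.  Clipping the state to a ball makes the closed loop globally
    Lipschitz and dominated ([truncated_field]), so that the Picard iteration
    [caratheodory_picard] applies, and uniqueness is Gronwall's inequality
    [gronwall0].  Absolutely continuous solutions in the almost everywhere
    sense are identified with solutions of the integral equation by the two
    halves of the fundamental theorem of calculus ([integral_of_derivative],
    [derivative_of_integral]).  Maximal trajectories arise by gluing
    ([exists_maximal]).

    Behaviour at a finite end point.  A bounded solution continues
    ([solution_extend]), so a maximal one is unbounded near [tau].  Started
    close to [tau] inside a ball, a solution cannot leave a slightly larger ball
    before [tau]; hence the norm of a maximal solution does not merely have
    limsup [+oo], it tends to [+oo] ([maximal_norm_diverges]).  A finite
    integral of [|B f (t, y)|] would bound [x], as the linear part by itself
    grows at most exponentially ([maximal_integral_infinite]).  A bounded [y]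
    would make that integral finite ([maximal_output_unbounded]). *)

Set Implicit Arguments.
Unset Strict Implicit.
Unset Printing Implicit Defensive.
Import Order.TTheory GRing.Theory Num.Theory.
Import numFieldNormedType.Exports.
Local Open Scope classical_set_scope.
Local Open Scope ring_scope.

(** * Column vectors with the maximum norm *)

Section ColumnNorm.
Context {R : realFieldType} {k : nat}.
Implicit Types x : 'cV[R]_k.

Lemma norm_coord x i : `|x i 0| <= `|x|.
Proof.
rewrite [leRHS]/Num.Def.normr/= mx_normrE.
by rewrite (le_bigmax_cond _ (fun i => `|x i.1 i.2|) (j := (i, 0))).
Qed.

Lemma norm_le_coord x (M : R) : 0 <= M -> (forall i, `|x i 0| <= M) -> `|x| <= M.
Proof.
move=> M0 h; rewrite [leLHS]/Num.Def.normr/= mx_normrE bigmax_le// => -[i j] _.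
by rewrite [j]ord1.
Qed.

End ColumnNorm.

Section ContinuityEpsDelta.
Context {R : realType} {V W : normedModType R}.

Lemma continuous_atP (G : V -> W) x : continuous_at x G <->
  forall e, 0 < e -> exists2 r, 0 < r &
    forall y, `|x - y| < r -> `|G x - G y| < e.
Proof.
split=> [cG e e0|h].
  have := cG (ball (G x) e) (nbhsx_ballx _ _ e0).
  move=> /nbhs_ballP[r r0 hr]; exists r => // y xy.
  by have := hr y; rewrite -!ball_normE; apply.
move=> A /nbhs_ballP[e /= e0 eA]; have [r r0 hr] := h e e0.
apply/nbhs_ballP; exists r => // y; rewrite -ball_normE => /hr ?.
by apply: eA; rewrite -ball_normE.
Qed.

End ContinuityEpsDelta.

Section ColumnCompact.
Context {R : realType} {k : nat}.

Lemma norm_trmx (m n : nat) (A : 'M[R]_(m, n)) : `|A^T| = `|A|.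
Proof.
have h (p q : nat) (B : 'M[R]_(p, q)) : `|B^T| <= `|B|.
  rewrite /Num.Def.normr/= !mx_normrE bigmax_le//.
    by apply: bigmax_ge_id.
  by move=> [i j] _; rewrite mxE
    (le_bigmax_cond _ (fun i => `|B i.1 i.2|) (j := (j, i))).
by apply/eqP; rewrite eq_le h -{1}[A]trmxK h.
Qed.

(** Bounded closed sets are compact for row vectors; transposition is an
    isometry and transports this to columns. *)
Lemma compact_cball (r : R) : compact [set x : 'cV[R]_k | `|x| <= r].
Proof.
have -> : [set x : 'cV[R]_k | `|x| <= r] = trmx @` [set x : 'rV[R]_k | `|x| <= r].
  apply/seteqP; split => [x /= h|_ [x /= h <-]]; last by rewrite /= norm_trmx.
  by exists x^T; rewrite ?trmxK//= norm_trmx.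
apply: continuous_compact; last first.
  apply: bounded_closed_compact.
    exists r; split; first exact: num_real.
    by move=> M rM x /= /le_trans; apply; exact: ltW.
  apply: (@preimage_closed _ _ (fun x : 'rV[R]_k => `|x|) [set y | y <= r]).
    by move=> ? _; exact: norm_continuous.
  exact: closed_le.
apply: continuous_subspaceT => x.
have FF : Filter (nbhs x) by exact: nbhs_filter.
apply/cvgrPdist_lt => e e0.
apply: filterS (nbhsx_ballx x e e0) => y.
by rewrite -ball_normE /= -linearB/= norm_trmx.
Qed.

End ColumnCompact.

(** * Simplicial chains modulo 2 *)

Section Chains.
Variable V : Type.
Implicit Types (s t : seq V) (c : seq (seq V)) (phi : seq V -> bool).

(** A chain is a list of simplices, and a simplex is the list of its vertices in
    a fixed order.  Two chains are the same modulo 2 when all boolean functions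
    of simplices have the same parity on them, so that no quotient is formed and
    cancellation is cancellation of booleans. *)
Definition parity phi c : bool := \big[addb/false]_(s <- c) phi s.

(** The boundary of a simplex is augmented: a vertex has the empty simplex as
    its face.  The parity induction on spheres below can then start from the
    empty simplex. *)
Fixpoint faces s : seq (seq V) :=
  if s is x :: s' then s' :: map (cons x) (faces s') else [::].

Definition bind (f : seq V -> seq (seq V)) c := flatten (map f c).

Lemma parity_cat phi c1 c2 : parity phi (c1 ++ c2) = parity phi c1 (+) parity phi c2.
Proof. by rewrite /parity big_cat. Qed.

Lemma parity_map phi (f : seq V -> seq V) c : parity phi (map f c) =
  parity (phi \o f) c.
Proof. by rewrite /parity big_map. Qed.

Lemma parity_bind phi f c : parity phi (bind f c) =
  parity (fun s => parity phi (f s)) c.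
Proof. by rewrite /parity /bind big_flatten big_map. Qed.

Lemma eq_parity phi psi c : (forall s, phi s = psi s) -> parity phi c = parity psi c.
Proof. by move=> h; apply: eq_bigr => s _; rewrite h. Qed.

Lemma parity_add phi psi c :
  parity (fun s => phi s (+) psi s) c = parity phi c (+) parity psi c.
Proof. by rewrite /parity big_split. Qed.

Lemma parity_faces_cons phi x s :
  parity phi (faces (x :: s)) = phi s (+) parity (phi \o cons x) (faces s).
Proof. by rewrite /parity /= big_cons big_map. Qed.

Lemma parity_bind_faces_cons phi x c :
  parity phi (bind faces (map (cons x) c)) =
  parity phi c (+) parity (phi \o cons x) (bind faces c).
Proof.
rewrite !parity_bind parity_map -parity_add; apply: eq_parity => s.
exact: parity_faces_cons.
Qed.

Lemma faces_faces phi s : parity phi (bind faces (faces s)) = false.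
Proof.
elim: s phi => [|x s IH] phi; first by rewrite /parity big_nil.
rewrite /= -cat1s /bind map_cat flatten_cat parity_cat.
rewrite -/(bind faces _) -/(bind faces (map _ _)) parity_bind_faces_cons IH addbF.
by rewrite /bind /= cats0 addbb.
Qed.

End Chains.
Arguments faces {V} s.

(** * Alternating simplices of a labelling *)

Section Fan.

Fixpoint alternating (b : bool) (l : seq bool) : bool :=
  if l is x :: l' then (x == b) && alternating (~~ b) l' else true.

(** In an alternating word only the removal of an end letter leaves an
    alternating one; in a word with one repeated sign the two possible removals
    cancel each other. *)
Lemma alternating_faces b l : parity (alternating b) (faces l) =
  alternating b l (+) alternating (~~ b) l.
Proof.
elim: l b => [|x l IH] b; first by rewrite /parity big_nil.
rewrite parity_faces_cons.
have -> : parity (alternating b \o cons x) (faces l) =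
  (x == b) && parity (alternating (~~ b)) (faces l).
  rewrite /parity; case xb: (x == b) => /=.
    by apply: eq_bigr => t _ /=; rewrite xb.
  by rewrite big1// => t _ /=; rewrite xb.
rewrite IH negbK /=; case: x; case: b; rewrite /= ?addbF //;
  by case: (alternating true l); case: (alternating false l).
Qed.

(** The signs are read in the order of increasing labels, which makes the
    property independent of the order of the vertices. *)
Definition alternating_labels (b : bool) (ls : seq nat) :=
  alternating b (map odd (sort leq ls)).

Lemma alternating_labels_perm b l1 l2 : perm_eq l1 l2 ->
  alternating_labels b l1 = alternating_labels b l2.
Proof.
move=> h; rewrite /alternating_labels; congr (alternating b (map odd _)).
by apply/perm_sortP => //; [exact: leq_total|exact: leq_trans|exact: anti_leq].
Qed.

Lemma parity_faces_rem (phi : seq nat -> bool) l :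
  (forall l1 l2, perm_eq l1 l2 -> phi l1 = phi l2) ->
  parity phi (faces l) = \big[addb/false]_(x <- l) phi (rem x l).
Proof.
elim: l phi => [|x l IH] phi hphi; first by rewrite /parity !big_nil.
rewrite parity_faces_cons big_cons /= eqxx; congr (_ (+) _).
rewrite IH /=; last first.
  by move=> l1 l2 h; apply: hphi; rewrite perm_cons.
rewrite big_seq [RHS]big_seq; apply: eq_bigr => y yl; apply: hphi.
case: eqP => [->|_]; last exact: perm_refl.
by rewrite perm_sym perm_to_rem.
Qed.

Lemma perm_rem (T : eqType) (x : T) l1 l2 :
  perm_eq l1 l2 -> perm_eq (rem x l1) (rem x l2).
Proof.
move=> h; have [xl|xl] := boolP (x \in l1).
  rewrite -(perm_cons x) -(permPl (perm_to_rem xl)) (permPl h) perm_to_rem//.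
  by rewrite -(perm_mem h).
by rewrite !rem_id// -(perm_mem h).
Qed.

(** Fan's counting identity: summed over a chain, it expresses the alternating
    simplices of the boundary through those of the chain itself. *)
Lemma alternating_labels_faces b ls : parity (alternating_labels b) (faces ls) =
  alternating_labels b ls (+) alternating_labels (~~ b) ls.
Proof.
rewrite parity_faces_rem; last exact: alternating_labels_perm.
have p : perm_eq ls (sort leq ls) by rewrite perm_sym perm_sort.
rewrite (perm_big _ p) /=.
have -> : \big[addb/false]_(x <- sort leq ls) alternating_labels b (rem x ls) =
          \big[addb/false]_(x <- sort leq ls) alternating_labels b
            (rem x (sort leq ls)).
  by apply: eq_bigr => x _; apply: alternating_labels_perm; exact: perm_rem.
rewrite -parity_faces_rem; last exact: alternating_labels_perm.
rewrite /alternating_labels -alternating_faces.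
have : sorted leq (sort leq ls) by exact: (sort_sorted leq_total).
move: (sort leq ls) => l {p ls} sl.
have fsub (l0 : seq nat) : all (fun t => subseq t l0) (faces l0).
  elim: l0 => // y l0 IH; apply/andP; split; first exact: subseq_cons.
  rewrite -/(all _ _) -/(faces _) all_map; by apply: sub_all IH => t; rewrite /= eqxx.
have -> : faces (map odd l) = map (map odd) (faces l).
  by elim: l {sl} => //= y l ->; congr cons; rewrite -!map_comp.
rewrite /parity big_map big_seq [RHS]big_seq; apply: eq_bigr => t tl.
congr (alternating b (map odd _)); apply: sorted_sort; first exact: leq_trans.
apply: subseq_sorted sl; first exact: leq_trans.
exact: (allP (fsub l)).
Qed.

(** A number [n] encodes the signed label of absolute value [n./2] and sign
    [odd n].  Sorting by [leq] therefore sorts by absolute value, as long as no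
    two labels are opposite. *)
Definition flip n := if odd n then n.-1 else n.+1.

Definition no_complementary (ls : seq nat) :=
  {in ls &, forall x y, x./2 = y./2 -> x = y}.

Lemma odd_flip n : odd (flip n) = ~~ odd n.
Proof. rewrite /flip; case: ifP => h; lia. Qed.

(** Without opposite labels all absolute values of distinct labels differ, so
    the antipode preserves the order by absolute value and only exchanges the
    signs. *)
Lemma alternating_labels_flip b ls : no_complementary ls ->
  alternating_labels b (map flip ls) = alternating_labels (~~ b) ls.
Proof.
move=> nc; rewrite /alternating_labels.
have -> : sort leq (map flip ls) = map flip (sort leq ls).
  apply: (sorted_eq leq_trans anti_leq).
  - exact: (sort_sorted leq_total).
  - rewrite sorted_map.
    rewrite (@eq_in_sorted _ [in ls] _ leq) ?(sort_sorted leq_total)//.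
      move=> x y xl yl /=; have [/(nc _ _ xl yl)->|] := eqVneq x./2 y./2.
        by rewrite !leqnn.
      rewrite /flip; case: ifP => hx; case: ifP => hy; lia.
    by apply/allP => x; rewrite mem_sort.
  - by rewrite perm_sort perm_map// perm_sym perm_sort.
rewrite -map_comp; elim: (sort leq ls) b => //= x l IH b.
by rewrite IH odd_flip; case: (odd x); case: b.
Qed.

(** Consecutive labels of an alternating simplex have different signs, and
    without opposite labels also different absolute values: [d] absolute values
    are too few for [d.+1] vertices. *)
Lemma alternating_labels_top b d ls :
  no_complementary ls -> {in ls, forall x, (x./2 < d)%N} -> size ls = d.+1 ->
  alternating_labels b ls = false.
Proof.
move=> nc hd sz; apply/negP => h.
have pl : perm_eq ls (sort leq ls) by rewrite perm_sym perm_sort.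
have srt : sorted leq (sort leq ls) by exact: (sort_sorted leq_total).
have nc' : no_complementary (sort leq ls).
  by move=> x y; rewrite !mem_sort; exact: nc.
have us : sorted ltn (map half (sort leq ls)).
  move: h srt nc'; rewrite /alternating_labels;
    elim: (sort leq ls) b => [//|x [//|y l] IH] b.
  move=> /= /and3P[/eqP xb /eqP yb h] /andP[xy srt] nc'; apply/andP; split.
    rewrite ltn_neqAle half_leq// andbT; apply/eqP => /nc'.
    rewrite !inE !eqxx orbT => /(_ isT isT) exy.
    by move: yb xb; rewrite exy => -> ; case: b {h}.
  apply: (IH (~~ b)) => //=; first by rewrite yb eqxx.
  by move=> u v ul vl; apply: nc'; rewrite inE ?ul ?vl orbT.
have uq : uniq (map half (sort leq ls)) by exact: sorted_uniq ltn_trans ltnn _ us.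
have := uniq_leq_size uq (s2 := iota 0 d).
rewrite size_map size_sort size_iota sz ltnn => H; apply: notF; apply: H.
move=> _ /mapP[x + ->]; rewrite mem_sort => /hd xd.
by rewrite mem_iota.
Qed.

End Fan.

(** * Barycentric subdivision *)

Section Subdivision.
Context {R : realFieldType} {V : lmodType R}.
Implicit Types (s t : seq V) (c : seq (seq V)) (phi : seq V -> bool).

Definition bary s : V := (size s)%:R^-1 *: \sum_(x <- s) x.

(** Each face of the subdivided boundary is coned from the barycentre.  The
    recursion is on the number of vertices, passed as [k]. *)
Fixpoint subdiv_rec (k : nat) s : seq (seq V) :=
  if k is k'.+1 then map (cons (bary s)) (bind (subdiv_rec k') (faces s))
  else [:: [::]].

Definition subdiv s := subdiv_rec (size s) s.

Fixpoint subdiv_iter (N : nat) c :=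
  if N is N'.+1 then subdiv_iter N' (bind subdiv c) else c.

Lemma faces_size (T : eqType) (s t : seq T) : t \in faces s -> size s = (size t).+1.
Proof.
elim: s t => //= x s IH t; rewrite inE => /orP[/eqP->//|/mapP[u us ->]].
by rewrite (IH u us).
Qed.

Lemma mem_faces (T : eqType) (s t : seq T) : t \in faces s -> {subset t <= s}.
Proof.
elim: s t => //= x s IH t; rewrite inE => /orP[/eqP->|/mapP[u us ->]] y.
  by rewrite inE orbC => ->.
by rewrite !inE => /orP[->//|/(IH _ us)->]; rewrite orbT.
Qed.

(** The boundary of a cone is its base plus the cone over the boundary of the
    base; the base here is the subdivided boundary, whose own boundary vanishes
    by induction and [faces_faces]. *)
Lemma subdiv_rec_faces phi k s : size s = k ->
  parity phi (bind faces (subdiv_rec k s)) =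
    parity phi (bind (subdiv_rec k.-1) (faces s)).
Proof.
elim: k s phi => [|k IH] s phi sz.
  by case: s sz.
rewrite [subdiv_rec _ _]/= parity_bind_faces_cons /=.
rewrite [X in _ (+) X](_ : _ = false) ?addbF//.
rewrite parity_bind parity_bind.
transitivity (parity (fun t => parity (phi \o cons (bary s))
  (bind (subdiv_rec k.-1) (faces t)))
   (faces s)).
  rewrite /parity big_seq [RHS]big_seq; apply: eq_bigr => t ts.
  rewrite -/(parity _ _) -/(parity _ _) -IH ?parity_bind//.
  by move: (faces_size ts); rewrite sz => -[].
rewrite -[RHS](faces_faces
  (fun t => parity (phi \o cons (bary s)) (subdiv_rec k.-1 t)) s).
by rewrite [RHS]parity_bind; apply: eq_parity => t; rewrite parity_bind.
Qed.

Lemma parity_bind_congr (f : seq V -> seq (seq V)) c1 c2 :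
  (forall phi, parity phi c1 = parity phi c2) ->
  forall phi, parity phi (bind f c1) = parity phi (bind f c2).
Proof. by move=> h phi; rewrite !parity_bind h. Qed.

Lemma subdiv_iter_congr N c1 c2 : (forall phi, parity phi c1 = parity phi c2) ->
  forall phi, parity phi (subdiv_iter N c1) = parity phi (subdiv_iter N c2).
Proof.
by elim: N c1 c2 => //= N IH c1 c2 h; apply: IH; exact: parity_bind_congr.
Qed.

Lemma bind_faces_subdiv c phi :
  parity phi (bind faces (bind subdiv c)) = parity phi (bind subdiv (bind faces c)).
Proof.
rewrite !parity_bind; apply: eq_parity => s;
  rewrite -parity_bind subdiv_rec_faces// parity_bind.
rewrite /parity big_seq [RHS]big_seq; apply: eq_bigr => t ts.
by rewrite /subdiv (faces_size ts).
Qed.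

Lemma bind_faces_subdiv_iter N c phi :
  parity phi (bind faces (subdiv_iter N c)) = parity phi (subdiv_iter N (bind faces c)).
Proof.
elim: N c phi => //= N IH c phi; rewrite IH.
by apply: subdiv_iter_congr => psi; exact: bind_faces_subdiv.
Qed.

Lemma bary_opp s : bary (map -%R s) = - bary s.
Proof.
by rewrite /bary size_map big_map sumrN scalerN.
Qed.

Lemma faces_map (T U : Type) (f : T -> U) (s : seq T) :
  faces (map f s) = map (map f) (faces s).
Proof. by elim: s => //= x s ->; congr cons; rewrite -!map_comp. Qed.

Lemma subdiv_rec_opp k s : subdiv_rec k (map -%R s) = map (map -%R) (subdiv_rec k s).
Proof.
elim: k s => //= k IH s; rewrite faces_map bary_opp -map_comp.
rewrite [RHS](_ : _ = map (cons (- bary s))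
  (map (map -%R) (bind (subdiv_rec k) (faces s)))).
  congr map; rewrite /bind map_flatten -!map_comp; congr flatten.
  by apply: eq_map => t /=; rewrite IH.
by rewrite -map_comp.
Qed.

Lemma subdiv_iter_opp N c : subdiv_iter N (map (map -%R) c) =
  map (map -%R) (subdiv_iter N c).
Proof.
elim: N c => //= N IH c; rewrite -IH; congr subdiv_iter.
rewrite /bind map_flatten -!map_comp; congr flatten.
by apply: eq_map => t /=; rewrite /subdiv size_map subdiv_rec_opp.
Qed.

(** A substitute for convexity that is just strong enough to pass from the
    vertices of a simplex to those of its subdivisions. *)
Definition bary_closed (P : V -> Prop) :=
  forall s, s != [::] -> (forall x, x \in s -> P x) -> P (bary s).

Lemma subdiv_rec_closed (P : V -> Prop) k s t : bary_closed P -> size s = k ->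
  (forall x, x \in s -> P x) -> t \in subdiv_rec k s -> forall x, x \in t -> P x.
Proof.
move=> hP; elim: k s t => [|k IH] s t sz hs /=; first by rewrite inE => /eqP->.
case/mapP => u /flatten_mapP[f fs uf] -> x; rewrite inE => /orP[/eqP->|xu].
  by apply: hP => //; case: s sz {hs fs}.
apply: (IH f u) => //; first by move: (faces_size fs); rewrite sz => -[].
by move=> y /(mem_faces fs); exact: hs.
Qed.

Lemma subdiv_rec_size k s t : size s = k -> t \in subdiv_rec k s -> size t = k.
Proof.
elim: k s t => [|k IH] s t sz /=; first by rewrite inE => /eqP->.
case/mapP => u /flatten_mapP[f fs uf] -> /=; rewrite (IH f u)//.
by move: (faces_size fs); rewrite sz => -[].
Qed.

Lemma subdiv_iter_mem N c t : t \in subdiv_iter N c ->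
  exists2 s, s \in c & t \in subdiv_iter N [:: s].
Proof.
elim: N c t => [|N IH] c t /=; first by move=> tc; exists t => //; rewrite inE.
move=> /IH[u /flatten_mapP[s sc us] tu]; exists s => //.
rewrite /bind /= cats0.
have subdiv_iter_sub (c1 c2 : seq (seq V)) : {subset c1 <= c2} ->
  {subset subdiv_iter N c1 <= subdiv_iter N c2}.
  clear; elim: N c1 c2 => //= N IH c1 c2 h; apply: IH => v /flatten_mapP[w w1 vw].
  by apply/flatten_mapP; exists w => //; exact: h.
by apply: subdiv_iter_sub tu => v; rewrite inE => /eqP->.
Qed.

Lemma subdiv_iter_ind (Q : nat -> seq V -> Prop) s :
  (forall k u t, Q k u -> t \in subdiv u -> Q k.+1 t) -> Q 0%N s ->
  forall N t, t \in subdiv_iter N [:: s] -> Q N t.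
Proof.
move=> step.
suff H : forall N k s, Q k s -> forall t, t \in subdiv_iter N [:: s] -> Q (N + k)%N t.
  by move=> Q0 N t tN; rewrite -[N]addn0; exact: H Q0 _ tN.
elim=> [|N IH] k u Qu t /=; first by rewrite inE => /eqP->.
rewrite /bind /= cats0 => /subdiv_iter_mem[v vu tv].
by rewrite addSnnS; apply: IH tv; exact: step Qu vu.
Qed.

Lemma subdiv_iter_size N s t : t \in subdiv_iter N [:: s] -> size t = size s.
Proof.
apply: (@subdiv_iter_ind (fun _ t => size t = size s)) => // k u v us vu.
by rewrite -us; exact: subdiv_rec_size vu.
Qed.

Lemma subdiv_iter_closed (P : V -> Prop) N s t : bary_closed P ->
  (forall x, x \in s -> P x) -> t \in subdiv_iter N [:: s] -> forall x, x \in t -> P x.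
Proof.
move=> hP hs; apply: (@subdiv_iter_ind (fun _ t => forall x, x \in t -> P x)) => //.
by move=> k u v us; exact: subdiv_rec_closed.
Qed.

End Subdivision.

Section Mesh.
Context {R : realFieldType} {V : normedModType R}.
Implicit Types s t : seq V.

Lemma bary_closed_dist (b : V) (M : R) : bary_closed (fun x => `|b - x| <= M).
Proof.
move=> s s0 hs; have n0 : (size s)%:R != 0 :> R.
  by rewrite pnatr_eq0 size_eq0.
have -> : b - bary s = (size s)%:R^-1 *: \sum_(x <- s) (b - x).
  rewrite sumrB scalerBr -/(bary s) big_const_seq iter_addr_0 count_predT.
  by rewrite -[b *+ _]scaler_nat scalerA mulVf// scale1r.
rewrite normrZ ger0_norm ?invr_ge0 ?ler0n// mulrC ler_pdivrMr; last first.
  by rewrite ltr0n lt0n size_eq0.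
rewrite (le_trans (ler_norm_sum _ _ _))// big_seq.
rewrite (@le_trans _ _ (\sum_(i <- s | i \in s) M))//; first exact: ler_sum.
by rewrite -big_seq big_const_seq iter_addr_0 count_predT mulr_natr.
Qed.

(** The term [x - x] in the average of the differences vanishes, which gains the
    factor [(k - 1) / k]. *)
Lemma bary_dist s (M : R) x : x \in s -> 0 <= M ->
  (forall y z, y \in s -> z \in s -> `|y - z| <= M) ->
  `|bary s - x| <= (size s).-1%:R / (size s)%:R * M.
Proof.
move=> xs M0 hs.
have sz : (0 < size s)%N by case: s xs {hs}.
have n0 : (size s)%:R != 0 :> R by rewrite pnatr_eq0 -lt0n.
have -> : bary s - x = (size s)%:R^-1 *: \sum_(y <- s) (y - x).
  rewrite sumrB scalerBr -/(bary s) big_const_seq iter_addr_0 count_predT.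
  by rewrite -[x *+ _]scaler_nat scalerA mulVf// scale1r.
rewrite normrZ ger0_norm ?invr_ge0 ?ler0n// mulrC [_ / _ * _]mulrAC.
rewrite ler_pM2r ?invr_gt0 ?ltr0n//.
rewrite (big_rem x xs) /= subrr add0r (le_trans (ler_norm_sum _ _ _))// big_seq.
rewrite (@le_trans _ _ (\sum_(i <- rem x s | i \in rem x s) M))//.
  by apply: ler_sum => i /mem_rem ims; exact: hs.
by rewrite -big_seq big_const_seq iter_addr_0 count_predT size_rem// mulr_natl.
Qed.

(** Two vertices either both lie in the subdivision of a face, or one of them is
    the barycentre; in the second case the distance is at most that from the
    barycentre to a vertex of [s]. *)
Lemma subdiv_rec_mesh k s t (M : R) : size s = k -> 0 <= M ->
  (forall y z, y \in s -> z \in s -> `|y - z| <= M) ->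
  t \in subdiv_rec k s ->
  forall y z, y \in t -> z \in t -> `|y - z| <= k.-1%:R / k%:R * M.
Proof.
elim: k s t M => [|k IH] s t M sz M0 hs /=; first by rewrite inE => /eqP->.
case/mapP => u /flatten_mapP[f fs uf] ->.
have sf : size f = k by move: (faces_size fs); rewrite sz => -[].
have B y : y \in u -> `|bary s - y| <= k%:R / k.+1%:R * M.
  have := @subdiv_rec_closed _ _ (fun x => `|bary s - x| <= k%:R / k.+1%:R * M) k f u.
  move=> /(_ (@bary_closed_dist _ _) sf); apply => // x xf.
  by have := bary_dist (mem_faces fs xf) M0 hs; rewrite sz.
move=> y z; rewrite !inE => /predU1P[->|yu] /predU1P[->|zu].
- by rewrite subrr normr0 mulr_ge0// divr_ge0.
- exact: B.
- by rewrite distrC; exact: B.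
- have := IH f u M sf M0 _ uf y z yu zu.
  move=> /(_ _)/le_trans; apply.
    by move=> a b /(mem_faces fs) ? /(mem_faces fs) ?; exact: hs.
  apply: ler_wpM2r => //.
  case: k {IH sf B uf sz} => [|k]; first by rewrite /= mul0r.
  rewrite /= ler_pdivrMr ?ltr0n// mulrAC ler_pdivlMr ?ltr0n//.
  by rewrite -!natrM ler_nat; lia.
Qed.

Lemma subdiv_iter_mesh N s t (M : R) : 0 <= M ->
  (forall y z, y \in s -> z \in s -> `|y - z| <= M) ->
  t \in subdiv_iter N [:: s] ->
  forall y z, y \in t -> z \in t ->
  `|y - z| <= ((size s).-1%:R / (size s)%:R) ^+ N * M.
Proof.
move=> M0 hs tN.
suff [] : size t = size s /\ forall y z, y \in t -> z \in t ->
  `|y - z| <= ((size s).-1%:R / (size s)%:R) ^+ N * M by [].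
move: N t tN; apply: subdiv_iter_ind => [k u t [su hu] tu|]; last first.
  by split=> // y z; rewrite expr0 mul1r; exact: hs.
split; first by rewrite -su; exact: subdiv_rec_size tu.
move=> y z yt zt; rewrite exprS -mulrA -{1 2}su.
apply: (subdiv_rec_mesh erefl _ hu tu yt zt).
by rewrite mulr_ge0// exprn_ge0// divr_ge0.
Qed.

End Mesh.

(** * The Tucker lemma on the cross-polytope *)

Section CrossPolytope.
Context {R : realFieldType} {d : nat}.
Notation V := 'cV[R]_d.

Definition axis (k : nat) : V := \col_i ((i : nat) == k)%:R.

(** The facets of the [k]-dimensional cross-polytope: the unit sphere of the
    norm [norm1], triangulated as the suspension of the sphere one dimension
    lower. *)
Fixpoint cross_boundary (k : nat) : seq (seq V) :=
  if k is k'.+1 then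
    map (cons (axis k')) (cross_boundary k') ++ map (cons (- axis k'))
      (cross_boundary k')
  else [:: [::]].

Definition norm1 (x : V) : R := \sum_i `|x i 0|.

Lemma cross_boundary_boundary k phi : parity phi (bind faces (cross_boundary k)) =
  false.
Proof.
elim: k phi => [|k IH] phi; first by rewrite /parity /bind big_nil.
by rewrite /= /bind map_cat flatten_cat parity_cat -!/(bind _ _)
  !parity_bind_faces_cons !IH !addbF addbb.
Qed.

Lemma cross_boundary_opp k phi : parity phi (map (map -%R) (cross_boundary k)) =
  parity phi (cross_boundary k).
Proof.
elim: k phi => [|k IH] phi //=.
rewrite map_cat !parity_cat -!map_comp.
have h (x : V) (psi : seq V -> bool) :
    parity psi [seq [eta map -%R] (x :: i) | i <- cross_boundary k] =
    parity psi (map (cons (- x)) (cross_boundary k)).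
  rewrite [RHS]parity_map -IH parity_map [LHS]parity_map.
  by apply: eq_parity.
by rewrite !h opprK addbC.
Qed.

(** Every facet lies in one orthant, described by a sign vector [eps], and in
    the hyperplane where the signed coordinates sum to one; both conditions pass
    to subdivisions. *)
Lemma cross_boundary_vertices k s : s \in cross_boundary k -> (k <= d)%N ->
  exists eps : 'I_d -> R,
  [/\ forall i, `|eps i| = 1 & forall x, x \in s ->
     \sum_i eps i * x i 0 = 1 /\ forall i, 0 <= eps i * x i 0].
Proof.
(* the induction fixes the signs of the first k coordinates only, and leaves the
   others prescribed by e *)
suff H (e : nat -> R) : (forall i, `|e i| = 1) -> s \in cross_boundary k ->
  (k <= d)%N ->
  exists eps : nat -> R,
  [/\ forall i, `|eps i| = 1, (forall i, (k <= i)%N -> eps i = e i) &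
    forall x, x \in s ->
     \sum_(i < d) eps i * x i 0 = 1 /\ forall i : 'I_d, 0 <= eps i * x i 0].
  move=> sk kd; have [|eps [h1 h2 h3]] := H (fun=> 1) _ sk kd.
    by move=> _; rewrite normr1.
  by exists eps; split.
move=> he; elim: k e he s => [|k IH] e he s.
  by rewrite inE => /eqP-> _; exists e; split.
rewrite /= mem_cat => H kd.
have [b [t tk ->]] : exists b : bool, exists2 t, t \in cross_boundary k &
    s = (-1) ^+ b *: axis k :: t.
  case/orP: H => /mapP[t tk ->]; [exists false|exists true]; exists t => //.
    by rewrite scale1r.
  by rewrite scaleN1r.
pose e' i := if i == k then (-1) ^+ b else e i.
have e'1 i : `|e' i| = 1.
  by rewrite /e'; case: ifP => // _; rewrite normrX normrN1 expr1n.
have [eps [h1 h2 h3]] := IH e' e'1 t tk (ltnW kd).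
exists eps; split => // [i ki|x].
  by rewrite h2 ?(ltnW ki)// /e' gtn_eqF.
rewrite inE => /orP[/eqP->|]; last exact: h3.
have epsk : eps k = (-1) ^+ b by rewrite h2// /e' eqxx.
have E (i : 'I_d) : eps i * ((-1) ^+ b *: axis k) i 0 = ((i : nat) == k)%:R.
  rewrite !mxE; case: eqP => [->|_]; last by rewrite !mulr0.
  by rewrite mulr1 epsk -signr_addb addbb.
split; last by move=> i; rewrite E.
under eq_bigr do rewrite E.
rewrite (bigD1 (Ordinal kd)) //= eqxx big1 ?addr0// => i.
by rewrite -val_eqE /= => /negbTE->.
Qed.

Lemma cross_boundary_size k s : s \in cross_boundary k -> size s = k.
Proof.
elim: k s => [|k IH] s /=; first by rewrite inE => /eqP->.
by rewrite mem_cat => /orP[] /mapP[t tk ->] /=; rewrite IH.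
Qed.

Lemma bary_mx (s : seq V) i :
  bary s i 0 = (size s)%:R^-1 * \sum_(x <- s) x i 0.
Proof. by rewrite mxE summxE. Qed.

Lemma bary_closed_facet (eps : 'I_d -> R) :
  bary_closed (fun x : V => \sum_i eps i * x i 0 = 1 /\
                        forall i, 0 <= eps i * x i 0).
Proof.
move=> s s0 hs; have n0 : (size s)%:R != 0 :> R by rewrite pnatr_eq0 size_eq0.
have E i : eps i * bary s i 0 = (size s)%:R^-1 * \sum_(x <- s) eps i * x i 0.
  by rewrite bary_mx mulrCA mulr_sumr.
split=> [|i]; last first.
  rewrite E mulr_ge0// big_seq sumr_ge0// => x xs.
  by have [_] := hs x xs; exact.
under eq_bigr do rewrite E.
rewrite -mulr_sumr exchange_big /= big_seq.
rewrite (eq_bigr (fun=> 1)); last by move=> x /hs[].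
by rewrite -big_seq big_const_seq iter_addr_0 count_predT mulVf.
Qed.

Lemma bary_closed_norm1 (M : R) : bary_closed (fun x : V => norm1 x <= M).
Proof.
move=> s s0 hs; rewrite /norm1.
under eq_bigr do rewrite bary_mx normrM ger0_norm ?invr_ge0//.
rewrite -mulr_sumr mulrC ler_pdivrMr ?ltr0n ?lt0n ?size_eq0//.
apply: (@le_trans _ _ (\sum_i \sum_(x <- s) `|x i 0|)).
  by apply: ler_sum => i _; exact: ler_norm_sum.
rewrite exchange_big big_seq (@le_trans _ _ (\sum_(i <- s | i \in s) M))//.
  by apply: ler_sum => x /hs.
by rewrite -big_seq big_const_seq iter_addr_0 count_predT mulr_natr.
Qed.

Lemma facet_norm1 (eps : 'I_d -> R) (x : V) : (forall i, `|eps i| = 1) ->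
  \sum_i eps i * x i 0 = 1 -> (forall i, 0 <= eps i * x i 0) -> norm1 x = 1.
Proof.
move=> e1 s1 pos; rewrite -s1; apply: eq_bigr => i _.
by rewrite -[RHS]ger0_norm// normrM e1 mul1r.
Qed.

Lemma subdiv_iter_cat N (c1 c2 : seq (seq V)) : subdiv_iter N (c1 ++ c2) =
  subdiv_iter N c1 ++ subdiv_iter N c2.
Proof.
elim: N c1 c2 => //= N IH c1 c2.
by rewrite -IH /bind map_cat flatten_cat.
Qed.

Lemma norm_norm1 (x : V) : `|x| <= norm1 x.
Proof.
rewrite [leLHS]/Num.Def.normr/= mx_normrE bigmax_le// => [|[i j] _].
  exact: sumr_ge0.
rewrite [j]ord1 /norm1 (bigD1 i)//= lerDl sumr_ge0//.
Qed.

Lemma norm1_norm (x : V) : norm1 x <= d%:R * `|x|.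
Proof.
rewrite /norm1 (le_trans (ler_sum _ (G := fun=> `|x|) _))//.
  by move=> i _; exact: norm_coord.
by rewrite sumr_const card_ord mulr_natl.
Qed.

(** Suppose that the labelling has no opposite labels on close points.  The
    number of alternating simplices of the sphere [cross_boundary k] starting
    with a positive sign is then odd for all [k <= d]: the boundary of the upper
    hemisphere is the sphere one dimension lower, so by Fan's identity its count
    is that of the simplices of the hemisphere alternating from either sign, and
    those starting with a negative sign are mirrored by the antipode into the
    lower hemisphere.  The last sphere bounds the ball, the cone over it with
    apex 0, where [alternating_labels_top] excludes alternating simplices of
    full dimension: the count would be even. *)
Lemma tucker (N : nat) (lab : V -> nat) :
  (forall x, ((lab x)./2 < d)%N) ->
  (forall x, norm1 x = 1 -> lab (- x) = flip (lab x)) ->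
  ~ (forall u v, norm1 u <= 1 -> norm1 v <= 1 ->
       `|u - v| <= (d%:R / d.+1%:R) ^+ N * 2 ->
       (lab u)./2 = (lab v)./2 -> lab u = lab v).
Proof.
move=> labd labo hnc.
(* cones over spheres, with apex on the next axis or at the origin, stay in the
   unit ball and have small simplices after N subdivisions *)
have cone_nc k (x : V) s : (k <= d)%N -> norm1 x <= 1 ->
    s \in subdiv_iter N (map (cons x) (cross_boundary k)) ->
      no_complementary (map lab s).
  move=> kd x1 sN _ _ /mapP[u us ->] /mapP[v vs ->].
  have [s' /mapP[t tk ->] sN'] := subdiv_iter_mem sN.
  have b1 y : y \in x :: t -> norm1 y <= 1.
    have [eps [e1 e2]] := cross_boundary_vertices tk kd.
    rewrite inE => /predU1P[->//|/e2[e3 e4]].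
    by rewrite (facet_norm1 e1).
  apply: hnc.
  - exact: (subdiv_iter_closed (@bary_closed_norm1 1) b1 sN' us).
  - exact: (subdiv_iter_closed (@bary_closed_norm1 1) b1 sN' vs).
  have := subdiv_iter_mesh (ler0n _ 2) _ sN' us vs.
  rewrite /= (cross_boundary_size tk) => h.
  apply: le_trans (h _) _.
    move=> y z /b1 y1 /b1 z1; rewrite (le_trans (ler_normB _ _))//.
    rewrite [leRHS](_ : _ = 1 + 1 :> R)// lerD//;
      exact: le_trans (norm_norm1 _) _.
  rewrite ler_wpM2r// lerXn2r ?nnegrE ?divr_ge0//.
  rewrite ler_pdivrMr ?ltr0n// mulrAC ler_pdivlMr ?ltr0n//.
  by rewrite -!natrM ler_nat; lia.
pose A b s := alternating_labels b (map lab s).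
have A_faces b s : parity (A b) (faces s) = A b s (+) A (~~ b) s.
  by rewrite /A -alternating_labels_faces faces_map /parity big_map.
have A_bd b c : parity (A b) (bind faces c) = parity (A b) c (+) parity (A (~~ b)) c.
  rewrite parity_bind -parity_add; apply: eq_parity => s; exact: A_faces.
have cone_bd (x : V) k phi :
    parity phi (bind faces (map (cons x) (cross_boundary k))) =
      parity phi (cross_boundary k).
  by rewrite parity_bind_faces_cons cross_boundary_boundary addbF.
have par k : (k <= d)%N -> parity (A true) (subdiv_iter N (cross_boundary k)) = true.
  elim: k => [_|k IH kd].
    have -> : subdiv_iter N (cross_boundary 0) = [:: [::]] by elim: (N) => //= M IH.
    by rewrite /parity big_seq1.
  transitivity (parity (A true) (subdiv_iter N (cross_boundary k)));
    last exact: IH (ltnW kd).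
  apply/esym.
  rewrite -(subdiv_iter_congr N (cone_bd (axis k) k)) -bind_faces_subdiv_iter A_bd.
  rewrite [cross_boundary _.+1]/= subdiv_iter_cat parity_cat; congr (_ (+) _).
  transitivity (parity (A true)
    (subdiv_iter N (map (map -%R) (map (cons (axis k)) (cross_boundary k)))));
      last first.
    apply: subdiv_iter_congr => phi; rewrite [RHS]parity_map -cross_boundary_opp.
    by rewrite !parity_map; apply: eq_parity.
  rewrite subdiv_iter_opp parity_map /parity big_seq [RHS]big_seq;
    apply: eq_bigr => s sN.
  rewrite /A /= -map_comp -[false]/(~~ true) -alternating_labels_flip; last first.
    apply: cone_nc sN; first exact: ltnW.
    rewrite /norm1 (bigD1 (Ordinal kd)) //= mxE eqxx normr1 big1 ?addr0// => i.
    by rewrite -val_eqE mxE /= => /negbTE->; rewrite normr0.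
  rewrite -map_comp; congr alternating_labels; apply/eq_in_map => x xs /=;
    rewrite labo//.
  have [s' /mapP[t tk ->] sN'] := subdiv_iter_mem sN.
  have tS : axis k :: t \in cross_boundary k.+1 by rewrite mem_cat map_f.
  have [eps [e1 e2]] := cross_boundary_vertices tS kd.
  have [e3 e4] := subdiv_iter_closed (@bary_closed_facet eps) e2 sN' xs.
  exact: facet_norm1 e1 e3 e4.
(* the sphere of full dimension bounds the ball, inside which nothing alternates *)
have := par d (leqnn d).
rewrite -(subdiv_iter_congr N (cone_bd 0 d)) -bind_faces_subdiv_iter A_bd.
have top b : parity (A b) (subdiv_iter N (map (cons 0) (cross_boundary d))) = false.
  rewrite /parity big_seq big1// => s sN.
  apply: (@alternating_labels_top b d); first apply: cone_nc sN => //.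
  - by rewrite /norm1 big1// => i _; rewrite mxE normr0.
  - by move=> _ /mapP[x _ ->].
  have [s' + /subdiv_iter_size] := subdiv_iter_mem sN; rewrite size_map => + ->.
  by case/mapP => t td -> /=; rewrite (cross_boundary_size td).
by rewrite !top.
Qed.

End CrossPolytope.

(** * Zeros of maps that are odd on the boundary *)

Section Borsuk.
Context {R : realType} {d : nat}.
Notation V := 'cV[R]_d.+1.

Lemma norm1_continuous : continuous (@norm1 R d.+1).
Proof.
apply: continuous_big => [|i _ x]; first exact: add_continuous.
by apply: cvg_norm; [exact: nbhs_filter|exact: (@coord_continuous R d.+1 1 i 0 x)].
Qed.

Lemma compact_norm1 : compact [set x : V | norm1 x <= 1].
Proof.
apply: (@subclosed_compact _ _ [set x : V | `|x| <= 1]).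
- apply: (@preimage_closed _ _ (@norm1 R d.+1) [set y | y <= 1]).
    by move=> ? _; exact: norm1_continuous.
  exact: closed_le.
- exact: compact_cball.
- by move=> x; apply: le_trans; exact: norm_norm1.
Qed.

Definition argmax (x : V) := [arg max_(i > ord0) `|x i 0|]%O.

Lemma argmaxE (x : V) : `|x| = `|x (argmax x) 0|.
Proof.
rewrite /argmax; case: arg_maxP => // i _ hi; apply/eqP.
by rewrite eq_le norm_coord andbT norm_le_coord// => j; exact: hi.
Qed.

Lemma argmaxN (x : V) : argmax (- x) = argmax x.
Proof.
rewrite /argmax; congr (Order.arg_max _ _ _).
by apply/funext => i; rewrite mxE normrN.
Qed.

(** Label a point by the coordinate of largest modulus of [G x] and its sign.
    Where [G] does not vanish, opposite labels of the same coordinate force a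
    jump of [G] of a definite size, which uniform continuity forbids on a fine
    subdivision; so the labelling would contradict [tucker]. *)
Lemma odd_boundary_zero (G : V -> V) : continuous G ->
  (forall x, norm1 x = 1 -> G (- x) = - G x) ->
  exists x, norm1 x <= 1 /\ G x = 0.
Proof.
move=> cG oG; apply: contrapT => nz.
have Gn0 x : norm1 x <= 1 -> G x != 0.
  by move=> x1; apply/eqP => Gx; apply: nz; exists x.
pose lab x := ((argmax (G x)).*2 + (0 < G x (argmax (G x)) ord0)%R)%N.
have labh x : (lab x)./2 = argmax (G x).
  by rewrite /lab addnC half_bit_double.
have labo x : odd (lab x) = (0 < G x (argmax (G x)) 0).
  by rewrite /lab oddD odd_double /=; case: (0 < _).
have coord0 x : norm1 x <= 1 -> G x (argmax (G x)) 0 != 0.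
  by move=> /Gn0; rewrite -normr_eq0 argmaxE normr_eq0.
(* uniformity of e over the ball is compactness, in the form that a property
   holding near every point of a compact set, for small parameters, holds on the
   whole set for small parameters *)
have [e e0 he] : exists2 e : R, 0 < e & forall u v, norm1 u <= 1 -> norm1 v <= 1 ->
    `|u - v| < e -> (lab u)./2 = (lab v)./2 -> lab u = lab v.
  have := (near_covering_withinP _).2 ((compact_near_coveringP _).1 compact_norm1).
  move=> /(_ R 0^'+ (fun e u => forall v, norm1 u <= 1 -> norm1 v <= 1 ->
    `|u - v| < e -> (lab u)./2 = (lab v)./2 -> lab u = lab v)) /(_ _) H.
  have {H} : \forall e \near 0^'+, [set x : V | norm1 x <= 1] `<=` 
    (fun u => forall v, norm1 u <= 1 -> norm1 v <= 1 ->
    `|u - v| < e -> (lab u)./2 = (lab v)./2 -> lab u = lab v).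
    apply: H => x x1.
    have m0 : 0 < `|G x| / 3 by rewrite divr_gt0// normr_gt0 Gn0.
    have [r r0 hr] := (continuous_atP _ _).1 (cG x) _ m0.
    exists (ball x (r / 2), [set e | e < r / 2]).
      split; first by apply: nbhsx_ballx; rewrite divr_gt0.
      by apply: nbhs_right_lt; rewrite divr_gt0.
    move=> [u e] [/= xu er] _ v u1 v1 uv huv.
    have Gu : `|G x - G u| < `|G x| / 3.
      apply: hr; move: xu; rewrite -ball_normE /= => /lt_le_trans; apply.
      by rewrite ler_pdivrMr// ler_peMr// ?ltW// ltr1n.
    have Gv : `|G x - G v| < `|G x| / 3.
      apply: hr; rewrite (splitr r) -(subrKA u).
      rewrite (le_lt_trans (ler_normD _ _))// ltrD//; last exact: lt_trans er.
      by move: xu; rewrite -ball_normE.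
    have uvG : `|G u - G v| < 2 * (`|G x| / 3).
      rewrite -(subrKA (G x)) (le_lt_trans (ler_normD _ _))//.
      by rewrite mulr_natl mulr2n ltrD// distrC.
    have Gul : 2 * (`|G x| / 3) < `|G u|.
      have : `|G x| <= `|G x - G u| + `|G u| by rewrite -{1}(subrK (G u) (G x))
        ler_normD.
      lra.
    move: huv; rewrite !labh => /val_inj huv.
    have c := norm_coord (G u - G v) (argmax (G u)).
    rewrite /lab -huv; congr (_ + nat_of_bool _)%N.
    move: (Gul); rewrite [ltRHS]argmaxE => Gul'.
    move: c; rewrite !mxE => c.
    have {}c := le_lt_trans c uvG.
    move: c; rewrite ltr_norml => /andP[c1 c2].
    case: (ltrgt0P (G u (argmax (G u)) 0)) => hu.
    - by apply/esym; move: Gul'; rewrite gtr0_norm// => ?; lra.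
    - move: Gul'; rewrite ltr0_norm// => ?.
      by apply/esym/negbTE; rewrite -leNgt; lra.
    - by move: Gul'; rewrite hu normr0 => ?; lra.
  move=> He.
  have [e [he e0]] := filter_ex (filterI He (nbhs_right_gt 0)).
  by exists e => // u v u1; exact: he.
have [N hN] : exists N, (d.+1%:R / d.+2%:R) ^+ N * 2 < e.
  have q1 : `|d.+1%:R / d.+2%:R : R| < 1.
    by rewrite ger0_norm ?divr_ge0// ltr_pdivrMr ?ltr0n// mul1r ltr_nat.
  have e2 : 0 < e / 2 by rewrite divr_gt0.
  have /cvgrPdist_lt/(_ _ e2)[N _ hN] := cvg_expr q1.
  exists N; move: (hN N (leqnn N)).
  rewrite /= sub0r normrN ger0_norm ?exprn_ge0 ?divr_ge0//.
  by rewrite ltr_pdivlMr.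
apply: (@tucker R d.+1 N lab) => //.
- by move=> x; rewrite labh ltn_ord.
- move=> x x1.
  have nx : G x (argmax (G x)) 0 != 0 by apply: coord0; rewrite x1.
  rewrite /lab oG// argmaxN mxE oppr_gt0 /flip oddD odd_double /=.
  case: ltrgt0P nx => //= _ _; first by rewrite addn1 addn0.
  by rewrite addn0 addn1.
- by move=> u v u1 v1 uv; apply: he => //; exact: le_lt_trans uv hN.
Qed.

End Borsuk.

(** * Injective radially unbounded maps are onto *)

Section Surjectivity.
Context {R : realType} {d : nat}.
Notation V := 'cV[R]_d.+1.

Lemma norm1Z (c : R) (x : V) : norm1 (c *: x) = `|c| * norm1 x.
Proof. by rewrite /norm1 mulr_sumr; apply: eq_bigr => i _; rewrite mxE normrM. Qed.

(** The map [G] below is continuous on the unit ball of [norm1] and odd on its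
    boundary, so it has a zero.  In the inner third [b = 0], and a zero of [G]
    solves [F z = y0].  In the middle third [c = 0] and [a x] is far from the
    origin: there [|F (a x)|] exceeds [|y0| + |F 0|], so [y0] can be moved to [F 0]
    without creating zeros.  In the outer third [b = 1], and a zero would
    be [F z = F (- c z)] with [z != 0] and [c >= 0], against injectivity. *)
Theorem continuous_injective_surjective (F : V -> V) :
  continuous F -> injective F ->
  (forall rho, exists sigma, forall x, sigma <= `|x| -> rho <= `|F x|) ->
  forall y, exists x, F x = y.
Proof.
move=> cF iF rF y0.
pose M := `|y0| + `|F 0| + 1.
have [sg hsg] := rF M.
(* norm1 exceeds the maximum norm by at most the factor d.+1, hence norm1 equal
   to rho forces a maximum norm beyond sg *)
pose rho := d.+1%:R * (`|sg| + 1).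
have rho0 : 0 < rho by rewrite mulr_gt0// ltr_pwDr.
pose clamp (t : R) := Num.min 1 (Num.max 0 t).
(* a spreads the inner third over the ball of radius rho of norm1, and sends the
   rest to the sphere of that radius *)
pose a (x : V) := (rho / Num.max (norm1 x) 3^-1) *: x.
pose b (x : V) := clamp (3 * norm1 x - 1).
pose c (x : V) := clamp (3 * norm1 x - 2).
pose G x := F (a x) - ((1 - b x) *: y0 + b x *: F (- (c x *: a x))).
have con : continuous (@norm1 R d.+1) by exact: norm1_continuous.
have ccl (u v : R) : continuous (fun x : V => clamp (u * norm1 x - v)).
  move=> x.
  apply: (@continuous_min _ V (cst 1) (cst 0 \max (fun x => u * norm1 x - v))).
    exact: cst_continuous.
  apply: (@continuous_max _ V (cst 0)); first exact: cst_continuous.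
  apply: continuousB; last exact: cst_continuous.
  by apply: continuousM; [exact: cst_continuous|exact: con].
have ca : continuous a.
  move=> x; apply: (@continuousZ _ _ V (fun x => rho / Num.max (norm1 x) 3^-1) id);
    last exact: cvg_id.
  apply: continuousM; first exact: cst_continuous.
  apply: continuousV; first by rewrite gt_eqF// lt_max invr_gt0 ltr0n orbT.
  apply: (@continuous_max _ V (@norm1 R d.+1) (cst 3^-1)); first exact: con.
  exact: cst_continuous.
have cG : continuous G.
  move=> x.
  apply: (@continuousB _ _ V (F \o a)
    (fun x => (1 - b x) *: y0 + b x *: F (- (c x *: a x)))).
    by apply: continuous_comp; [exact: ca|exact: cF].
  apply: (@continuousD _ _ V (fun x => (1 - b x) *: y0)
    (fun x => b x *: F (- (c x *: a x)))).
    apply: (@continuousZ _ _ V (fun x => 1 - b x) (cst y0)); last first.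
      exact: cst_continuous.
    by apply: continuousB; [exact: cst_continuous|exact: ccl].
  apply: (@continuousZ _ _ V b (fun x => F (- (c x *: a x)))); first exact: ccl.
  apply: (@continuous_comp V V V (fun x => - (c x *: a x)) F); last exact: cF.
  by apply: (@continuousN _ _ V (fun x => c x *: a x)); apply: (@continuousZ _ _ V c a);
    [exact: ccl|exact: ca].
have oN (x : V) : norm1 (- x) = norm1 x by rewrite -[- x]scaleN1r norm1Z normrN1 mul1r.
have aN (x : V) : a (- x) = - a x by rewrite /a oN scalerN.
have [|x [x1 Gx]] := odd_boundary_zero cG.
  move=> x x1; rewrite /G /b /c aN oN x1.
  have -> : clamp (3 * 1 - 1) = 1 by rewrite /clamp max_r ?min_l//; lra.
  have -> : clamp (3 * 1 - 2) = 1 by rewrite /clamp max_r ?min_l//; lra.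
  by rewrite subrr scale0r !add0r !scale1r opprK opprB.
move: Gx => /eqP; rewrite /G subr_eq0 => /eqP.
(* inner third: a zero of G is a solution *)
have [s1|s1] := leP (3 * norm1 x - 1) 0.
  rewrite /b /clamp (max_l s1) min_r ?ler01//.
  by rewrite subr0 scale1r scale0r addr0 => <-; exists (a x).
have sm : Num.max (norm1 x) 3^-1 = norm1 x by rewrite max_l//; lra.
have s0 : 0 < norm1 x by lra.
have an : sg <= `|a x|.
  have : norm1 (a x) = rho.
    by rewrite norm1Z sm ger0_norm ?mulfVK ?gt_eqF// divr_ge0// ltW.
  have := norm1_norm (a x) => /[swap] ->; rewrite /rho ler_pM2l ?ltr0n//.
  by have := ler_norm sg; lra.
have Fa := hsg _ an.
have b01 : 0 <= b x <= 1.
  by rewrite /b /clamp le_min ler01 le_max lexx ge_min lexx.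
(* middle third: F (a x) is too large for a zero *)
have [s2|s2] := leP (3 * norm1 x - 2) 0.
  rewrite /c /clamp (max_l s2) min_r ?ler01//.
  rewrite scale0r oppr0 => FE; exfalso; move: Fa; rewrite FE; apply/negP.
  rewrite -ltNge (le_lt_trans (ler_normD _ _))// !normrZ.
  have /andP[b0 b1] := b01.
  rewrite (ger0_norm b0) ger0_norm ?subr_ge0//.
  have : (1 - b x) * `|y0| <= `|y0| by rewrite ler_piMl// lerBlDl lerDr.
  have : b x * `|F 0| <= `|F 0| by rewrite ler_piMl.
  by rewrite /M; lra.
(* outer third: a zero of G contradicts injectivity *)
have -> : b x = 1 by rewrite /b /clamp max_r ?min_l//; lra.
rewrite subrr scale0r add0r scale1r => /iF/eqP; rewrite -addr_eq0 -{1}[a x]scale1r.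
rewrite -scalerDl scaler_eq0 => /orP[|/eqP a0].
  have : 0 <= c x by rewrite /c /clamp le_min ler01 le_max lexx.
  by move=> c0; rewrite gt_eqF//; lra.
have : norm1 (a x) = 0 by rewrite a0 /norm1 big1// => i _; rewrite mxE normr0.
rewrite norm1Z sm => /eqP; rewrite mulf_eq0 (gt_eqF s0) orbF normr_eq0.
by rewrite mulf_eq0 (gt_eqF rho0) invr_eq0 (gt_eqF s0).
Qed.

End Surjectivity.

(** * Lebesgue integrals over bounded intervals *)

Section Lebesgue.
Context {R : realType}.
Notation lR := (lebesgueR R).
Notation mu := (@leb R).
Notation bmu := (@lebesgue_measure R).
Implicit Types (A : set R) (f g : R -> R) (a b c t : R).

Lemma borel_lebesgue A :
  measurable (A : set (measurableTypeR R)) -> measurable (A : set lR).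
Proof. by move=> mA; exact: sub_caratheodory. Qed.

Lemma leb_borel A : mu A = bmu A. Proof. by []. Qed.

Lemma mitv (i : interval R) : measurable ([set` i] : set lR).
Proof. by apply: borel_lebesgue; exact: measurable_itv. Qed.

Lemma leb_oc a b : a <= b -> mu `]a, b]%classic = (b - a)%:E.
Proof.
move=> ab; rewrite leb_borel lebesgue_measure_itv /= lte_fin.
by move: ab; rewrite le_eqVlt => /predU1P[->|->]; rewrite ?ltxx ?subrr.
Qed.

(** Half-open intervals are used so that integrals over adjacent intervals add up
    without exceptional points; for [b <= a] the integral is zero. *)
Definition integ g a b := mu.-integrable `]a, b]%classic (EFin \o g).
Definition Lint g a b : R := \int[mu]_(t in `]a, b]%classic) g t.

Lemma integ_sub g a b a' b' : integ g a b -> a <= a' -> b' <= b -> integ g a' b'.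
Proof.
move=> ig aa bb; apply: integrableS ig; [exact: mitv|exact: mitv|].
by apply: subset_itv; rewrite bnd_simp.
Qed.

Lemma integ_measurable g a b : integ g a b ->
  measurable_fun (`]a, b]%classic : set lR) g.
Proof. by move=> /measurable_int/measurable_EFinP. Qed.

Lemma integ_le f g a b : measurable_fun (`]a, b]%classic : set lR) f ->
  (forall t, t \in `]a, b] -> `|f t| <= g t) -> integ g a b -> integ f a b.
Proof.
move=> mf fg ig; apply: le_integrable ig; first exact: mitv.
  exact/measurable_EFinP.
move=> t /= ht; by rewrite lee_fin (le_trans (fg t ht))// ler_norm.
Qed.

Lemma integ_norm g a b : integ g a b -> integ (fun t => `|g t|) a b.
Proof. by move=> /integrable_norm; apply: eq_integrable => //; exact: mitv. Qed.

Lemma integD f g a b : integ f a b -> integ g a b -> integ (fun t => f t + g t) a b.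
Proof.
move=> h1 h2; have := integrableD (mitv _) h1 h2.
by apply: eq_integrable => //; exact: mitv.
Qed.

Lemma integB f g a b : integ f a b -> integ g a b -> integ (fun t => f t - g t) a b.
Proof.
move=> h1 h2; have := integrableB (mitv _) h1 h2.
by apply: eq_integrable => //; exact: mitv.
Qed.

Lemma integZ k g a b : integ g a b -> integ (fun t => k * g t) a b.
Proof.
move=> h1; have := integrableZl (mitv _) k h1.
by apply: eq_integrable => //; exact: mitv.
Qed.

Lemma integ_cst k a b : integ (fun=> k) a b.
Proof.
apply: measurable_bounded_integrable => //; first exact: mitv.
  have [ab|ba] := leP a b; first by rewrite leb_oc// ltry.
  by rewrite set_itv_ge ?measure0 ?ltry// bnd_simp -leNgt ltW.
by exists `|k|; split => // M hM x _ /=; rewrite ltW.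
Qed.

Lemma Lint_ge g a b : b <= a -> Lint g a b = 0.
Proof.
by move=> ba; rewrite /Lint set_itv_ge ?bnd_simp -?leNgt// Rintegral_set0.
Qed.

Lemma Lint_split g a b c : a <= b -> b <= c -> integ g a c ->
  Lint g a c = Lint g a b + Lint g b c.
Proof.
move=> ab bc ig; rewrite /Lint.
have E : `]a, c]%classic = `]a, b]%classic `|` `]b, c]%classic :> set R.
  apply/seteqP; split => x /=; rewrite !in_itv /=.
    by case/andP => ax xc; case: (leP x b) => xb; [left|right]; rewrite ?ax ?xb.
  case=> /andP[h1 h2]; first by rewrite h1 (le_trans h2).
  by rewrite h2 (le_lt_trans ab).
rewrite E Rintegral_setU//; [exact: mitv|exact: mitv|by rewrite -E|].
apply/disj_set2P; apply/seteqP; split => // x [] /=; rewrite !in_itv /=.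
by move=> /andP[_ xb] /andP[/(le_lt_trans xb)]; rewrite ltxx.
Qed.

Lemma Lint_ge0 g a b : (forall t, t \in `]a, b] -> 0 <= g t) -> 0 <= Lint g a b.
Proof. by move=> h; apply: Rintegral_ge0. Qed.

Lemma le_Lint f g a b : integ f a b -> integ g a b ->
  (forall t, t \in `]a, b] -> f t <= g t) -> Lint f a b <= Lint g a b.
Proof. by move=> h1 h2 h; apply: le_Rintegral => //; exact: mitv. Qed.

Lemma Lint_norm g a b : integ g a b -> `|Lint g a b| <= Lint (fun t => `|g t|) a b.
Proof. by move=> h; apply: le_normr_Rintegral => //; exact: mitv. Qed.

Lemma LintD f g a b : integ f a b -> integ g a b ->
  Lint (fun t => f t + g t) a b = Lint f a b + Lint g a b.
Proof. by move=> h1 h2; apply: RintegralD => //; exact: mitv. Qed.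

Lemma LintB f g a b : integ f a b -> integ g a b ->
  Lint (fun t => f t - g t) a b = Lint f a b - Lint g a b.
Proof. by move=> h1 h2; apply: RintegralB => //; exact: mitv. Qed.

Lemma LintZ k g a b : integ g a b ->
  Lint (fun t => k * g t) a b = k * Lint g a b.
Proof. by move=> h1; apply: RintegralZl => //; exact: mitv. Qed.

Lemma Lint_cst k a b : a <= b -> Lint (fun=> k) a b = k * (b - a).
Proof. by move=> ab; rewrite /Lint Rintegral_cst ?leb_oc//; exact: mitv. Qed.

Lemma eq_Lint f g a b : (forall t, t \in `]a, b] -> f t = g t) ->
  Lint f a b = Lint g a b.
Proof. by move=> h; apply: eq_Rintegral => t; rewrite inE; exact: h. Qed.

Lemma Lint_mono g a b a' b' : integ g a b -> a <= a' -> b' <= b ->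
  (forall t, t \in `]a, b] -> 0 <= g t) -> Lint g a' b' <= Lint g a b.
Proof.
move=> ig aa bb g0; have [ab|ba] := leP a' b'; last first.
  by rewrite Lint_ge ?Lint_ge0// ltW.
rewrite (@Lint_split _ a a' b) ?(le_trans ab)//.
rewrite (@Lint_split _ a' b' b)//; last exact: integ_sub ig _ _.
rewrite addrCA lerDl addr_ge0// Lint_ge0// => t; rewrite in_itv /= => /andP[h1 h2];
  apply: g0; rewrite in_itv /=.
- by rewrite h1 (le_trans h2)// (le_trans ab).
- by rewrite h2 (le_lt_trans _ h1)// (le_trans aa).
Qed.

End Lebesgue.

(** * Absolute continuity of the integral *)

Section AbsoluteContinuity.
Context {R : realType}.
Notation lR := (lebesgueR R).
Notation mu := (@leb R).
Implicit Types (f g : R -> R) (a b c t : R).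

Lemma LintE g a b : integ g a b ->
  (Lint g a b)%:E = (\int[mu]_(t in `]a, b]%classic) (g t)%:E)%E.
Proof. by move=> ig; rewrite fineK// integrable_fin_num//; exact: mitv. Qed.

Lemma sum_Lint_le g a b N (p q : 'I_N -> R) :
  integ g a b -> (forall t, t \in `]a, b] -> 0 <= g t) ->
  (forall i, [/\ a <= p i, q i <= b & p i <= q i]) ->
  (forall i j, i != j -> q i <= p j \/ q j <= p i) ->
  \sum_i Lint g (p i) (q i) <= Lint g a b.
Proof.
move=> ig g0 pq dis.
have sub i : `]p i, q i]%classic `<=` `]a, b]%classic.
  by have [? ? ?] := pq i; apply: subset_itv; rewrite bnd_simp.
rewrite -lee_fin LintE// -sumEFin.
under eq_bigr => i _.
  rewrite LintE; last by have [? ? ?] := pq i; apply: integ_sub ig _ _.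
  over.
have tri : trivIset [set` index_enum 'I_N] (fun i => `]p i, q i]%classic).
  move=> i j _ _ [x [/=]]; rewrite !in_itv /= => /andP[h1 h2] /andP[h3 h4].
  apply/eqP/negPn/negP => /dis[h|h].
    by move: (le_lt_trans (le_trans h2 h) h3); rewrite ltxx.
  by move: (le_lt_trans (le_trans h4 h) h1); rewrite ltxx.
rewrite -(@ge0_integral_bigsetU _ _ _ mu _ (fun i => `]p i, q i]%classic)
  (EFin \o g) (index_enum 'I_N))//.
- apply: ge0_subset_integral => //.
  + by apply: bigsetU_measurable => i _; exact: mitv.
  + exact: mitv.
  + exact: (measurable_int mu).
  + by rewrite -bigcup_seq; apply: bigcup_sub => i _; exact: sub.
- by move=> i; exact: mitv.
- exact: index_enum_uniq.
- apply: measurable_funS (measurable_int mu ig); first exact: mitv.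
  by rewrite -bigcup_seq; apply: bigcup_sub => i _; exact: sub.
- by move=> x; rewrite -bigcup_seq => -[i _ /sub xi]; rewrite lee_fin g0.
Qed.

Lemma Lint_cvg (f_ : nat -> R -> R) f g a b :
  (forall n, measurable_fun (`]a, b]%classic : set lR) (f_ n)) ->
  (forall t, t \in `]a, b] -> f_ n t @[n --> \oo] --> f t) ->
  integ g a b ->
  (forall n t, t \in `]a, b] -> `|f_ n t| <= g t) ->
  integ f a b /\ Lint (f_ n) a b @[n --> \oo] --> Lint f a b.
Proof.
move=> mf cf ig fg.
have mfl : measurable_fun (`]a, b]%classic : set lR) f.
  by apply: (measurable_fun_cvg mf) => x xab; exact: cf.
have [||||| if_ _ c] := @dominated_convergence _ (lR) R mu `]a, b]%classic (mitv _)
   (fun n => EFin \o f_ n) (EFin \o f) (EFin \o g).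
- by move=> n; exact/measurable_EFinP.
- exact/measurable_EFinP.
- by apply: aeW => t tab; apply/cvg_EFin; [exact: nearW|exact: cf].
- exact: ig.
- by apply: aeW => t n tab /=; rewrite lee_fin fg.
split=> //.
have fin n : integ (f_ n) a b by apply: (integ_le (mf n) _ ig) => t; exact: fg.
by rewrite -LintE// in c; exact: fine_cvg c.
Qed.

(** Truncate [g] at a height [n] so large that the excess has integral below
    [e / 2], by dominated convergence; the bounded part contributes at most [n]
    times the total length. *)
Lemma Lint_abs_cont g a b : integ g a b -> (forall t, t \in `]a, b] -> 0 <= g t) ->
  forall e, 0 < e -> exists2 d, 0 < d &
  forall N (p q : 'I_N -> R),
  (forall i, [/\ a <= p i, q i <= b & p i <= q i]) ->
  (forall i j, i != j -> q i <= p j \/ q j <= p i) ->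
  \sum_i (q i - p i) < d -> \sum_i Lint g (p i) (q i) < e.
Proof.
move=> ig g0 e e0.
pose gn (n : nat) t := Num.min (g t) n%:R.
have mg := integ_measurable ig.
have mgn n : measurable_fun (`]a, b]%classic : set lR) (gn n).
  by apply: measurable_minr => //; exact: measurable_cst.
have gn0 n t : t \in `]a, b] -> 0 <= gn n t by move=> h; rewrite le_min g0//=.
have gnle n t : gn n t <= g t by rewrite ge_min lexx.
have ign n : integ (gn n) a b.
  by apply: integ_le ig => // t h; rewrite ger0_norm ?gn0.
have [] := @Lint_cvg (fun n t => g t - gn n t) (fun=> 0) g a b.
- by move=> n; exact: measurable_funB.
- move=> t h; apply/cvgrPdist_lt => r r0; near=> n.
  rewrite /gn min_l ?subrr ?subr0 ?normr0//.
  rewrite (le_trans (ltW (archi_boundP (g0 t h))))// ler_nat.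
  by near: n; exact: nbhs_infty_ge.
- exact: ig.
- by move=> n t h; rewrite ger0_norm ?subr_ge0// lerBlDr lerDl gn0.
move=> _.
have -> : Lint (fun=> 0 : R) a b = 0.
  by rewrite /Lint (Rintegral_cst _ (mitv _)) mul0r.
have e2 : 0 < e / 2 by rewrite divr_gt0.
move=> /cvgrPdist_lt/(_ _ e2)[n _ /(_ n (leqnn n))].
rewrite /= sub0r normrN => hn.
exists (e / 2 / n.+1%:R); first by rewrite divr_gt0.
move=> N p q pq dis subdiv.
have ipq f i : integ f a b -> integ f (p i) (q i).
  by move=> h; have [? ? ?] := pq i; apply: integ_sub h _ _.
rewrite (eq_bigr (fun i => Lint (gn n) (p i) (q i) +
    Lint (fun t => g t - gn n t) (p i) (q i))); last first.
  move=> i _; rewrite -LintD ?ipq//; last exact: integB.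
  by apply: eq_Lint => t _; rewrite addrC subrK.
rewrite big_split /= [ltRHS](splitr e) ltr_leD//; last first.
  apply: le_trans (ltW hn); rewrite ger0_norm; last first.
    by apply: Lint_ge0 => t _; rewrite subr_ge0.
  by apply: sum_Lint_le => //; [exact: integB|move=> t _; rewrite subr_ge0].
have : \sum_i Lint (gn n) (p i) (q i) <= \sum_i n%:R * (q i - p i).
  apply: ler_sum => i _; have [h1 h2 h3] := pq i.
  rewrite -Lint_cst// le_Lint ?ipq//; first exact: integ_cst.
  by move=> t _; rewrite ge_min lexx orbT.
move/le_lt_trans; apply; rewrite -mulr_sumr.
have s0 : 0 <= \sum_i (q i - p i).
  by apply: sumr_ge0 => i _; rewrite subr_ge0; case: (pq i).
rewrite (@le_lt_trans _ _ (n.+1%:R * \sum_i (q i - p i)))//.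
  by rewrite ler_wpM2r// ler_nat.
by move: subdiv; rewrite ltr_pdivlMr// mulrC.
Unshelve. all: by end_near. Qed.

Definition scalar_ac (X : R -> R) a b := forall e, 0 < e -> exists2 d, 0 < d &
  forall N (p q : 'I_N -> R),
  (forall i, [/\ a <= p i, q i <= b & p i <= q i]) ->
  (forall i j, i != j -> q i <= p j \/ q j <= p i) ->
  \sum_i (q i - p i) < d -> \sum_i `|X (q i) - X (p i)| < e.

Lemma scalar_ac_Lint g a b (c : R) : integ g a b ->
  scalar_ac (fun t => c + Lint g a t) a b.
Proof.
move=> ig e e0.
have [//|d d0 hd] := Lint_abs_cont (integ_norm ig) _ e0.
exists d => // N p q pq dis subdiv.
apply: le_lt_trans (hd N p q pq dis subdiv); apply: ler_sum => i _.
have [h1 h2 h3] := pq i.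
rewrite (@Lint_split _ _ a (p i) (q i)) ?h1//; last first.
  by apply: integ_sub ig _ _.
rewrite addrA [c + _]addrC addrAC; rewrite [_ + Lint g (p i) _]addrC.
rewrite (_ : _ - _ = Lint g (p i) (q i)); last by ring.
by apply: Lint_norm; apply: integ_sub ig _ _.
Qed.

Lemma Lint_small g a b : integ g a b -> (forall t, t \in `]a, b] -> 0 <= g t) ->
  forall e, 0 < e -> exists2 d, 0 < d &
  forall p q, a <= p -> p <= q -> q <= b -> q - p < d -> Lint g p q < e.
Proof.
move=> ig g0 e e0; have [d d0 hd] := Lint_abs_cont ig g0 e0.
exists d => // p q ap pq qb pqd.
have := hd 1%N (fun=> p) (fun=> q); rewrite !big_ord1; apply => //.
by move=> i j; rewrite !ord1 eqxx.
Qed.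

Lemma scalar_ac_continuous X a b : scalar_ac X a b -> forall e, 0 < e ->
  exists2 d, 0 < d &
  forall p q, a <= p -> p <= q -> q <= b -> q - p < d -> `|X q - X p| < e.
Proof.
move=> rX e e0; have [d d0 hd] := rX e e0.
exists d => // p q ap pq qb pqd.
have := hd 1%N (fun=> p) (fun=> q); rewrite !big_ord1; apply => //.
by move=> i j; rewrite !ord1 eqxx.
Qed.

Lemma scalar_acB X Y a b : scalar_ac X a b -> scalar_ac Y a b ->
  scalar_ac (fun t => X t - Y t) a b.
Proof.
move=> hX hY e e0; have e2 : 0 < e / 2 by rewrite divr_gt0.
have [d1 d10 h1] := hX _ e2; have [d2 d20 h2] := hY _ e2.
exists (Num.min d1 d2); first by rewrite lt_min d10.
move=> N p q pq dis; rewrite lt_min => /andP[s1 s2].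
rewrite (splitr e); apply: le_lt_trans (ltrD (h1 _ _ _ pq dis s1) (h2 _ _ _ pq dis s2)).
rewrite -big_split /=; apply: ler_sum => i _.
apply: le_trans (ler_normB _ _).
by rewrite le_eqVlt; apply/orP; left; apply/eqP; congr `| _ |; ring.
Qed.

End AbsoluteContinuity.

(** * The fundamental theorem of calculus *)

Section BorelModification.
Context {R : realType}.
Notation lR := (lebesgueR R).
Notation bR := (measurableTypeR R).
Notation mu := (@leb R).
Notation bmu := (@lebesgue_measure R).

(** The Lebesgue sets form the completion of the Borel sets. *)
Lemma lebesgue_measurable_borel (A : set R) : measurable (A : set lR) ->
  exists X M : set R, [/\ measurable (X : set bR), measurable (M : set bR),
    bmu M = 0%E, X `<=` A & A `<=` X `|` M].
Proof.
move=> mA.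
have : (completed_algebra_gen bmu).-sigma.-measurable A.
  by rewrite completed_caratheodory_measurable.
rewrite g_sigma_completed_algebra_genE => -[/= X mX [N [M [mM M0 NM]] XN]].
exists X, M; split => //; first by rewrite -XN; left.
by rewrite -XN => x [Xx|/NM]; [left|right].
Qed.

Lemma negligible_borel (E : set R) : mu.-negligible E ->
  exists M : set R, [/\ measurable (M : set bR), bmu M = 0%E & E `<=` M].
Proof.
move=> [A [mA A0 EA]].
have [X [M [mX mM M0 XA AXM]]] := lebesgue_measurable_borel mA.
have X0 : bmu X = 0%E.
  apply/eqP; rewrite eq_le measure_ge0 andbT -A0.
  by rewrite -(leb_borel X) le_measure// inE//; exact: borel_lebesgue.
exists (X `|` M); split; first exact: measurableU.
  by rewrite null_set_setU.
exact: subset_trans AXM.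
Qed.

(** Lebesgue differentiation is used for Borel functions, whereas the signals
    are only Lebesgue measurable.  The level sets of [f] at rational levels are
    Borel up to Borel null sets; setting [f] to zero on the union of these null
    sets makes all level sets Borel. *)
Lemma borel_modification (f : R -> R) :
  measurable_fun ([set: R] : set lR) f ->
  exists (g : R -> R) (B : set R), [/\ measurable_fun ([set: R] : set bR) g,
    measurable (B : set bR), bmu B = 0%E & forall t, ~ B t -> g t = f t].
Proof.
move=> mf.
have H (q : rat) : exists XM : set R * set R,
    [/\ measurable (XM.1 : set bR), measurable (XM.2 : set bR),
    bmu XM.2 = 0%E, XM.1 `<=` [set t | f t < ratr q] &
    [set t | f t < ratr q] `<=` XM.1 `|` XM.2].
  have mq : measurable ([set t | f t < ratr q] : set lR).
    have := mf measurableT `]-oo, ratr q[%classic (measurable_itv _).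
    rewrite setTI (_ : _ @^-1` _ = [set t | f t < ratr q])//.
  have [X [M [h1 h2 h3 h4 h5]]] := lebesgue_measurable_borel mq.
  by exists (X, M).
pose X q := (projT1 (cid (H q))).1; pose M q := (projT1 (cid (H q))).2.
have mX q : measurable (X q : set bR) by rewrite /X; case: cid => ? [].
have mM q : measurable (M q : set bR) by rewrite /M; case: cid => ? [].
have M0 q : bmu (M q) = 0%E by rewrite /M; case: cid => ? [].
have XA q : X q `<=` [set t | f t < ratr q] by rewrite /X; case: cid => ? [].
have AXM q : [set t | f t < ratr q] `<=` X q `|` M q.
  by rewrite /X /M; case: cid => ? [].
pose B := \bigcup_q M q.
have mB : measurable (B : set bR) by exact: bigcupT_measurable_rat.
have B0 : bmu B = 0%E.
  apply: measure_negligible => //.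
  pose M' n := if unpickle n is Some q then M q else set0.
  have nM : bmu.-negligible (\bigcup_n M' n).
    apply: negligible_bigcup => n; rewrite /M'; case: unpickle => [q|].
      by exists (M q); split; [exact: mM|exact: M0|].
    exact: negligible_set0.
  apply: negligibleS nM => t [q _ Mt]; exists (pickle q); first exact: I.
  by rewrite /M' pickleK.
pose g t := if t \in B then 0 else f t.
exists g, B; split => //; last by move=> t Bt; rewrite /g memNset.
move=> _; apply: (measurability _ (RGenInftyO.measurableE R)) => //.
move=> _ [_ [x ->] <-]; rewrite setTI.
have -> : g @^-1` `]-oo, x[%classic =
   (\bigcup_(q in [set q : rat | ratr q <= x]) (X q `\` B)) `|`
   (if 0 < x then B else set0).
  apply/seteqP; split => t /=; rewrite in_itv /= /g.
    case: ifPn => tB; first by move=> ->; right; exact/set_mem.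
    move=> /rat_in_itvoo[q]; rewrite in_itv /= => /andP[fq qx]; left.
    exists q; first exact: ltW.
    have Bt : ~ B t by move=> Bt; move: tB; rewrite mem_set.
    split=> //; have [//|Mt] := AXM q t fq.
    by exfalso; apply: Bt; exists q.
  move=> [[q /= qx [Xt Bt]]|].
    by rewrite memNset// (lt_le_trans (XA _ _ Xt)).
  by case: ifP => // x0 Bt; rewrite mem_set.
apply: measurableU; last by case: ifP.
rewrite bigcup_mkcond; apply: bigcupT_measurable_rat => q.
by case: ifP => _ //; exact: measurableD.
Qed.

End BorelModification.

Section AeEqual.
Context d (T : measurableType d) (R : realType) (mu : {measure set T -> \bar R}).
Implicit Types (D : set T) (f g : T -> R).

Lemma ae_eq_integrable D f g : measurable D -> measurable_fun D g ->
  {ae mu, forall x, D x -> f x = g x} ->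
  mu.-integrable D (EFin \o f) -> mu.-integrable D (EFin \o g).
Proof.
move=> mD mg fg /integrableP[mf fin].
have mg' : measurable_fun D (EFin \o g) by exact/measurable_EFinP.
apply/integrableP; split => //; apply: le_lt_trans fin.
rewrite (@ge0_ae_eq_integral _ _ _ mu D (fun x => `|(EFin \o g) x|%E)
     (fun x => `|(EFin \o f) x|%E))//.
- exact: measurableT_comp.
- exact: measurableT_comp.
- by apply: filterS fg => x /= h Dx; rewrite h.
Qed.

Lemma ae_eq_Rintegral D f g : measurable D -> measurable_fun D g ->
  {ae mu, forall x, D x -> f x = g x} ->
  mu.-integrable D (EFin \o f) ->
  (\int[mu]_(x in D) f x = \int[mu]_(x in D) g x)%R.
Proof.
move=> mD mg fg fi.
have mf : measurable_fun D (EFin \o f) by move/integrableP : fi => [].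
have mg' : measurable_fun D (EFin \o g) by exact/measurable_EFinP.
rewrite /Rintegral; congr fine; apply: ae_eq_integral => //.
by apply: filterS fg => x /= h Dx; rewrite h.
Qed.

End AeEqual.

Section LebesgueDifferentiation.
Context {R : realType}.
Notation lR := (lebesgueR R).
Notation bR := (measurableTypeR R).
Notation mu := (@leb R).
Notation bmu := (@lebesgue_measure R).

(** The identity, from the Lebesgue to the Borel line: integrals against the two
    measures are compared by pushing forward along it. *)
Let toB (x : lR) : bR := x.

Let mtoB : measurable_fun [set: lR] toB.
Proof. by move=> _ A mA; rewrite setTI; exact: borel_lebesgue. Qed.

Let push_bmu (D : set bR) (f : bR -> \bar R) :
  (\int[pushforward mu toB]_(x in D) f x = \int[bmu]_(x in D) f x)%E.
Proof. by apply: eq_measure_integral => A mA _; rewrite /pushforward. Qed.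

Lemma integrable_borel (g : R -> R) (D : set R) :
  measurable_fun ([set: R] : set bR) g -> measurable (D : set bR) ->
  mu.-integrable D (EFin \o g) -> bmu.-integrable D (EFin \o g).
Proof.
move=> mg mD ig.
have mg' : measurable_fun ([set: R] : set bR) (EFin \o g).
  exact/measurable_EFinP.
have /integrableP[mgD fin] := @integrable_pushforward _ _ lR bR R toB mtoB mu D
  (EFin \o g) mg' ig mD.
by apply/integrableP; split => //; rewrite -push_bmu.
Qed.

Lemma integral_borel (g : R -> R) (D : set R) :
  measurable_fun ([set: R] : set bR) g -> measurable (D : set bR) ->
  mu.-integrable D (EFin \o g) ->
  (\int[bmu]_(x in D) (EFin \o g) x = \int[mu]_(x in D) (EFin \o g) x)%E.
Proof.
move=> mg mD ig.
have mg' : measurable_fun ([set: R] : set bR) (EFin \o g).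
  exact/measurable_EFinP.
rewrite -push_bmu.
exact: (@integral_pushforward _ _ lR bR R toB mtoB mu D (EFin \o g) mg' ig mD).
Qed.

Lemma borel_lebesgue_fun (g : R -> R) :
  measurable_fun ([set: R] : set bR) g -> measurable_fun ([set: R] : set lR) g.
Proof. move=> mg; exact: (measurableT_comp (f := g : bR -> R) mg mtoB). Qed.

(** Lebesgue differentiation for a Borel function equal to [phi] off a null set
    and vanishing off the interval. *)
Lemma Lint_derivative (phi : R -> R) a b : integ phi a b ->
  {ae mu, forall t, t \in `]a, b[ -> is_derive t 1 (Lint phi a) (phi t)}.
Proof.
move=> iphi.
pose f := phi \_ `]a, b]%classic.
have mf : measurable_fun ([set: R] : set lR) f.
  by apply/(measurable_restrictT _ (mitv _)); exact: integ_measurable iphi.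
have [g [B [mg mB B0 gf]]] := borel_modification mf.
have mgl := borel_lebesgue_fun mg.
have mu0 : mu B = 0%E by [].
have ifT : mu.-integrable setT (EFin \o f).
  have := (@integrable_mkcond _ lR R mu `]a, b]%classic (EFin \o phi)
    (mitv _)).1 iphi.
  by rewrite restrict_EFin.
have aeq (D : set R) : {ae mu, forall t, D t -> f t = g t}.
  exists B; split => //; first exact: borel_lebesgue.
  by move=> t /= /not_implyP[_ h]; apply: contrapT => Bt; apply: h; rewrite gf.
have igT : mu.-integrable setT (EFin \o g).
  exact: (ae_eq_integrable measurableT mgl (aeq setT) ifT).
have igB : bmu.-integrable setT (EFin \o g) by exact: integrable_borel.
pose F x := (\int[bmu]_(t in [set` Interval (BRight a) (BRight x)]) g t)%R.
have FE x : x <= b -> F x = Lint phi a x.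
  move=> xb; pose D := `]a, x]%classic.
  have ifD : mu.-integrable D (EFin \o f).
    by apply: integrableS ifT => //; exact: mitv.
  have igD : mu.-integrable D (EFin \o g).
    by apply: integrableS igT => //; exact: mitv.
  have -> : F x = (\int[mu]_(t in D) g t)%R.
    by rewrite /F /Rintegral integral_borel.
  have mgD : measurable_fun (D : set lR) g.
    by apply: measurable_funS mgl.
  rewrite -(ae_eq_Rintegral (mitv _) mgD (aeq D) ifD).
  apply: eq_Rintegral => t; rewrite inE /= in_itv /= => /andP[at_ tx].
  by rewrite /f patchE mem_set//= in_itv /= at_ (le_trans tx).
have [||N [mN N0 hN]] := @FTC1 R g (BRight a).
- by move=> y; apply: integrableS igB.
- exact: open_integrable_locally openT igB.
exists (N `|` B); split.
- by apply: borel_lebesgue; exact: measurableU.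
- rewrite leb_borel null_set_setU//.
move=> t /= nt.
have [Nt|Nt] := pselect (N t); first by left.
right; apply: contrapT => Bt; apply: nt => tab.
have /andP[at_ tb] : a < t < b by move: tab; rewrite in_itv.
have : (BRight a < BRight (t : R))%O -> derivable F t 1 /\ derive1 F t = g t.
  by apply: contrapT => h; apply: Nt; apply: hN.
rewrite bnd_simp => /(_ at_)[dF F't].
apply: (@near_eq_is_derive _ _ _ F).
- near=> z; apply: FE; rewrite ltW//; near: z; exact: lt_nbhsl.
- rewrite (_ : phi t = g t); last first.
    by rewrite gf// /f patchE mem_set//= in_itv /= at_ ltW.
  rewrite -F't derive1E; exact: derivableP.
Unshelve. all: by end_near. Qed.

End LebesgueDifferentiation.

Section ZeroDerivative.
Context {R : realType}.
Notation mu := (@leb R).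
Notation bmu := (@lebesgue_measure R).

(** The intervals are listed from right to left: the covering argument of
    [scalar_ac_deriv0] adds the next one on the right. *)
Fixpoint chain (a s : R) (l : seq (R * R)) : Prop :=
  if l is pq :: l' then
    [/\ a <= pq.1, pq.1 <= pq.2, pq.2 <= s & chain a pq.1 l']
  else True.

Lemma chain_nth (a s : R) l i : chain a s l -> (i < size l)%N ->
  [/\ a <= (nth (0, 0) l i).1, (nth (0, 0) l i).1 <= (nth (0, 0) l i).2 &
      (nth (0, 0) l i).2 <= s].
Proof.
elim: l s i => // -[p q] l IH s [|i] /= [h1 h2 h3 h4] il; first by split.
have [g1 g2 g3] := IH p i h4 il.
by split => //; rewrite (le_trans g3)// (le_trans h2).
Qed.

Lemma chain_lt (a s : R) l i j : chain a s l -> (i < j)%N -> (j < size l)%N ->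
  (nth (0, 0) l j).2 <= (nth (0, 0) l i).1.
Proof.
elim: l s i j => // -[p q] l IH s i [//|j] /= [h1 h2 h3 h4] ij jl.
case: i ij => [|i] ij /=; last exact: IH h4 _ _.
by have [] := chain_nth h4 jl.
Qed.

Lemma scalar_ac_chain (X : R -> R) (a b e d : R) :
  (forall N (p q : 'I_N -> R),
    (forall i, [/\ a <= p i, q i <= b & p i <= q i]) ->
    (forall i j, i != j -> q i <= p j \/ q j <= p i) ->
    \sum_i (q i - p i) < d -> \sum_i `|X (q i) - X (p i)| < e) ->
  forall l, chain a b l -> \sum_(pq <- l) (pq.2 - pq.1) < d ->
  \sum_(pq <- l) `|X pq.2 - X pq.1| < e.
Proof.
move=> h l cl; rewrite !(big_nth (0, 0)) !big_mkord => subdiv.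
apply: (h _ (fun i => (nth (0, 0) l i).1) (fun i => (nth (0, 0) l i).2)) => //.
  by move=> i; have [? ? ?] := chain_nth cl (ltn_ord i); split.
move=> i j; rewrite -val_eqE neq_ltn => /orP[ij|ij]; [right|left];
  exact: (chain_lt cl ij (ltn_ord _)).
Qed.

Lemma is_derive0_bound (X : R -> R) (c k : R) : is_derive c 1 X 0 -> 0 < k ->
  exists2 r, 0 < r & forall h, `|h| < r -> `|X (c + h) - X c| <= k * `|h|.
Proof.
move=> [dX X0] k0; have {}dX : h^-1 *: (X (h *: 1 + c) - X c) @[h --> 0^'] --> 'D_1 X c.
  exact: dX.
rewrite X0 in dX.
have /cvgrPdist_le/(_ _ k0)/nbhs_ballP[r /= r0 hr] := dX.
exists r => // h hr0; have [->|h0] := eqVneq h 0.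
  by rewrite addr0 subrr normr0 mulr0.
have := hr h; rewrite -ball_normE /= !sub0r !normrN => /(_ hr0 h0).
rewrite [h *: 1]mulr1 addrC normrZ normfV ler_pdivrMl ?normr_gt0//.
by rewrite addrC [h + c]addrC [_ * k]mulrC.
Qed.

(** Move from [a] to [b] by small steps.  At a point of zero derivative the
    increment is at most [k] times the length, which sums to [e / 2].  The
    remaining points form a null set, covered by an open set [U] of measure
    below the [d] that absolute continuity provides, so the increments over
    disjoint intervals inside [U] sum to less than [e / 2]. *)
Lemma scalar_ac_deriv0 (X : R -> R) (a b : R) : a <= b -> scalar_ac X a b ->
  {ae mu, forall t, t \in `]a, b[ -> is_derive t 1 X 0} -> X b = X a.
Proof.
rewrite le_eqVlt => /predU1P[->//|ab] rX [N0 [mN0 N00 dN0]].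
have [N [mN N_0 N0N]] : exists M : set R,
    [/\ measurable (M : set (measurableTypeR R)), bmu M = 0%E & N0 `<=` M].
  by apply: negligible_borel; exists N0; split; [exact: mN0|exact: N00|].
have der t : ~ N t -> t \in `]a, b[ -> is_derive t 1 X 0.
  move=> Nt tab; apply: contrapT => h; apply: Nt; apply: N0N; apply: dN0 => /=.
  by move/(_ tab).
apply/eqP; rewrite -subr_eq0 -normr_le0; apply/ler_addgt0Pl => e e0.
rewrite addr0.
have e2 : 0 < e / 2 by rewrite divr_gt0.
have [d d0 /scalar_ac_chain hd] := rX _ e2.
pose E := N `|` [set a] `|` [set b].
have mE : measurable (E : set (measurableTypeR R)).
  by apply: measurableU => //; apply: measurableU.
have E0 : bmu E = 0%E.
  have pt x : bmu [set x] = 0%E by exact: lebesgue_measure_set1.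
  have NaE : bmu (N `|` [set a]) = 0%E by apply: null_set_setU => //; exact: pt.
  by apply: null_set_setU => //; [exact: measurableU|exact: pt].
have [|U [oU EU UE]] := @lebesgue_regularity_outer R E d mE _ d0.
  by rewrite [X in (X < _)%E]E0 ltry.
have mU : measurable (U : set (measurableTypeR R)) by exact: open_measurable.
have Ud : (bmu U < d%:E)%E.
  have mUE : measurable (U `\` E : set (measurableTypeR R)) by exact: measurableD.
  apply: le_lt_trans UE; rewrite -[X in (bmu X <= _)%E](setDUK EU).
  have := @measureU2 _ _ _ bmu _ _ mE mUE; rewrite [X in (_ <= X + _)%E]E0 add0e.
  exact.
pose k := e / 2 / (b - a).
have k0 : 0 < k by rewrite divr_gt0// subr_gt0.
(* the points reached from a in this way, with the list l of the intervals inside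
   U *)
pose Good s := exists l, [/\ chain a s l,
  ((\sum_(pq <- l) (pq.2 - pq.1))%:E <= bmu (U `&` `]a, s]))%E &
  `|X s - X a| <= k * (s - a) + \sum_(pq <- l) `|X pq.2 - X pq.1|].
have Goodb : Good b -> `|X b - X a| <= e.
  move=> [l [cl sl Xl]]; apply: le_trans Xl _.
  have sld : \sum_(pq <- l) (pq.2 - pq.1) < d.
    rewrite -lte_fin; apply: le_lt_trans sl _; apply: le_lt_trans Ud.
    by apply: le_measure; rewrite ?inE//; exact: measurableI.
  rewrite [leRHS](splitr e) /k divfK ?subr_eq0 ?gt_eqF//.
  by rewrite lerD2l ltW// hd.
apply: Goodb.
have chain_le (s t : R) l : s <= t -> chain a s l -> chain a t l.
  by case: l => // -[p q] l st /= [? ? qs ?]; split => //; exact: le_trans st.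
have mUs (s : R) : measurable (U `&` `]a, s] : set (measurableTypeR R)).
  exact: measurableI.
have step1 s t : a <= s -> s <= t -> Good s -> `|X t - X s| <= k * (t - s) -> Good t.
  move=> as_ st [l [cl sl Xl]] Xst; exists l; split; first exact: chain_le cl.
    apply: (le_trans sl); apply: le_measure; rewrite ?inE//.
    by apply: setIS; apply: subset_itvl; rewrite bnd_simp.
  rewrite -(subrKA (X s)) (le_trans (ler_normD _ _))//.
  apply: le_trans (lerD Xst Xl) _; rewrite addrA -mulrDr lerD2r ler_wpM2l ?(ltW k0)//.
  by rewrite addrA subrK.
have step2 s t : a <= s -> s <= t -> Good s -> `]s, t]%classic `<=` U -> Good t.
  move=> as_ st [l [cl sl Xl]] stU; exists ((s, t) :: l); split => //.
    rewrite big_cons /= addrC EFinD.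
    have -> : U `&` `]a, t] = (U `&` `]a, s]) `|` `]s, t].
      apply/seteqP; split => x /=; rewrite !in_itv /=.
        by move=> [Ux /andP[ax xt]]; case: (leP x s) => xs; [left|right];
          rewrite ?ax.
      move=> [[Ux /andP[ax xs]]|/andP[sx xt]].
        by rewrite ax (le_trans xs).
      by rewrite xt (le_lt_trans as_)//; split => //; apply: stU;
        rewrite /= in_itv /= sx.
    rewrite measureU//; first last.
      apply/seteqP; split => // x /=; rewrite !in_itv /= => -[[_ /andP[_ xs]] /andP[]].
      by move=> /(le_lt_trans xs); rewrite ltxx.
    have st_len : bmu `]s, t]%classic = (t - s)%:E := leb_oc st.
    by apply: leeD => //; rewrite [X in (_ <= X)%E]st_len.
  rewrite big_cons /= -(subrKA (X s)) (le_trans (ler_normD _ _))//.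
  rewrite addrCA lerD2l (le_trans Xl)// lerD2r ler_wpM2l ?(ltW k0)//.
  by rewrite lerD2r.
(* every point lets goodness pass from slightly before to slightly after it; the
   supremum argument below then reaches b *)
have loc c : a <= c <= b -> exists2 r, 0 < r & forall s t, a <= s -> s <= c ->
    c <= t -> t <= b -> c - r < s -> t < c + r -> Good s -> Good t.
  move=> /andP[ac cb]; have [Ec|Ec] := pselect (E c).
    have /nbhs_ballP[r /= r0 rU] := open_nbhs_nbhs (conj oU (EU _ Ec)).
    exists r => // s t as_ sc ct tb cs tc Gs.
    apply: step2 Gs _ => //; first exact: le_trans ct.
    move=> x /=; rewrite in_itv /= => /andP[sx xt]; apply: rU.
    rewrite -ball_normE /= ltr_norml; apply/andP; split; lra.
  have Nc : ~ N c by move=> Nc; apply: Ec; left; left.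
  have cab : c \in `]a, b[.
    rewrite in_itv /= !lt_neqAle ac cb !andbT; apply/andP; split.
      by apply/eqP => acE; apply: Ec; left; right.
    by apply/eqP => acE; apply: Ec; right.
  have Dc := der c Nc cab.
  have [r r0 hr] : exists2 r, 0 < r & forall h, `|h| < r ->
      `|X (c + h) - X c| <= k * `|h|.
    exact: is_derive0_bound Dc k0.
  exists r => // s t as_ sc ct tb cs tc Gs.
  apply: step1 Gs _ => //; first exact: le_trans ct.
  have ct' : c + (t - c) = t by rewrite addrC subrK.
  have cs' : c + (s - c) = s by rewrite addrC subrK.
  have h1 : `|X t - X c| <= k * (t - c).
    have := hr (t - c); rewrite ct' (ger0_norm (x := t - c)) ?subr_ge0//.
    by apply; rewrite ltrBlDl.
  have h2 : `|X c - X s| <= k * (c - s).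
    have := hr (s - c); rewrite cs' (ler0_norm (x := s - c)) ?subr_le0//.
    by rewrite opprB distrC; apply; lra.
  rewrite -(subrKA (X c)) (le_trans (ler_normD _ _))//.
  by apply: le_trans (lerD h1 h2) _; rewrite -mulrDr addrA subrK.
pose S := [set s | a <= s <= b /\ Good s].
have Sa : S a.
  split; first by rewrite lexx ltW.
  by exists [::]; split; rewrite // ?big_nil // subrr normr0 subrr mulr0 addr0.
have supS : has_sup S.
  by split; [exists a|exists b => s [/andP[]]].
pose c := sup S.
have ac : a <= c by apply: ub_le_sup => //; case: supS.
have cb : c <= b by apply: ge_sup; [case: supS|move=> s [/andP[]]].
have [r r0 hr] := loc c (introT andP (conj ac cb)).
have [s [/andP[as_ sb] Gs] cs] := sup_adherent r0 supS.
have sc : s <= c by apply: ub_le_sup; [case: supS|split=> //; rewrite as_].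
pose t := Num.min b (c + r / 2).
have ct : c <= t by rewrite le_min cb lerDl divr_ge0// ltW.
have tb : t <= b by rewrite ge_min lexx.
have Gt : Good t.
  apply: hr Gs => //; rewrite gt_min; apply/orP; right.
  by rewrite ltrD2l ltr_pdivrMr// ltr_pMr// ltr1n.
have tc : t <= c.
  by apply: ub_le_sup; [case: supS|split=> //; rewrite tb (le_trans ac)].
move: Gt; rewrite /t; case: (leP b (c + r / 2)) => // h.
by move: tc; rewrite /t (min_r (ltW h)) gerDl leNgt divr_gt0.
Qed.

End ZeroDerivative.

Section EuclideanNorm.
Context {R : realType} {k : nat}.
Implicit Types z : 'cV[R]_k.

Lemma enorm_ge0 z : 0 <= enorm z. Proof. exact: sqrtr_ge0. Qed.

Lemma coord_enorm z i : `|z i 0| <= enorm z.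
Proof.
rewrite /enorm -sqrtr_sqr ler_wsqrtr// (bigD1 i)//= lerDl sumr_ge0// => j _.
exact: sqr_ge0.
Qed.

Lemma norm_enorm z : `|z| <= enorm z.
Proof. by apply: norm_le_coord => [|i]; [exact: enorm_ge0|exact: coord_enorm]. Qed.

Lemma enorm_sum z : enorm z <= \sum_i `|z i 0|.
Proof.
have s0 : 0 <= \sum_i `|z i 0| by apply: sumr_ge0.
rewrite /enorm -[leRHS]ger0_norm// -sqrtr_sqr ler_wsqrtr//.
rewrite expr2 mulr_suml ler_sum// => i _.
rewrite -real_normK ?num_real// expr2 ler_wpM2l//.
by rewrite (bigD1 i)//= lerDl sumr_ge0.
Qed.

Lemma enorm_norm z : enorm z <= k%:R * `|z|.
Proof.
apply: le_trans (enorm_sum z) _.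
rewrite (le_trans (ler_sum _ (G := fun=> `|z|) _))//.
  by move=> i _; exact: norm_coord.
by rewrite sumr_const card_ord mulr_natl.
Qed.

End EuclideanNorm.

#[global] Instance ae_leb_filter {R : realType} :
  Filter (nbhs (almost_everywhere (@leb R))).
Proof. exact: (ae_filter_ringOfSetsType (@leb R)). Qed.

Section VectorFTC.
Context {R : realType} {k : nat}.
Notation mu := (@leb R).
Implicit Types (x phi : R -> 'cV[R]_k) (a b t : R).

Definition vinteg phi a b := forall i, integ (fun t => phi t i 0) a b.
Definition vLint phi a b : 'cV[R]_k := \col_i Lint (fun t => phi t i 0) a b.

(** Absolute continuity of a vector function is that of its coordinates, the
    Euclidean norm lying between the largest modulus of a coordinate and the
    sum of the moduli. *)
Lemma abs_continuousP x a b :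
  abs_continuous `[a, b]%classic x <-> forall i, scalar_ac (fun t => x t i 0) a b.
Proof.
split=> [h i e e0|h e e0].
  have [d d0 hd] := h e e0; exists d => // N p q pq dis subdiv.
  apply: le_lt_trans (hd N p q _ dis subdiv).
    by apply: ler_sum => j _; have := coord_enorm (x (q j) - x (p j)) i; rewrite !mxE.
  move=> j; have [h1 h2 h3] := pq j.
  by split => //=; rewrite in_itv /= ?h1 ?h2 ?(le_trans h3)// (le_trans h1).
pose e' := e / k.+1%:R.
have e'0 : 0 < e' by rewrite divr_gt0.
pose d i := s2val (cid2 (h i e' e'0)).
have d0 i : 0 < d i by rewrite /d; case: cid2.
exists (\big[Num.min/1]_i d i).
  by elim/big_ind : _ => // u v u0 v0; rewrite lt_min u0.
move=> N p q pq dis subdiv.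
have pq' i : [/\ a <= p i, q i <= b & p i <= q i].
  by have [] := pq i; rewrite /= !in_itv /= => /andP[? ?] /andP[? ?] ?; split.
have hi i : \sum_j `|x (q j) i 0 - x (p j) i 0| < e'.
  rewrite /d in subdiv; have := s2valP' (cid2 (h i e' e'0)); apply => //.
  by apply: lt_le_trans subdiv _; exact: bigmin_le.
apply: (@le_lt_trans _ _ (\sum_j \sum_i `|x (q j) i 0 - x (p j) i 0|)).
  apply: ler_sum => j _; apply: le_trans (enorm_sum _) _.
  by apply: ler_sum => i _; rewrite !mxE.
rewrite exchange_big /=.
apply: (@le_lt_trans _ _ (\sum_(i < k) e')).
  by apply: ler_sum => i _; exact: ltW.
rewrite sumr_const card_ord -mulr_natl /e' mulrA ltr_pdivrMr//.
by rewrite mulrC ltr_pM2l// ltr_nat.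
Qed.

Lemma is_derive_coord x t (d : 'cV[R]_k) :
  is_derive t 1 x d <-> forall i, is_derive t 1 (fun s => x s i 0) (d i 0).
Proof.
split=> [[dx xd] i|h].
  have di := (derivable_mxP _ _ _).1 dx.
  split; first exact: di.
  by rewrite -xd derive_mx// mxE.
have dx : derivable x t 1.
  by apply/derivable_mxP => i j; rewrite ord1; have [] := h i.
split => //; rewrite derive_mx//; apply/matrixP => i j.
by rewrite mxE ord1; have [] := h i.
Qed.

(** The difference of [x] and of the integral of [phi] is absolutely continuous
    with derivative zero almost everywhere, hence constant. *)
Lemma integral_of_derivative x phi a b : a <= b ->
  abs_continuous `[a, b]%classic x -> vinteg phi a b ->
  {ae mu, forall t, t \in `]a, b[ -> is_derive t 1 x (phi t)} ->
  x b = x a + vLint phi a b.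
Proof.
move=> ab /abs_continuousP rx iphi dx; apply/matrixP => i j.
rewrite ord1 !mxE; pose Y t := x t i 0 - (0 + Lint (fun t => phi t i 0) a t).
have rY : scalar_ac Y a b by apply: scalar_acB => //; exact: scalar_ac_Lint.
have := scalar_ac_deriv0 ab rY; rewrite /Y !add0r (Lint_ge _ (lexx a)) subr0.
move=> <-; first by rewrite subrK.
apply: filterS2 dx (Lint_derivative (iphi i)) => t h1 h2 tab.
have d1 := (is_derive_coord _ _ _).1 (h1 tab) i; have d2 := h2 tab.
rewrite /Y (_ : (fun t => _) = (fun t => x t i 0) - Lint (fun t => phi t i 0) a).
  by rewrite -(subrr (phi t i 0)); exact: is_deriveB.
by apply/funext => s; rewrite /= add0r.
Qed.

Lemma derivative_of_integral x phi a b (x0 : 'cV[R]_k) : vinteg phi a b ->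
  (forall t, a <= t <= b -> x t = x0 + vLint phi a t) ->
  abs_continuous `[a, b]%classic x /\
  {ae mu, forall t, t \in `]a, b[ -> is_derive t 1 x (phi t)}.
Proof.
move=> iphi xE; split.
  apply/abs_continuousP => i e e0.
  have [d d0 hd] := scalar_ac_Lint (x0 i 0) (iphi i) e0.
  exists d => // N p q pq dis subdiv; have := hd N p q pq dis subdiv.
  congr (_ < _); apply: eq_bigr => j _; have [h1 h2 h3] := pq j.
  rewrite xE ?xE; last 2 first.
  - by rewrite h1 (le_trans h3).
  - by rewrite h2 (le_trans h1).
  by rewrite !mxE.
have : forall i, {ae mu, forall t, t \in `]a, b[ ->
    is_derive t 1 (Lint (fun t => phi t i 0) a) (phi t i 0)}.
  by move=> i; exact: Lint_derivative.
move=> /filter_forall; apply: filterS => t /= h tab.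
apply/is_derive_coord => i; have := h i tab => dL.
apply: (@near_eq_is_derive _ _ _ (fun s => x0 i 0 + Lint (fun t => phi t i 0) a s)).
  move: tab; rewrite in_itv /= => /andP[at_ tb].
  near=> s; rewrite xE ?mxE//; apply/andP; split.
    by rewrite ltW//; near: s; exact: lt_nbhsr.
  by rewrite ltW//; near: s; exact: lt_nbhsl.
pose L := Lint (fun t => phi t i 0) a.
have -> : (fun s => x0 i 0 + Lint (fun t => phi t i 0) a s) = cst (x0 i 0) + L.
  by apply/funext.
rewrite -[phi t i 0]add0r -/L; rewrite -/L in dL.
exact: (is_deriveD (is_derive_cst _ _ _) dL).
Unshelve. all: by end_near. Qed.

End VectorFTC.

(** * Measurability of compositions and of implicit functions *)

Section InfimumMeasurable.
Context d (T : measurableType d) (R : realType).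

(** Such a [u] is the infimum of the countable family [h]. *)
Lemma measurable_fun_approx_above (I : countType) (D : set T) (u : T -> R)
    (h : I -> T -> R) :
  (forall j, measurable_fun D (h j)) ->
  (forall t j, D t -> u t <= h j t) ->
  (forall t e, D t -> 0 < e -> exists j, h j t < u t + e) ->
  measurable_fun D u.
Proof.
move=> mh uh ap mD; apply: (measurability _ (RGenInftyO.measurableE R)) => //.
move=> _ [_ [x ->] <-].
have -> : D `&` u @^-1` `]-oo, x[ = \bigcup_j (D `&` h j @^-1` `]-oo, x[).
  apply/seteqP; split => t /=.
    move=> [Dt]; rewrite in_itv /= => ux.
    have [|j hj] := ap t (x - u t) Dt; first by rewrite subr_gt0.
    by exists j => //; split => //=; rewrite in_itv /=; move: hj; rewrite addrC subrK.
  move=> [j _ [Dt /=]]; rewrite in_itv /= => hx; split => //.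
  by rewrite in_itv /= (le_lt_trans (uh t j Dt)).
apply: countable_bigcupT_measurable; first exact: countableP.
by move=> j; apply: mh.
Qed.

End InfimumMeasurable.

Section DenseSequence.
Context {R : realType} {p : nat}.

(** Points outside the ball are replaced by 0, so that the whole family stays in
    the ball where the Lipschitz bounds are available, while it remains dense in
    any slightly smaller ball. *)
Definition rat_point (r : R) (q : 'cV[rat]_p) : 'cV[R]_p :=
  let z := map_mx ratr q in if `|z| <= r then z else 0.

Lemma rat_point_ball r q : 0 <= r -> `|rat_point r q| <= r.
Proof. by rewrite /rat_point; case: ifP => //; rewrite normr0. Qed.

Lemma rat_point_dense r (x : 'cV[R]_p) e : `|x| <= r -> 0 < e ->
  exists q, `|rat_point (r + 1) q - x| < e.
Proof.
move=> xr e0; pose e' := Num.min (e / 2) 1.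
have e'0 : 0 < e' by rewrite lt_min divr_gt0//=.
have ex i : exists q : rat, `|ratr q - x i 0| < e'.
  have [q] := @rat_in_itvoo R (x i 0 - e') (x i 0 + e') ltac:(lra).
  rewrite in_itv /= => /andP[h1 h2]; exists q.
  by rewrite ltr_norml; apply/andP; split; lra.
pose q : 'cV[rat]_p := \col_i xchoose (ex i).
have hq : `|map_mx ratr q - x| <= e'.
  apply: norm_le_coord => [|i]; first exact: ltW.
  by rewrite !mxE; have /ltW := xchooseP (ex i).
exists q; rewrite /rat_point ifT.
  apply: le_lt_trans hq _; rewrite gt_min; apply/orP; left.
  by rewrite ltr_pdivrMr// ltr_pMr// ltr1n.
rewrite -(subrK x (map_mx _ _)) (le_trans (ler_normD _ _))// addrC lerD//.
by apply: le_trans hq _; rewrite ge_min lexx orbT.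
Qed.

End DenseSequence.

Section CompositionMeasurable.
Context {R : realType} {p m : nat}.
Notation lR := (lebesgueR R).
Variable D : set R.
Hypothesis mD : measurable (D : set lR).

Lemma vmeasurable_norm1 k (g : R -> 'cV[R]_k) : vmeasurable D g ->
  measurable_fun (D : set lR) (fun t => norm1 (g t)).
Proof.
move=> mg; rewrite /norm1; apply: measurable_sum => i.
exact: measurableT_comp.
Qed.

Lemma vmeasurableB k (g h : R -> 'cV[R]_k) : vmeasurable D g -> vmeasurable D h ->
  vmeasurable D (fun t => g t - h t).
Proof.
move=> mg mh i; under eq_fun do rewrite !mxE.
exact: measurable_funB.
Qed.

Lemma vmeasurableD k (g h : R -> 'cV[R]_k) : vmeasurable D g -> vmeasurable D h ->
  vmeasurable D (fun t => g t + h t).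
Proof.
move=> mg mh i; under eq_fun do rewrite !mxE.
exact: measurable_funD.
Qed.

Lemma vmeasurable_mulmx k l (A : 'M[R]_(k, l)) (g : R -> 'cV[R]_l) :
  vmeasurable D g -> vmeasurable D (fun t => A *m g t).
Proof.
move=> mg i; under eq_fun do rewrite mxE.
by apply: measurable_sum => j; apply: measurable_funM.
Qed.

Lemma vmeasurable_cst k (z : 'cV[R]_k) : vmeasurable D (fun=> z).
Proof. by move=> i; exact: measurable_cst. Qed.

(** By the Lipschitz bound, coordinate [i] of [f t (y t)] is the infimum over
    rational points [q] of [f t q i + lam t * |q - y t|_1]. *)
Lemma vmeasurable_comp (f : R -> 'cV[R]_p -> 'cV[R]_m) (lam : R -> R)
    (y : R -> 'cV[R]_p) (r : R) : 0 <= r ->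
  (forall xi, vmeasurable D (fun t => f t xi)) ->
  measurable_fun (D : set lR) lam ->
  (forall t, D t -> 0 <= lam t) ->
  (forall t xi zeta, D t -> `|xi| <= r + 1 -> `|zeta| <= r + 1 ->
     `|f t xi - f t zeta| <= lam t * `|xi - zeta|) ->
  vmeasurable D y -> (forall t, D t -> `|y t| <= r) ->
  vmeasurable D (fun t => f t (y t)).
Proof.
move=> r0 mf ml l0 lip my yr i.
have r1 : r <= r + 1 by rewrite lerDl.
apply: (@measurable_fun_approx_above _ lR R 'cV[rat]_p D _
  (fun q t => f t (rat_point (r + 1) q) i 0 +
              lam t * norm1 (rat_point (r + 1) q - y t))).
- move=> q; apply: measurable_funD; first exact: mf.
  apply: measurable_funM; first exact: ml.
  apply: vmeasurable_norm1; apply: vmeasurableB; last exact: my.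
  exact: vmeasurable_cst.
- move=> t q Dt; rewrite -lerBlDl.
  have := lip t (y t) (rat_point (r + 1) q) Dt.
  move=> /(_ (le_trans (yr t Dt) r1)) /(_ (rat_point_ball _ _)) h.
  have {}h := h (le_trans r0 r1).
  have := norm_coord (f t (y t) - f t (rat_point (r + 1) q)) i; rewrite !mxE.
  move=> /(le_trans (ler_norm _))/le_trans; apply; apply: le_trans h _.
  by rewrite distrC ler_wpM2l ?l0// norm_norm1.
- move=> t e Dt e0; pose L := lam t * (p%:R + 1) + 1.
  have L0 : 0 < L by rewrite ltr_wpDl// mulr_ge0 ?l0.
  have [q hq] := rat_point_dense (yr t Dt) (divr_gt0 e0 L0).
  exists q; set z := rat_point _ _ in hq *.
  have zr : `|z| <= r + 1 by rewrite rat_point_ball// (le_trans r0).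
  have h1 : f t z i 0 - f t (y t) i 0 <= lam t * `|z - y t|.
    have := lip t z (y t) Dt zr (le_trans (yr t Dt) r1).
    have := norm_coord (f t z - f t (y t)) i; rewrite !mxE.
    by move=> /(le_trans (ler_norm _)) /le_trans h /h.
  have h2 : lam t * norm1 (z - y t) <= lam t * (p%:R * `|z - y t|).
    by rewrite ler_wpM2l ?l0// norm1_norm.
  have h3 : L * `|z - y t| < e by rewrite mulrC -ltr_pdivlMr.
  have h4 : 0 <= `|z - y t| by [].
  by move: h3; rewrite /L; nra.
Qed.

End CompositionMeasurable.

Section InverseMeasurable.
Context {R : realType} {p : nat}.
Notation lR := (lebesgueR R).

(** As [y t] is the only point with [F t (y t) = w t], and with the lower bound
    on [F], coordinate [i] of [y t] is the infimum over rational points [q] of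
    [q i + |F t q - w t|_1 / eps]. *)
Lemma vmeasurable_inverse (D : set R) (F : R -> 'cV[R]_p -> 'cV[R]_p)
  (y w : R -> 'cV[R]_p)
    (r eps : R) : measurable (D : set lR) -> 0 <= r -> 0 < eps ->
  (forall xi, vmeasurable D (fun t => F t xi)) ->
  (forall t, D t -> exists2 L, 0 <= L & forall xi zeta,
     `|xi| <= r + 1 -> `|zeta| <= r + 1 -> `|F t xi - F t zeta| <= L * `|xi - zeta|) ->
  (forall t xi zeta, D t -> `|xi| <= r + 1 -> `|zeta| <= r + 1 ->
     eps * `|xi - zeta| <= `|F t xi - F t zeta|) ->
  vmeasurable D w -> (forall t, D t -> `|y t| <= r) ->
  (forall t, D t -> F t (y t) = w t) ->
  vmeasurable D y.
Proof.
move=> mD r0 e0 mF lip low mw yr Fy i.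
have r1 : r <= r + 1 by rewrite lerDl.
apply: (@measurable_fun_approx_above _ lR R 'cV[rat]_p D _
  (fun q t => rat_point (r + 1) q i 0 +
              eps^-1 * norm1 (F t (rat_point (r + 1) q) - w t))).
- move=> q; apply: measurable_funD; first exact: measurable_cst.
  apply: measurable_funM; first exact: measurable_cst.
  by apply: vmeasurable_norm1; apply: vmeasurableB; [exact: mF|exact: mw].
- move=> t q Dt; rewrite -lerBlDl.
  have := low t (y t) (rat_point (r + 1) q) Dt.
  move=> /(_ (le_trans (yr t Dt) r1)) /(_ (rat_point_ball _ (le_trans r0 r1))).
  rewrite mulrC -ler_pdivlMr// => h.
  have := norm_coord (y t - (rat_point (r + 1) q)) i; rewrite !mxE.
  move=> /(le_trans (ler_norm _))/le_trans; apply; apply: le_trans h _.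
  by rewrite mulrC ler_wpM2l ?invr_ge0 ?(ltW e0)// distrC (Fy t Dt) norm_norm1.
- move=> t e Dt e1; have [K K0 hK] := lip t Dt.
  pose L := 1 + eps^-1 * (p%:R * K).
  have L0 : 0 < L by rewrite ltr_wpDr// mulr_ge0 ?invr_ge0 ?(ltW e0)// mulr_ge0.
  have [q hq] := rat_point_dense (yr t Dt) (divr_gt0 e1 L0).
  exists q; set z := rat_point _ _ in hq *.
  have zr : `|z| <= r + 1 by rewrite rat_point_ball// (le_trans r0).
  have h1 : z i 0 - y t i 0 <= `|z - y t|.
    have := norm_coord (z - y t) i; rewrite !mxE.
    exact: (le_trans (ler_norm _)).
  have h2 : norm1 (F t z - w t) <= p%:R * (K * `|z - y t|).
    rewrite (le_trans (norm1_norm _))// ler_wpM2l// -(Fy t Dt).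
    by apply: hK => //; exact: le_trans (yr t Dt) r1.
  have h3 : L * `|z - y t| < e by rewrite mulrC -ltr_pdivlMr.
  have h4 : eps^-1 * norm1 (F t z - w t) <= eps^-1 * (p%:R * (K * `|z - y t|)).
    by rewrite ler_wpM2l// invr_ge0 ltW.
  move: h3; rewrite /L; set A := eps^-1 * norm1 _ in h4 *.
  rewrite mulrDl mul1r -!mulrA => h3; lra.
Qed.

End InverseMeasurable.

(** * Gronwall's inequality and Picard iteration *)

Section Gronwall.
Context {R : realType}.
Notation lR := (lebesgueR R).

Lemma integ_mul_bounded (g W : R -> R) (a b K : R) : integ g a b ->
  measurable_fun (`]a, b]%classic : set lR) W ->
  (forall t, t \in `]a, b] -> `|W t| <= K) -> integ (fun t => g t * W t) a b.
Proof.
move=> ig mW WK; apply: (@integ_le _ _ (fun t => K * `|g t|)).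
- by apply: measurable_funM => //; exact: integ_measurable ig.
- by move=> t tab; rewrite normrM mulrC ler_wpM2r// WK.
- by apply: integZ; exact: integ_norm.
Qed.

Lemma lebesgue_id : measurable_fun ([set: R] : set lR) (id : R -> R).
Proof. by move=> _ A mA; rewrite setTI; exact: borel_lebesgue. Qed.

(** The weight of the Bielecki norm, for an integrable Lipschitz constant [mu]:
    integration against [mu] contracts by [2 / 3] relative to [W].  It is a step
    function, four times larger on each new interval on which [mu] has integral
    below [1 / 2]. *)
Lemma gronwall_weight (mu : R -> R) (a b : R) : a <= b -> integ mu a b ->
  (forall t, t \in `]a, b] -> 0 <= mu t) ->
  exists (W : R -> R) (K : R),
    [/\ measurable_fun ([set: R] : set lR) W, forall t, 1 <= W t <= K &
     forall t, t \in `]a, b] -> Lint (fun s => mu s * W s) a t <= 2 / 3 * W t].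
Proof.
move=> ab imu mu0.
have [d d0 hd] := Lint_small imu mu0
  (divr_gt0 (ltr01 : 0 < 1 :> R) (ltr0n _ 2 : 0 < 2 :> R)).
pose P c := exists (W : R -> R) (K : R),
    [/\ measurable_fun ([set: R] : set lR) W, forall t, 1 <= W t <= K &
     forall t, t \in `]a, c] -> Lint (fun s => mu s * W s) a t <= 2 / 3 * W t].
have step c c' : a <= c -> c <= c' -> c' <= b -> c' - c < d -> P c -> P c'.
  move=> ac cc' c'b c'd [W [K [mW WK hW]]].
  pose W' t := if t <= c then W t else 4 * K.
  have K1 : 1 <= K by have /andP[h1 h2] := WK c; exact: le_trans h2.
  have mW' : measurable_fun ([set: R] : set lR) W'.
    apply: measurable_fun_ifT; [|exact: mW|exact: measurable_cst].
    by apply: measurable_fun_ler; [exact: lebesgue_id|exact: measurable_cst].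
  have W'K t : 1 <= W' t <= 4 * K.
    rewrite /W'; case: ifP => _; last by apply/andP; split; lra.
    by have /andP[h1 h2] := WK t; apply/andP; split; lra.
  exists W', (4 * K); split => // t; rewrite in_itv /= => /andP[at_ tc'].
  have [tc|ct] := leP t c.
    rewrite (@eq_Lint _ _ (fun s => mu s * W s)).
      by rewrite /W' tc hW// in_itv /= at_.
    by move=> s; rewrite in_itv /= /W' => /andP[_ st]; rewrite (le_trans st).
  have iW' p q : a <= p -> q <= b -> integ (fun s => mu s * W' s) p q.
    move=> ap qb; apply: (@integ_mul_bounded _ _ _ _ (4 * K)).
    - exact: integ_sub imu _ _.
    - exact: measurable_funS mW'.
    - move=> s _; have /andP[h1 h2] := W'K s; rewrite ger0_norm//; lra.
  have iW p q : a <= p -> q <= b -> integ (fun s => mu s * W s) p q.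
    move=> ap qb; apply: (@integ_mul_bounded _ _ _ _ K).
    - exact: integ_sub imu _ _.
    - exact: measurable_funS mW.
    - move=> s _; have /andP[h1 h2] := WK s; rewrite ger0_norm//; lra.
  have tb : t <= b by exact: le_trans c'b.
  rewrite (@Lint_split _ _ a c t) ?iW' ?(ltW ct)//.
  have E1 : Lint (fun s => mu s * W' s) a c <= 2 / 3 * K.
    rewrite (@eq_Lint _ _ (fun s => mu s * W s)).
      move: ac; rewrite le_eqVlt => /predU1P[<-|ac].
        by rewrite Lint_ge//; lra.
      apply: (le_trans (hW c _)); first by rewrite in_itv /= ac lexx.
      by have /andP[h1 h2] := WK c; lra.
    by move=> s; rewrite in_itv /= /W' => /andP[_ ->].
  have E2 : Lint (fun s => mu s * W' s) c t <= 1 / 2 * (4 * K).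
    rewrite (@eq_Lint _ _ (fun s => 4 * K * mu s)).
      rewrite LintZ; last exact: integ_sub imu _ _.
      rewrite mulrC ler_wpM2r//; first lra.
      by apply/ltW/hd => //; [exact: ltW|lra].
    move=> s; rewrite in_itv /= /W' => /andP[cs _].
    by rewrite leNgt cs /= mulrC.
  (* 2 / 3 * K before c and 1 / 2 * (4 * K) after c add up to 2 / 3 * (4 * K) *)
  have -> : W' t = 4 * K by rewrite /W' leNgt ct.
  lra.
(* steps of length d / 2 reach b after finitely many repetitions *)
have all n : P (Num.min b (a + n%:R * (d / 2))).
  elim: n => [|n IH].
    rewrite mul0r addr0 min_r//; exists (fun=> 1), 1; split => //.
      by move=> t; rewrite lexx.
    by move=> t; rewrite in_itv /= => /andP[at_ /(lt_le_trans at_)]; rewrite ltxx.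
  have nd : 0 <= n%:R * (d / 2) by rewrite mulr_ge0// divr_ge0// ltW.
  have Sd : n.+1%:R * (d / 2) = n%:R * (d / 2) + d / 2 by rewrite -natr1 mulrDl mul1r.
  apply: step IH.
  - by rewrite le_min ab lerDl.
  - by rewrite le_min ge_min lexx /= ge_min Sd; apply/orP; right; lra.
  - by rewrite ge_min lexx.
  - rewrite Sd; case: (leP b (a + n%:R * (d / 2))) => h1;
    case: (leP b (a + (n%:R * (d / 2) + d / 2))) => h2; lra.
have [n hn] : exists n : nat, b <= a + n%:R * (d / 2).
  exists (Num.bound ((b - a) / (d / 2))).
  rewrite -lerBlDl -ler_pdivrMr ?divr_gt0// ltW// archi_boundP//.
  by rewrite divr_ge0 ?subr_ge0// divr_ge0// ltW.
by have := all n; rewrite min_l.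
Qed.

Lemma geometric_le0 (u C q : R) : `|q| < 1 -> (forall k, u <= C * q ^+ k) -> u <= 0.
Proof.
move=> q1 h.
have c : C * q ^+ k @[k --> \oo] --> C * 0.
  by apply: cvgM; [exact: cvg_cst|exact: cvg_expr].
rewrite -(mulr0 C) -(cvg_lim _ c)//; apply: limr_ge; first by apply/cvg_ex;
  exists (C * 0).
exact: nearW.
Qed.

(** Inserting a bound [u <= C * W] into the inequality improves [C] by the factor
    [2 / 3]; iteration gives zero. *)
Lemma gronwall0 (mu u : R -> R) (a b M : R) : a <= b -> integ mu a b ->
  (forall t, t \in `]a, b] -> 0 <= mu t) ->
  measurable_fun (`]a, b]%classic : set lR) u ->
  (forall t, t \in `]a, b] -> 0 <= u t <= M) ->
  (forall t, t \in `]a, b] -> u t <= Lint (fun s => mu s * u s) a t) ->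
  forall t, t \in `]a, b] -> u t = 0.
Proof.
move=> ab imu mu0 mu_ uM hu t tab.
have [W [K [mW WK hW]]] := gronwall_weight ab imu mu0.
have M0 : 0 <= M by have /andP[h1 h2] := uM t tab; exact: le_trans h2.
have sub s q : s \in `]a, b] -> q \in `]a, s] -> q \in `]a, b].
  by rewrite !in_itv /= => /andP[_ sb] /andP[-> qs]; exact: le_trans sb.
have bound k s : s \in `]a, b] -> u s <= M * (2 / 3) ^+ k * W s.
  elim: k s => [|k IH] s sab.
    have /andP[h1 h2] := uM s sab; have /andP[W1 W2] := WK s.
    by rewrite expr0 mulr1 (le_trans h2)// ler_peMr.
  have sb : s <= b by move: sab; rewrite in_itv /= => /andP[].
  have iW : integ (fun r => mu r * W r) a s.
    apply: (@integ_mul_bounded _ _ _ _ K).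
    - exact: integ_sub imu _ _.
    - exact: measurable_funS mW.
    - by move=> r _; have /andP[h1 h2] := WK r; rewrite ger0_norm//; lra.
  have iu : integ (fun r => mu r * u r) a s.
    apply: (@integ_mul_bounded _ _ _ _ M).
    - exact: integ_sub imu _ _.
    - apply: measurable_funS mu_ => //; first exact: mitv.
      by apply: subset_itvl; rewrite bnd_simp.
    - by move=> r /(sub _ _ sab) rab; have /andP[h1 h2] := uM r rab; rewrite ger0_norm.
  apply: le_trans (hu s sab) _.
  apply: (@le_trans _ _ (Lint (fun r => M * (2 / 3) ^+ k * (mu r * W r)) a s)).
    apply: le_Lint => //; first exact: integZ.
    move=> r /(sub _ _ sab) rab; rewrite mulrCA ler_wpM2l ?mu0//.
    exact: IH.
  rewrite LintZ// exprSr.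
  rewrite [leRHS](_ : _ = M * (2 / 3) ^+ k * (2 / 3 * W s)); last by ring.
  by rewrite ler_wpM2l ?hW// mulr_ge0// exprn_ge0.
apply/eqP; rewrite eq_le; have /andP[-> _] := uM t tab; rewrite andbT.
apply: (@geometric_le0 _ (M * W t) (2 / 3)).
  by rewrite ger0_norm//; lra.
by move=> k; rewrite mulrAC; exact: bound.
Qed.

End Gronwall.

Section Continuous.
Context {R : realType}.
Notation lR := (lebesgueR R).

(** Composing with the retraction of the line to [[a, b]] makes the function
    continuous everywhere, so that measurability and boundedness on [[a, b]] are
    those of a continuous function. *)
Lemma scalar_ac_extension (X : R -> R) (a b : R) : a <= b -> scalar_ac X a b ->
  exists2 Y : R -> R, continuous Y & forall t, a <= t <= b -> Y t = X t.
Proof.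
move=> ab rX.
pose cl t := Num.max a (Num.min b t).
have cla t : a <= cl t by rewrite le_max lexx.
have clb t : cl t <= b by rewrite ge_max ab ge_min lexx.
have cl_mono s t : s <= t -> cl s <= cl t.
  move=> st; rewrite ge_max cla /= /cl le_max; apply/orP; right.
  by rewrite le_min !ge_min lexx st orbT.
have cl_lip s t : s <= t -> cl t - cl s <= t - s.
  move=> st; rewrite lerBlDr {1}/cl ge_max; apply/andP; split.
    by have := cla s; lra.
  have : Num.min b s <= cl s by rewrite le_max lexx orbT.
  case: (leP b s) => h1; case: (leP b t) => h2 h3; lra.
exists (fun t => X (cl t)); last first.
  by move=> t /andP[at_ tb]; rewrite /cl min_r// max_r.
move=> t; apply/continuous_atP => e e0.
have [d d0 hd] := scalar_ac_continuous rX e0.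
exists d => // s; have [st|/ltW ts] := leP s t.
  rewrite (ger0_norm (x := t - s)) ?subr_ge0// => std.
  by apply: hd => //; [exact: cl_mono|apply: le_lt_trans std; exact: cl_lip].
rewrite distrC (ger0_norm (x := s - t)) ?subr_ge0// => std.
rewrite distrC; apply: hd => //; first exact: cl_mono.
by apply: le_lt_trans std; exact: cl_lip.
Qed.

Lemma scalar_ac_measurable (X : R -> R) (a b : R) : scalar_ac X a b ->
  measurable_fun (`[a, b]%classic : set lR) X.
Proof.
move=> rX; have [ab|ba] := leP a b; last first.
  by rewrite set_itv_ge ?bnd_simp -?ltNge//; exact: measurable_fun_set0.
have [Y cY YX] := scalar_ac_extension ab rX.
have mY := borel_lebesgue_fun (continuous_measurable_fun cY).
have : measurable_fun (`[a, b]%classic : set lR) Y by exact: measurable_funS mY.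
by apply: eq_measurable_fun => t; rewrite inE /= in_itv /= => /YX.
Qed.

Lemma scalar_ac_bounded (X : R -> R) (a b : R) : scalar_ac X a b ->
  exists M, forall t, a <= t <= b -> `|X t| <= M.
Proof.
move=> rX; have [ab|ba] := leP a b; last first.
  by exists 0 => t /andP[at_ tb]; move: (lt_le_trans ba (le_trans at_ tb));
    rewrite ltxx.
have [Y cY YX] := scalar_ac_extension ab rX.
have cN : continuous (fun t => `|Y t|).
  by move=> t; apply: cvg_norm; exact: cY.
have [c _ hc] := EVT_max ab (continuous_subspaceT cN).
exists `|Y c| => t tab; rewrite -YX//; apply: hc.
by rewrite in_itv.
Qed.

Lemma Lint_measurable (g : R -> R) (a b : R) : integ g a b ->
  measurable_fun (`]a, b]%classic : set lR) (Lint g a).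
Proof.
move=> ig; have /scalar_ac_measurable := scalar_ac_Lint 0 ig.
rewrite (_ : (fun t => _) = Lint g a); last by apply/funext => t; rewrite add0r.
move=> h; apply: measurable_funS h; first exact: mitv.
by apply: subset_itvr; rewrite bnd_simp.
Qed.

End Continuous.

Section VectorIntegral.
Context {R : realType} {k : nat}.
Implicit Types (phi psi : R -> 'cV[R]_k).
Notation lR := (lebesgueR R).

Lemma vinteg_le phi g a b : vmeasurable `]a, b]%classic phi ->
  (forall t, t \in `]a, b] -> `|phi t| <= g t) -> integ g a b -> vinteg phi a b.
Proof.
move=> mp pg ig i; apply: integ_le ig; first exact: mp.
by move=> t tab; exact: le_trans (norm_coord _ _) (pg t tab).
Qed.

Lemma vinteg_sub phi a b a' b' : vinteg phi a b -> a <= a' -> b' <= b ->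
  vinteg phi a' b'.
Proof. by move=> h aa bb i; exact: integ_sub (h i) aa bb. Qed.

Lemma vLint_norm phi g a b : vinteg phi a b -> integ g a b ->
  (forall t, t \in `]a, b] -> `|phi t| <= g t) -> `|vLint phi a b| <= Lint g a b.
Proof.
move=> ip ig pg; apply: norm_le_coord => [|i].
  by apply: Lint_ge0 => t /pg; exact: le_trans.
rewrite mxE; apply: le_trans (Lint_norm (ip i)) _.
apply: le_Lint => //; first exact: integ_norm (ip i).
by move=> t tab; exact: le_trans (norm_coord _ _) (pg t tab).
Qed.

Lemma vLintB phi psi a b : vinteg phi a b -> vinteg psi a b ->
  vLint (fun t => phi t - psi t) a b = vLint phi a b - vLint psi a b.
Proof.
move=> h1 h2; apply/matrixP => i j; rewrite !mxE -LintB//.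
by apply: eq_Lint => t _; rewrite !mxE.
Qed.

Lemma vintegB phi psi a b : vinteg phi a b -> vinteg psi a b ->
  vinteg (fun t => phi t - psi t) a b.
Proof.
move=> h1 h2 i; have := integB (h1 i) (h2 i).
by congr integ; apply/funext => t; rewrite !mxE.
Qed.

Lemma vLint_split phi a b c : a <= b -> b <= c -> vinteg phi a c ->
  vLint phi a c = vLint phi a b + vLint phi b c.
Proof.
by move=> ab bc ip; apply/matrixP => i j; rewrite !mxE; exact: Lint_split.
Qed.

Lemma eq_vLint phi psi a b : (forall t, t \in `]a, b] -> phi t = psi t) ->
  vLint phi a b = vLint psi a b.
Proof.
by move=> h; apply/matrixP => i j; rewrite !mxE; apply: eq_Lint => t /h ->.
Qed.

Lemma vLint_ge phi a b : b <= a -> vLint phi a b = 0.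
Proof. by move=> ba; apply/matrixP => i j; rewrite !mxE; exact: Lint_ge. Qed.

End VectorIntegral.

Lemma geometric_cvg (R : realType) (u : nat -> R) (C q : R) : 0 <= q -> q < 1 ->
  (forall k, `|u k.+1 - u k| <= C * q ^+ k) -> cvgn u.
Proof.
move=> q0 q1 h.
rewrite (_ : u = (fun n => u 0%N + series (telescope u) n)); last first.
  by apply/funext => n; rewrite -eq_sum_telescope.
apply: is_cvgD; first exact: is_cvg_cst.
apply: normed_cvg; apply: (@series_le_cvg _ _ (geometric C q)) => //.
- by move=> k; exact: normr_ge0.
- by move=> k; exact: le_trans (normr_ge0 _) (h k).
- by apply: is_cvg_geometric_series; rewrite ger0_norm.
Qed.

Section Picard.
Context {R : realType} {n : nat}.
Notation V := 'cV[R]_n.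
Notation lR := (lebesgueR R).

(** Relative to the weight of [gronwall_weight] the Picard map is a contraction
    by [2 / 3], so the iterates converge geometrically at every point; the
    integral equation passes to the limit by dominated convergence, [beta] being
    the dominating function. *)
Theorem caratheodory_picard (H : R -> V -> V) (mu beta : R -> R) (a b : R) (x0 : V) :
  a <= b -> integ mu a b -> integ beta a b ->
  (forall x, vmeasurable `]a, b]%classic x ->
     vmeasurable `]a, b]%classic (fun t => H t (x t))) ->
  (forall t xi zeta, t \in `]a, b] -> `|H t xi - H t zeta| <= mu t * `|xi - zeta|) ->
  (forall t xi, t \in `]a, b] -> `|H t xi| <= beta t) ->
  (forall t, t \in `]a, b] -> 0 <= mu t) ->
  exists x, [/\ vmeasurable `]a, b]%classic x,
    vinteg (fun t => H t (x t)) a b &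
    forall t, a <= t <= b -> x t = x0 + vLint (fun s => H s (x s)) a t].
Proof.
move=> ab imu ibeta mH lip bd mu0.
have [W [K [mW WK hW]]] := gronwall_weight ab imu mu0.
pose step (x : R -> V) (t : R) : V := x0 + vLint (fun s => H s (x s)) a t.
pose x_ k := iter k step (fun=> x0).
have sub s q : s \in `]a, b] -> q \in `]a, s] -> q \in `]a, b].
  by rewrite !in_itv /= => /andP[_ sb] /andP[-> qs]; exact: le_trans sb.
have iH x : vmeasurable `]a, b]%classic x -> vinteg (fun t => H t (x t)) a b.
  by move=> mx; apply: vinteg_le ibeta; [exact: mH|move=> t; exact: bd].
have mstep x : vmeasurable `]a, b]%classic x -> vmeasurable `]a, b]%classic (step x).
  move=> mx i.
  have -> : (fun t => step x t i 0) =
      (fun t => x0 i 0 + Lint (fun s => H s (x s) i 0) a t).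
    by apply/funext => t; rewrite /step !mxE.
  apply: measurable_funD; first exact: measurable_cst.
  exact: Lint_measurable (iH x mx i).
have mx k : vmeasurable `]a, b]%classic (x_ k).
  by elim: k => [|k IH]; [exact: vmeasurable_cst|exact: mstep].
have iHs x t : t \in `]a, b] -> vmeasurable `]a, b]%classic x ->
    vinteg (fun t => H t (x t)) a t.
  rewrite in_itv /= => /andP[_ tb] m; apply: vinteg_sub (iH x m) _ _ => //.
pose M := Lint beta a b.
have beta0 t : t \in `]a, b] -> 0 <= beta t by move=> tab; exact: le_trans (bd t 0 tab).
have M0 : 0 <= M by apply: Lint_ge0.
have dx k t : t \in `]a, b] -> `|x_ k.+1 t - x_ k t| <= M * (2 / 3) ^+ k * W t.
  elim: k t => [|k IH] t tab.
    have /andP[W1 W2] := WK t.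
    rewrite expr0 mulr1 /= /step addrC addKr.
    have tb : t <= b by move: tab; rewrite in_itv /= => /andP[].
    apply: (@le_trans _ _ M); last by rewrite ler_peMr.
    apply: (@le_trans _ _ (Lint beta a t)).
      apply: vLint_norm; first exact: iHs (mx 0%N).
        exact: integ_sub ibeta _ _.
      by move=> s /(sub _ _ tab) sab; exact: bd.
    by apply: Lint_mono.
  have tb : t <= b by move: tab; rewrite in_itv /= => /andP[].
  have -> : x_ k.+2 t - x_ k.+1 t =
      vLint (fun s => H s (x_ k.+1 s) - H s (x_ k s)) a t.
    rewrite vLintB; [|exact: iHs|exact: iHs].
    by rewrite [x_ k.+2 t]/= [x_ k.+1 t in LHS]/= /step opprD addrACA subrr add0r.
  have iW : integ (fun r => mu r * W r) a t.
    apply: (@integ_mul_bounded _ _ _ _ _ K).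
    - exact: integ_sub imu _ _.
    - exact: measurable_funS mW.
    - by move=> r _; have /andP[h1 h2] := WK r; rewrite ger0_norm//; lra.
  apply: (@le_trans _ _ (Lint (fun r => M * (2 / 3) ^+ k * (mu r * W r)) a t)).
    apply: vLint_norm.
    - by apply: vintegB; exact: iHs.
    - exact: integZ.
    - move=> s /(sub _ _ tab) sab; apply: le_trans (lip _ _ _ sab) _.
      by rewrite mulrCA ler_wpM2l ?mu0// IH.
  rewrite LintZ// exprSr.
  rewrite [leRHS](_ : _ = M * (2 / 3) ^+ k * (2 / 3 * W t)); last by ring.
  by rewrite ler_wpM2l ?hW// mulr_ge0// exprn_ge0.
have cx t i : t \in `]a, b] -> cvgn (fun k => x_ k t i 0).
  move=> tab; apply: (@geometric_cvg _ _ (M * W t) (2 / 3)); [lra|lra|].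
  move=> k; have := norm_coord (x_ k.+1 t - x_ k t) i; rewrite !mxE.
  by move=> /le_trans; apply; rewrite mulrAC; exact: dx.
pose y t : V := \col_i limn (fun k => x_ k t i 0).
have xy t i : t \in `]a, b] -> x_ k t i 0 @[k --> \oo] --> y t i 0.
  by move=> tab; rewrite mxE; exact: cx.
have xyn t e : t \in `]a, b] -> 0 < e -> \forall k \near \oo, `|y t - x_ k t| <= e.
  move=> tab e0.
  have h i : \forall k \near \oo, `|y t i 0 - x_ k t i 0| <= e.
    by have /cvgrPdist_le/(_ _ e0) := xy t i tab.
  have {}h : \forall k \near \oo, forall i, `|y t i 0 - x_ k t i 0| <= e.
    exact: filter_forall.
  apply: filterS h => k hk; apply: norm_le_coord => [|i]; first exact: ltW.
  by have := hk i; rewrite !mxE.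
have my : vmeasurable `]a, b]%classic y.
  move=> i; apply: (@measurable_fun_cvg _ lR R _ (fun k t => x_ k t i 0)).
    by move=> k; exact: mx.
  by move=> t tab; exact: xy.
have ey t : t \in `]a, b] -> y t = step y t.
  move=> tab; apply/matrixP => i j; rewrite ord1.
  have tb : t <= b by move: tab; rewrite in_itv /= => /andP[].
  have subt : `]a, t]%classic `<=` `]a, b]%classic by apply: subset_itvl;
    rewrite bnd_simp.
  have c1 := xy t i tab.
  have [|||| _ c2] := @Lint_cvg R (fun k s => H s (x_ k s) i 0)
     (fun s => H s (y s) i 0) beta a t.
  - by move=> k; apply: measurable_funS (mH _ (mx k) i) => //; exact: mitv.
  - move=> s /(sub _ _ tab) sab; apply/cvgrPdist_lt => e e0.
    have m1 : 0 < mu s + 1 by rewrite ltr_wpDl// mu0.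
    apply: filterS (xyn s _ sab (divr_gt0 e0 m1)) => k hk.
    have := norm_coord (H s (y s) - H s (x_ k s)) i; rewrite !mxE => /le_lt_trans;
      apply.
    apply: le_lt_trans (lip _ _ _ sab) _.
    apply: (@le_lt_trans _ _ (mu s * (e / (mu s + 1)))).
      by rewrite ler_wpM2l ?mu0.
    by rewrite mulrCA gtr_pMr// ltr_pdivrMr// mul1r ltrDl.
  - exact: integ_sub ibeta _ _.
  - move=> k s /(sub _ _ tab) sab; exact: le_trans (norm_coord _ _) (bd _ _ sab).
  have c3 : x_ k.+1 t i 0 @[k --> \oo] --> step y t i 0.
    rewrite [X in _ --> X]mxE [X in _ --> _ + X]mxE.
    rewrite (_ : (fun k => _) = fun k => x0 i 0 + Lint (fun s => H s (x_ k s) i 0) a t).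
      by apply: cvgD => //; exact: cvg_cst.
    by apply/funext => k; rewrite /= /step !mxE.
  have c1' : x_ k.+1 t i 0 @[k --> \oo] --> y t i 0.
    by rewrite (cvg_shiftS (fun k => x_ k t i 0)).
  exact: (cvg_unique _ c1' c3).
have Hy t : t <= b -> vLint (fun s => H s (step y s)) a t =
  vLint (fun s => H s (y s)) a t.
  move=> tb; apply: eq_vLint => s; rewrite in_itv /= => /andP[as_ st].
  by rewrite -ey// in_itv /= as_ (le_trans st).
(* y solves the equation only on the half-open interval, where the limit is
   known to exist; step y also takes the initial value at a *)
exists (step y); split; first exact: mstep.
  by apply: iH; exact: mstep.
by move=> t /andP[_ tb]; rewrite Hy.
Qed.

End Picard.

(** * Norms, integrability and truncation *)

Section DominatedFinite.
Context d (T : measurableType d) (R : realType) (mu : {measure set T -> \bar R}).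
Implicit Types (D : set T) (g h : T -> R).

Lemma dominated_integrable D g h : measurable D ->
  measurable_fun D g -> measurable_fun D h ->
  (forall t, D t -> `|g t| <= h t) -> (\int[mu]_(t in D) (h t)%:E < +oo)%E ->
  mu.-integrable D (EFin \o g).
Proof.
move=> mD mg mh gh fin; apply/integrableP; split; first exact/measurable_EFinP.
apply: le_lt_trans fin; apply: ge0_le_integral => //.
- by apply: measurableT_comp => //; exact/measurable_EFinP.
- exact/measurable_EFinP.
Qed.

Lemma integral_finite D g : measurable D -> mu.-integrable D (EFin \o g) ->
  (\int[mu]_(t in D) (g t)%:E < +oo)%E.
Proof. by move=> mD ig; exact: integrable_lty. Qed.

End DominatedFinite.

Section Conversions.
Context {R : realType} {k : nat}.
Notation lR := (lebesgueR R).
Notation mu := (@leb R).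
Implicit Types (g h : R -> 'cV[R]_k) (D : set R) (a b : R).

Lemma vmeasurable_norm D g : measurable (D : set lR) -> vmeasurable D g ->
  measurable_fun (D : set lR) (fun t => `|g t|).
Proof.
move=> mD mg.
have H (s : seq ('I_k * 'I_1)) :
    measurable_fun (D : set lR) (fun t => \big[Num.max/0]_(i <- s) `|g t i.1 i.2|).
  elim: s => [|[i j] s IH].
    by under eq_fun do rewrite big_nil; exact: measurable_cst.
  under eq_fun do rewrite big_cons.
  apply: measurable_maxr; last exact: IH.
  by rewrite [j]ord1; exact: measurableT_comp.
have := H (index_enum ('I_k * 'I_1)%type).
by congr measurable_fun; apply/funext => t; rewrite [RHS]/Num.Def.normr/= mx_normrE.
Qed.

Lemma vmeasurable_enorm D g : measurable (D : set lR) -> vmeasurable D g ->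
  measurable_fun (D : set lR) (fun t => enorm (g t)).
Proof.
move=> mD mg; rewrite /enorm.
apply: (measurableT_comp (f := @Num.sqrt R)).
  by apply: continuous_measurable_fun; exact: sqrt_continuous.
by apply: measurable_sum => i; exact: measurable_funX.
Qed.

Lemma vmeasurable_ae D g h : measurable (D : set lR) ->
  {ae mu, forall t, D t -> g t = h t} -> vmeasurable D g -> vmeasurable D h.
Proof.
move=> mD gh mg i; apply/measurable_EFinP.
apply: (@ae_measurable_fun _ lR R mu completed_lebesgue_measure_is_complete D
  (EFin \o (fun t => g t i 0))).
  by apply: filterS gh => t /= e Dt; rewrite e.
exact/measurable_EFinP.
Qed.

Lemma vmeasurableS D E g : measurable (D : set lR) -> E `<=` D ->
  vmeasurable D g -> vmeasurable E g.
Proof. by move=> mD ED mg i; apply: measurable_funS (mg i). Qed.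

Lemma closed_itv_setU a b : `[a, b]%classic `<=` [set a] `|` `]a, b]%classic.
Proof.
move=> t /=; rewrite !in_itv /= le_eqVlt => /andP[/predU1P[->|->] ->].
  by left.
by right.
Qed.

Lemma measurable_pt a : measurable ([set a] : set lR).
Proof. by apply: borel_lebesgue; exact: measurable_set1. Qed.

Lemma leb_pt a : mu [set a] = 0%E.
Proof. exact: lebesgue_measure_set1. Qed.

Lemma vmeasurable_closed a b g : vmeasurable `]a, b]%classic g ->
  vmeasurable `[a, b]%classic g.
Proof.
move=> mg i.
apply: (@measurable_funS _ _ lR _ ([set a] `|` `]a, b]%classic)).
- by apply: measurableU; [exact: measurable_pt|exact: mitv].
- exact: closed_itv_setU.
- apply/measurable_funU; [exact: measurable_pt|exact: mitv|split].
    exact: measurable_fun_set1.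
  exact: mg.
Qed.

Lemma L1_vinteg a b g : L1 `[a, b]%classic g -> vinteg g a b.
Proof.
move=> [mg fin] i.
have sub : `]a, b]%classic `<=` (`[a, b]%classic : set R).
  by apply: subset_itvr; rewrite bnd_simp.
have me := vmeasurable_enorm (mitv `[a, b]) mg.
have gi : mu.-integrable `[a, b]%classic (EFin \o (fun t => g t i 0)).
  apply: (dominated_integrable (mitv _) (mg i) me _ fin) => t _.
  exact: coord_enorm.
exact: (integrableS (mitv _) (mitv _) sub gi).
Qed.

Lemma vinteg_L1 a b g : vinteg g a b -> L1 `[a, b]%classic g.
Proof.
move=> ig.
have mg : vmeasurable `]a, b]%classic g by move=> i; exact: integ_measurable (ig i).
have mg' := vmeasurable_closed mg.
split => //.
have me := vmeasurable_enorm (mitv `[a, b]) mg'.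
pose s t := \sum_i `|g t i 0|.
have ms : measurable_fun (`[a, b]%classic : set lR) s.
  by apply: measurable_sum => i; exact: measurableT_comp.
have is_ : integ s a b.
  have := @integrable_sum _ lR R mu `]a, b]%classic (mitv _) _ (index_enum 'I_k) xpredT
    (fun i t => (`|g t i 0|)%:E).
  move=> H; have := H (fun i _ => integ_norm (ig i)).
  by apply: eq_integrable; [exact: mitv|move=> t _; rewrite /= sumEFin].
have is' : mu.-integrable `[a, b]%classic (EFin \o s).
  apply/(@negligible_integrable _ lR R mu _ [set a]).
  - exact: measurable_pt.
  - exact: mitv.
  - exact/measurable_EFinP.
  - exact: leb_pt.
  apply: integrableS is_; [exact: mitv| |].
    by apply: measurableD; [exact: mitv|exact: measurable_pt].
  by move=> t [/closed_itv_setU[]].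
apply: (integral_finite (mitv _)).
apply: (dominated_integrable (mitv _) me ms _ (integral_finite (mitv _) is')) => t _.
by rewrite ger0_norm ?enorm_ge0// enorm_sum.
Qed.

End Conversions.

Section Clip.
Context {R : realType} {k : nat}.
Implicit Types z : 'cV[R]_k.

(** The projection to the cube of radius [r], which is the ball of the maximum
    norm. *)
Definition clip (r : R) z : 'cV[R]_k :=
  \col_i Num.max (- r) (Num.min r (z i 0)).

Lemma clip_norm r z : 0 <= r -> `|clip r z| <= r.
Proof.
move=> r0; apply: norm_le_coord => // i; rewrite mxE ler_norml le_max lexx /=.
by rewrite ge_max ge_min lexx /= andbT; lra.
Qed.

Lemma clip_id r z : `|z| <= r -> clip r z = z.
Proof.
move=> zr; apply/matrixP => i j; rewrite ord1 mxE.
have := le_trans (norm_coord z i) zr; rewrite ler_norml => /andP[h1 h2].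
by rewrite min_r// max_r.
Qed.

Lemma clip_lip r z z' : 0 <= r -> `|clip r z - clip r z'| <= `|z - z'|.
Proof.
move=> r0; apply: norm_le_coord => // i; apply: le_trans (norm_coord _ i).
rewrite !mxE; set u := z i 0; set v := z' i 0.
have h (a b : R) : a <= b ->
  0 <= Num.max (- r) (Num.min r b) - Num.max (- r) (Num.min r a) <= b - a.
  move=> ab; case: (leP r b) => h1; case: (leP r a) => h2;
  repeat (case: (leP (- r) _) => ?); apply/andP; split; lra.
have [uv|/ltW vu] := leP u v.
  have /andP[h1 h2] := h _ _ uv.
  by rewrite distrC [leRHS]distrC !ger0_norm// subr_ge0.
have /andP[h1 h2] := h _ _ vu.
by rewrite !ger0_norm// subr_ge0.
Qed.

Lemma vmeasurable_clip (D : set R) r (g : R -> 'cV[R]_k) :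
  measurable (D : set (lebesgueR R)) -> vmeasurable D g ->
    vmeasurable D (fun t => clip r (g t)).
Proof.
move=> mD mg i.
have -> : (fun t => clip r (g t) i 0) =
  (cst (- r) \max (cst r \min (fun t => g t i 0))).
  by apply/funext => t; rewrite mxE.
by apply: measurable_maxr => //; apply: measurable_minr.
Qed.

End Clip.

Section OperatorBound.
Context {R : realType} {k l : nat}.

(** Here [|A|] is the largest modulus of an entry, so [op_bound A] dominates the
    absolute row sums of [A]. *)
Definition op_bound (A : 'M[R]_(k, l)) : R := l%:R * `|A|.

Lemma op_bound_ge0 A : 0 <= op_bound A. Proof. by rewrite mulr_ge0. Qed.

Lemma norm_mulmx (A : 'M[R]_(k, l)) (z : 'cV[R]_l) : `|A *m z| <= op_bound A * `|z|.
Proof.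
apply: norm_le_coord => [|i]; first by rewrite mulr_ge0// op_bound_ge0.
rewrite mxE (le_trans (ler_norm_sum _ _ _))//.
rewrite (le_trans (ler_sum _ (G := fun=> `|A| * `|z|) _))//.
  move=> j _; rewrite normrM ler_pM ?norm_coord//.
  rewrite [leRHS]/Num.Def.normr/= mx_normrE.
  exact: (le_bigmax_cond _ (fun i => `|A i.1 i.2|) (j := (i, j))).
by rewrite sumr_const card_ord /op_bound -mulrA mulr_natl.
Qed.

End OperatorBound.

Section EnormIntegrable.
Context {R : realType} {k : nat}.
Notation lR := (lebesgueR R).
Notation mu := (@leb R).

Lemma L1_enorm (g : R -> 'cV[R]_k) a b : L1 `[a, b]%classic g ->
  integ (fun t => enorm (g t)) a b.
Proof.
move=> [mg fin].
have me := vmeasurable_enorm (mitv `[a, b]) mg.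
have : mu.-integrable `[a, b]%classic (EFin \o (fun t => enorm (g t))).
  apply: (dominated_integrable (mitv _) me me _ fin) => t _.
  by rewrite ger0_norm// enorm_ge0.
apply: integrableS; [exact: mitv|exact: mitv|].
by apply: subset_itvr; rewrite bnd_simp.
Qed.

End EnormIntegrable.

(** * Inversion of the output equation *)

(** Since [F = id - D f], the two bounds together make [F t] Lipschitz in both
    directions on compact sets. *)
Definition locally_bilipschitz {R : realType} {n m me p : nat}
    (S : lure R n m me p) : Prop :=
  forall (T : set R) (K : set 'cV[R]_p),
  compact T -> T `<=` Rplus -> compact K ->
  exists (lambda : R -> R) (eps : R),
    [/\ (forall t, 0 <= t -> 0 <= lambda t),
        (forall a b : R, `[a, b]%classic `<=` Rplus ->
           (@leb R).-integrable `[a, b]%classic (fun t => (lambda t)%:E)),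
        0 < eps,
        (forall t xi zeta, 0 <= t -> K xi -> K zeta ->
           enorm (lf S t xi - lf S t zeta) <= lambda t * enorm (xi - zeta)) &
        (forall t xi zeta, T t -> K xi -> K zeta ->
           eps * enorm (xi - zeta) <= enorm (lF S t xi - lF S t zeta))].

Section LureInverse.
Context {R : realType} {n m me p : nat} (S : lure R n m me p).
Notation lR := (lebesgueR R).
Notation f := (lf S).
Notation F := (lF S).
Hypothesis hint : exists xi0 : 'cV[R]_p, locally L1 Rplus (fun t => f t xi0).
Hypothesis hrad : radially_unbounded_loc_unif F.
Hypothesis hlip : locally_bilipschitz S.

Lemma itv_Rplus (a b : R) : 0 <= a -> `[a, b]%classic `<=` (Rplus : set R).
Proof.
by move=> a0 t /=; rewrite /Rplus /= !in_itv /= andbT => /andP[/(le_trans a0)].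
Qed.

(** The case of balls and of intervals [[0, T]], restated for the maximum norm at
    the cost of a factor depending on the dimension. *)
Lemma lipschitz_ball (T r : R) : exists (lam : R -> R) (eps : R),
  [/\ (forall t, 0 <= t -> 0 <= lam t),
      (forall a b : R, 0 <= a -> integ lam a b),
      0 < eps,
      (forall t xi zeta, 0 <= t -> `|xi| <= r -> `|zeta| <= r ->
         `|f t xi - f t zeta| <= lam t * `|xi - zeta|) &
      (forall t xi zeta, 0 <= t <= T -> `|xi| <= r -> `|zeta| <= r ->
         eps * `|xi - zeta| <= `|F t xi - F t zeta|)].
Proof.
have [lam [eps [l0 li e0 lip low]]] := hlip (@segment_compact R 0 T)
   (@itv_Rplus 0 T (lexx _)) (@compact_cball R p r).
exists (fun t => p%:R * lam t), (eps / p.+1%:R); split.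
- by move=> t t0; rewrite mulr_ge0// l0.
- move=> a b a0; apply: integZ; have := li a b (itv_Rplus a0).
  apply: integrableS; [exact: mitv|exact: mitv|].
  by apply: subset_itvr; rewrite bnd_simp.
- by rewrite divr_gt0.
- move=> t xi zeta t0 xr zr; apply: le_trans (norm_enorm _) _.
  apply: le_trans (lip _ _ _ t0 xr zr) _.
  by rewrite mulrAC [leRHS]mulrC ler_wpM2l ?l0// enorm_norm.
- move=> t xi zeta tT xr zr; rewrite mulrAC ler_pdivrMr//.
  apply: (@le_trans _ _ (eps * enorm (xi - zeta))).
    by rewrite ler_wpM2l ?norm_enorm// ltW.
  apply: le_trans (low t xi zeta _ xr zr) _; first by rewrite /= in_itv.
  apply: le_trans (enorm_norm _) _; rewrite mulrC ler_wpM2l//.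
  by rewrite ler_nat.
Qed.

Lemma F_radial (T rho : R) : exists2 sigma : R, 0 <= sigma &
  forall t xi, 0 <= t <= T -> sigma <= `|xi| -> rho <= `|F t xi|.
Proof.
have r0 : 0 < p%:R * `|rho| + 1 by rewrite ltr_wpDl// mulr_ge0.
have [s s0 hs] := hrad r0 (@segment_compact R 0 T) (@itv_Rplus 0 T (lexx _)).
exists s => // t xi tT sx.
have := hs t xi; rewrite /= in_itv => /(_ tT (le_trans sx (norm_enorm _))) h.
have := le_trans h (enorm_norm _) => {}h.
rewrite leNgt; apply/negP => Fr.
have : p%:R * `|F t xi| <= p%:R * `|rho|.
  by rewrite ler_wpM2l// (le_trans (ltW Fr))// ler_norm.
lra.
Qed.

Lemma lF_sub t xi zeta :
  F t xi - F t zeta = (xi - zeta) - lD S *m (f t xi - f t zeta).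
Proof. by rewrite /lF mulmxBr !opprD !opprK addrACA. Qed.

Lemma F_lipschitz (t L : R) xi zeta : `|f t xi - f t zeta| <= L * `|xi - zeta| ->
  `|F t xi - F t zeta| <= (1 + op_bound (lD S) * L) * `|xi - zeta|.
Proof.
move=> h; rewrite lF_sub.
rewrite (le_trans (ler_normB _ _))// mulrDl mul1r lerD//.
by rewrite (le_trans (norm_mulmx _ _))// -mulrA ler_wpM2l ?op_bound_ge0// distrC.
Qed.

Lemma F_continuous (t : R) : 0 <= t -> continuous (F t).
Proof.
move=> t0 xi; apply/continuous_atP => e e0.
pose B := op_bound (lD S) + 1.
have B0 : 0 < B by rewrite ltr_wpDl// op_bound_ge0.
have := (lf_caratheodory S).1 t t0 xi.
move=> /continuous_atP/(_ (e / (2 * B)))[|r r0 hr];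
  first by rewrite divr_gt0// mulr_gt0.
exists (Num.min r (e / 2)); first by rewrite lt_min r0 divr_gt0.
move=> y; rewrite lt_min => /andP[y1 y2].
rewrite lF_sub.
rewrite (le_lt_trans (ler_normB _ _))// [ltRHS](splitr e) ltrD//.
rewrite (le_lt_trans (norm_mulmx _ _))//.
have := hr y y1; rewrite invfM mulrA ltr_pdivlMr// mulrC => h.
apply: le_lt_trans h; rewrite ler_wpM2r// /B; lra.
Qed.

Lemma F_injective (t : R) : 0 <= t -> injective (F t).
Proof.
move=> t0 xi zeta e.
have [lam [eps [_ _ e0 _ low]]] := lipschitz_ball t (Num.max `|xi| `|zeta|).
have := low t xi zeta; rewrite t0 lexx !le_max !lexx orbT => /(_ isT isT isT).
rewrite e subrr normr0 pmulr_rle0// normr_le0 subr_eq0 => /eqP //.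
Qed.

(** In dimension zero, which [continuous_injective_surjective] excludes, there is
    only one point. *)
Lemma F_surjective (t : R) : 0 <= t -> forall z, exists xi, F t xi = z.
Proof.
move=> t0.
have rad (rho : R) : exists sigma, forall x, sigma <= `|x| -> rho <= `|F t x|.
  have [s _ hs] := F_radial t rho; exists s => x sx; apply: hs => //.
  by rewrite t0 lexx.
move: (F_continuous t0) (F_injective t0) rad; move: (F t).
clear; case: p => [|d] G cG iG rG z.
  by exists 0; rewrite [LHS]flatmx0 [RHS]flatmx0.
exact: continuous_injective_surjective.
Qed.

Definition lF_inv (t : R) (z : 'cV[R]_p) : 'cV[R]_p := xget 0 [set xi | F t xi = z].

Lemma lF_invK t z : 0 <= t -> F t (lF_inv t z) = z.
Proof.
move=> t0; rewrite /lF_inv; case: xgetP => // h.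
by have [xi /h] := F_surjective t0 z.
Qed.

Lemma lF_invE t xi z : 0 <= t -> F t xi = z -> lF_inv t z = xi.
Proof. by move=> t0 e; apply: (F_injective t0); rewrite lF_invK. Qed.

(** Radial unboundedness keeps [F_t^-1 z] in one ball of radius [s] for
    [t <= T] and [|z| <= rho].  On a larger ball that also contains [xi0], the
    constants [lam] and [eps] give the Lipschitz constant [lam / eps] of
    [f t (F_t^-1 z)], and comparison with [f t xi0] gives the dominating
    function. *)
Lemma output_bounds (T rho : R) : 0 <= rho -> exists (sigma : R) (L bet : R -> R),
  [/\ (forall a b : R, 0 <= a -> integ L a b) /\ (forall t, 0 <= t -> 0 <= L t),
      (forall a b : R, 0 <= a -> integ bet a b),
      (forall t z, 0 <= t <= T -> `|z| <= rho ->
         `|lF_inv t z| <= sigma /\ `|f t (lF_inv t z)| <= bet t),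
      (forall t z z', 0 <= t <= T -> `|z| <= rho -> `|z'| <= rho ->
         `|f t (lF_inv t z) - f t (lF_inv t z')| <= L t * `|z - z'|) &
      (forall a b (w : R -> 'cV[R]_p), 0 <= a -> b <= T ->
         vmeasurable `]a, b]%classic w ->
         (forall t, t \in `]a, b] -> `|w t| <= rho) ->
         vmeasurable `]a, b]%classic (fun t => lF_inv t (w t)) /\
         vmeasurable `]a, b]%classic (fun t => f t (lF_inv t (w t))))].
Proof.
move=> rho0.
have [xi0 hxi0] := hint.
have [s s0 hs] := F_radial T (rho + 1).
have gs t z : 0 <= t <= T -> `|z| <= rho -> `|lF_inv t z| <= s.
  move=> tT zr; rewrite leNgt; apply/negP => /ltW /(hs t _ tT).
  have /andP[t0 _] := tT; rewrite lF_invK// => h; lra.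
pose r := s + `|xi0|.
have r0 : 0 <= r by rewrite addr_ge0.
have [lam [eps [l0 li e0 lip low]]] := lipschitz_ball T (r + 1).
have sr1 (z : 'cV[R]_p) : `|z| <= s -> `|z| <= r + 1.
  move=> zs; rewrite /r; have : 0 <= `|xi0| by []. lra.
have xr1 : `|xi0| <= r + 1 by rewrite /r; lra.
exists s, (fun t => eps^-1 * lam t),
  (fun t => enorm (f t xi0) + (s + `|xi0|) * lam t); split.
- split=> [a b a0|t t0]; first by apply: integZ; exact: li.
  by rewrite mulr_ge0 ?l0// invr_ge0 ltW.
- move=> a b a0; apply: integD; last by apply: integZ; exact: li.
  by apply: L1_enorm; apply: hxi0; exact: itv_Rplus.
- move=> t z tT zr; have /andP[t0 _] := tT; have gz := gs t z tT zr; split => //.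
  rewrite -(subrK (f t xi0) (f t (lF_inv t z))) (le_trans (ler_normD _ _))// addrC.
  rewrite lerD ?norm_enorm// (le_trans (lip _ _ _ t0 (sr1 _ gz) xr1))// mulrC.
  by rewrite ler_wpM2r ?l0// (le_trans (ler_normB _ _))// lerD.
- move=> t z z' tT zr zr'; have /andP[t0 _] := tT.
  have gz := sr1 _ (gs t z tT zr); have gz' := sr1 _ (gs t z' tT zr').
  apply: le_trans (lip _ _ _ t0 gz gz') _.
  have := low _ _ _ tT gz gz'; rewrite !lF_invK// mulrC -ler_pdivlMr// => h.
  by rewrite [eps^-1 * _]mulrC -mulrA ler_wpM2l ?l0// mulrC.
- move=> a b w a0 bT mw wr.
  have tab t : `]a, b]%classic t -> 0 <= t <= T.
    rewrite /= in_itv /= => /andP[at_ tb].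
    by rewrite (le_trans tb)// (le_trans a0)// ltW.
  have sr : s <= r by rewrite /r lerDl.
  have subP : `]a, b]%classic `<=` (Rplus : set R).
    by move=> t /tab /andP[t0 _]; rewrite /Rplus /= in_itv /= t0.
  have mf xi : vmeasurable `]a, b]%classic (fun t => f t xi).
    by move=> i; apply: measurable_funS ((lf_caratheodory S).2 xi i) => //; exact: mitv.
  have mF xi : vmeasurable `]a, b]%classic (fun t => F t xi).
    rewrite /lF; apply: vmeasurableB; first exact: vmeasurable_cst.
    exact: vmeasurable_mulmx.
  have mg : vmeasurable `]a, b]%classic (fun t => lF_inv t (w t)).
    apply: (@vmeasurable_inverse _ _ _ F _ w r eps) => //; first exact: mitv.
    + move=> t /tab /andP[t0 _].
      exists (1 + op_bound (lD S) * lam t).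
        by rewrite addr_ge0// mulr_ge0 ?op_bound_ge0// l0.
      by move=> xi zeta x1 z1; apply: F_lipschitz; exact: lip.
    + by move=> t xi zeta /tab; exact: low.
    + by move=> t Dt; apply: le_trans sr; apply: gs; [exact: tab|exact: wr].
    + by move=> t /tab /andP[t0 _]; rewrite lF_invK.
  split; first exact: mg.
  apply: (@vmeasurable_comp _ _ _ _ f lam _ r) => //.
  + exact: integ_measurable (li a b a0).
  + by move=> t /tab /andP[t0 _]; exact: l0.
  + by move=> t xi zeta /tab /andP[t0 _]; exact: lip.
  + by move=> t Dt; apply: le_trans sr; apply: gs; [exact: tab|exact: wr].
Qed.

End LureInverse.

(** * The closed loop as a differential equation *)

Section AeVector.
Context {R : realType} {k : nat}.
Notation lR := (lebesgueR R).
Notation mu := (@leb R).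

Lemma vinteg_ae (g h : R -> 'cV[R]_k) a b :
  {ae mu, forall t, t \in `]a, b] -> g t = h t} -> vinteg g a b ->
  vinteg h a b /\ vLint g a b = vLint h a b.
Proof.
move=> gh ig.
have mg : vmeasurable `]a, b]%classic g by move=> i; exact: integ_measurable (ig i).
have mh : vmeasurable `]a, b]%classic h.
  by apply: vmeasurable_ae mg; [exact: mitv|exact: gh].
have ghi i : {ae mu, forall t, `]a, b]%classic t -> g t i 0 = h t i 0}.
  by apply: filterS gh => t /= e tab; rewrite e.
split=> [i|].
  exact: (ae_eq_integrable (mitv _) (mh i) (ghi i) (ig i)).
apply/matrixP => i j; rewrite !mxE.
exact: (ae_eq_Rintegral (mitv _) (mh i) (ghi i) (ig i)).
Qed.

Lemma vinteg_bounded (g : R -> 'cV[R]_k) (M a b : R) :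
  vmeasurable `]a, b]%classic g ->
  (forall t, t \in `]a, b] -> `|g t| <= M) -> vinteg g a b.
Proof. by move=> mg gM; apply: (vinteg_le mg gM); exact: integ_cst. Qed.

End AeVector.

Section ClosedLoop.
Context {R : realType} {n m me p : nat} (S : lure R n m me p).
Notation lR := (lebesgueR R).
Notation mu := (@leb R).
Notation f := (lf S).
Notation F := (lF S).
Hypothesis hint : exists xi0 : 'cV[R]_p, locally L1 Rplus (fun t => f t xi0).
Hypothesis hrad : radially_unbounded_loc_unif F.
Hypothesis hlip : locally_bilipschitz S.
Variable v : R -> 'cV[R]_me.
Hypothesis hv : locally Linfty Rplus v.

(** Solving the output equation for [y] turns the system into the differential
    equation with right-hand side [closed_loop]. *)
Definition output_map (t : R) (xi : 'cV[R]_n) : 'cV[R]_p :=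
  lF_inv S t (lC S *m xi + lDe S *m v t).
Definition closed_loop (t : R) (xi : 'cV[R]_n) : 'cV[R]_n :=
  lA S *m xi + lB S *m f t (output_map t xi) + lBe S *m v t.

Lemma input_bound (a b : R) : 0 <= a -> exists2 M : R, 0 <= M &
  vmeasurable `]a, b]%classic v /\ {ae mu, forall t, t \in `]a, b] -> `|v t| <= M}.
Proof.
move=> a0; have [mv [M hM]] := hv (@itv_Rplus _ a b a0).
have sub : `]a, b]%classic `<=` (`[a, b]%classic : set R).
  by apply: subset_itvr; rewrite bnd_simp.
exists `|M| => //; split; first by apply: vmeasurableS mv => //; exact: mitv.
apply: filterS hM => t h /sub /h vt.
exact: le_trans (norm_enorm _) (le_trans vt (ler_norm _)).
Qed.

(** Clip the state to radius [r] and the input to its essential bound [M].  The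
    argument of [F_t^-1] then stays in a fixed ball, where [output_bounds] gives
    a global Lipschitz constant and a dominating function.  Clipping the input
    changes it on a null set of times only, hence the agreement with
    [closed_loop] almost everywhere. *)
Lemma truncated_field (t0 T r : R) : 0 <= t0 -> 0 <= r ->
  exists (H : R -> 'cV[R]_n -> 'cV[R]_n) (kap beta : R -> R),
  [/\ integ kap t0 T /\ integ beta t0 T,
    (forall x, vmeasurable `]t0, T]%classic x ->
     vmeasurable `]t0, T]%classic (fun t => H t (x t))),
    (forall t, t \in `]t0, T] -> 0 <= kap t /\
      forall xi zeta, `|H t xi - H t zeta| <= kap t * `|xi - zeta|),
    (forall t xi, t \in `]t0, T] -> `|H t xi| <= beta t) &
    {ae mu, forall t, t \in `]t0, T] -> forall xi, `|xi| <= r ->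
      H t xi = closed_loop t xi} /\
    (forall x, vmeasurable `]t0, T]%classic x ->
      (forall t, t \in `]t0, T] -> `|x t| <= r) ->
      vinteg (fun t => output_map t (x t)) t0 T /\ vinteg
        (fun t => f t (output_map t (x t))) t0 T)].
Proof.
move=> a0 r0.
have [M M0 [mv vM]] := input_bound T a0.
pose rho := op_bound (lC S) * r + op_bound (lDe S) * M.
have rho0 : 0 <= rho by rewrite addr_ge0// mulr_ge0// op_bound_ge0.
have [sg [L [bet [[iL L0] ibet bd lip meas]]]] := output_bounds hint hrad hlip T rho0.
pose v' t := clip M (v t).
pose w t xi := lC S *m clip r xi + lDe S *m v' t.
have wr t xi : `|w t xi| <= rho.
  rewrite (le_trans (ler_normD _ _))// lerD//.
    by rewrite (le_trans (norm_mulmx _ _))// ler_wpM2l ?op_bound_ge0// clip_norm.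
  by rewrite (le_trans (norm_mulmx _ _))// ler_wpM2l ?op_bound_ge0// clip_norm.
have tT t : t \in `]t0, T] -> 0 <= t <= T.
  by rewrite in_itv /= => /andP[h1 ->]; rewrite (le_trans a0)// ltW.
have mv' : vmeasurable `]t0, T]%classic v'.
  by apply: vmeasurable_clip => //; exact: mitv.
have mw x : vmeasurable `]t0, T]%classic x ->
    vmeasurable `]t0, T]%classic (fun t => w t (x t)).
  move=> mx; apply: vmeasurableD; last exact: vmeasurable_mulmx.
  by apply: vmeasurable_mulmx; apply: vmeasurable_clip; [exact: mitv|exact: mx].
pose H t xi := lA S *m clip r xi + lB S *m f t (lF_inv S t (w t xi)) + lBe S *m v' t.
exists H, (fun t => op_bound (lA S) + op_bound (lB S) * op_bound (lC S) * L t),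
  (fun t => op_bound (lA S) * r + op_bound (lBe S) * M + op_bound (lB S) * bet t);
    split.
- split; apply: integD; [exact: integ_cst| |exact: integ_cst|].
    by apply: integZ; exact: iL.
  by apply: integZ; exact: ibet.
- move=> x mx; have [m1 m2] := meas t0 T (fun t => w t (x t)) a0 (lexx _) (mw x mx)
    (fun t _ => wr t (x t)).
  apply: vmeasurableD; last exact: vmeasurable_mulmx.
  apply: vmeasurableD; last exact: vmeasurable_mulmx.
  by apply: vmeasurable_mulmx; apply: vmeasurable_clip => //; exact: mitv.
- move=> t tab; have t0T := tT t tab; have /andP[tp _] := t0T; split.
    by rewrite addr_ge0 ?op_bound_ge0// mulr_ge0 ?L0// mulr_ge0 ?op_bound_ge0.
  move=> xi zeta.
  have -> : H t xi - H t zeta = lA S *m (clip r xi - clip r zeta) +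
      lB S *m (f t (lF_inv S t (w t xi)) - f t (lF_inv S t (w t zeta))).
    by rewrite !mulmxBr /H opprD addrACA subrr addr0 opprD addrACA.
  rewrite mulrDl (le_trans (ler_normD _ _))// lerD//.
    by rewrite (le_trans (norm_mulmx _ _))// ler_wpM2l ?op_bound_ge0// clip_lip.
  apply: le_trans (norm_mulmx _ _) _.
  have -> : op_bound (lB S) * op_bound (lC S) * L t * `|xi - zeta| =
     op_bound (lB S) * (L t * (op_bound (lC S) * `|xi - zeta|)) by ring.
  rewrite ler_wpM2l ?op_bound_ge0//.
  apply: le_trans (lip t _ _ t0T (wr t xi) (wr t zeta)) _.
  rewrite ler_wpM2l ?L0//.
  rewrite /w opprD addrACA subrr addr0 -mulmxBr (le_trans (norm_mulmx _ _))//.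
  by rewrite ler_wpM2l ?op_bound_ge0// clip_lip.
- move=> t xi tab; have t0T := tT t tab.
  have [_ h] := bd t _ t0T (wr t xi).
  rewrite /H (le_trans (ler_normD _ _))// addrAC lerD//.
    rewrite (le_trans (ler_normD _ _))// lerD//.
      by rewrite (le_trans (norm_mulmx _ _))// ler_wpM2l ?op_bound_ge0// clip_norm.
    by rewrite (le_trans (norm_mulmx _ _))// ler_wpM2l ?op_bound_ge0.
  by rewrite (le_trans (norm_mulmx _ _))// ler_wpM2l ?op_bound_ge0// clip_norm.
- have agree : {ae mu, forall t, t \in `]t0, T] -> forall xi, `|xi| <= r ->
      lF_inv S t (w t xi) = output_map t xi /\ v' t = v t}.
    apply: filterS vM => t h /h vt xi xr.
    by rewrite /output_map /w /v' clip_id// clip_id.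
  split.
    apply: filterS agree => t h tab xi xr; have [h1 h2] := h tab xi xr.
    by rewrite /closed_loop /H h1 h2 clip_id.
  move=> x mx xr; have [m1 m2] := meas t0 T (fun t => w t (x t)) a0 (lexx _) (mw x mx)
    (fun t _ => wr t (x t)).
  have ae1 : {ae mu, forall t, t \in `]t0, T] ->
    lF_inv S t (w t (x t)) = output_map t (x t)}.
    by apply: filterS agree => t h tab; have [] := h tab (x t) (xr t tab).
  have ae2 : {ae mu, forall t, t \in `]t0, T] ->
      f t (lF_inv S t (w t (x t))) = f t (output_map t (x t))}.
    by apply: filterS ae1 => t h tab; rewrite h.
  split; [apply: (vinteg_ae ae1 _).1|apply: (vinteg_ae ae2 _).1].
    apply: (vinteg_bounded (M := sg) m1) => t tab.
    by have [] := bd t _ (tT t tab) (wr t (x t)).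
  apply: (vinteg_le m2 (g := bet)); last exact: ibet.
  by move=> t tab; have [] := bd t _ (tT t tab) (wr t (x t)).
Qed.

(** The integral form of the differential equation, which is stable under
    restriction and gluing. *)
Definition solution (x : R -> 'cV[R]_n) (a b : R) : Prop :=
  vinteg (fun t => closed_loop t (x t)) a b /\
  forall t, a <= t <= b -> x t = x a + vLint (fun s => closed_loop s (x s)) a t.

(** One bound [beta] on the increments serves all initial times and states: it
    controls how soon a solution started inside the ball can leave it. *)
Lemma truncated_solution (t0 T r : R) : 0 <= t0 -> 0 <= r ->
  exists beta : R -> R, [/\ integ beta t0 T, forall t, t \in `]t0, T] -> 0 <= beta t &
  forall t1 x1, t0 <= t1 -> t1 <= T -> exists X : R -> 'cV[R]_n, [/\ X t1 = x1,
    forall t, t1 <= t <= T -> `|X t - x1| <= Lint beta t1 t &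
    forall b, b <= T -> (forall t, t1 <= t <= b -> `|X t| <= r) -> solution X t1 b]].
Proof.
move=> a0 r0; have [H [kap [beta [[ik ib] mH lip bd [agree _]]]]] :=
  truncated_field T a0 r0.
exists beta; split => //.
  by move=> t tab; exact: le_trans (normr_ge0 _) (bd t 0 tab).
move=> t1 x1 t01 t1T.
have sub t : t \in `]t1, T] -> t \in `]t0, T].
  by rewrite !in_itv /= => /andP[h ->]; rewrite (le_lt_trans t01).
have subs : `]t1, T]%classic `<=` (`]t0, T]%classic : set R) by move=> t /sub.
have [||||||X [mX iX XE]] := @caratheodory_picard _ _ H kap beta t1 T x1 t1T.
- exact: integ_sub ik _ _.
- exact: integ_sub ib _ _.
- move=> x mx.
  (* extend x by zero to the left of t1 *)
  pose x' t := if t <= t1 then 0 else x t.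
  have mx' : vmeasurable `]t0, T]%classic x'.
    move=> i.
    have -> : (fun t => x' t i 0) = (fun t => if t <= t1 then 0 else x t i 0).
      by apply/funext => t; rewrite /x'; case: ifP => //; rewrite mxE.
    apply: (@measurable_funS _ _ lR _ (`]t0, t1]%classic `|` `]t1, T]%classic)).
    + by apply: measurableU; exact: mitv.
    + move=> t /=; rewrite !in_itv /= => /andP[h1 h2].
      by case: (leP t t1) => h; [left|right]; rewrite ?h1.
    + apply/measurable_funU; [exact: mitv|exact: mitv|split].
        have : measurable_fun (`]t0, t1]%classic : set lR) (cst (0 : R)) by [].
        apply: eq_measurable_fun.
        by move=> t; rewrite inE /= in_itv /= => /andP[_ ->].
      have := mx i; apply: eq_measurable_fun.
      by move=> t; rewrite inE /= in_itv /= => /andP[h _]; rewrite leNgt h.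
  have := vmeasurableS (mitv _) subs (mH x' mx') => h i.
  have := h i; apply: eq_measurable_fun.
  by move=> t; rewrite inE /= in_itv /= => /andP[g _]; rewrite /x' leNgt g.
- by move=> t xi zeta /sub /lip[_]; exact.
- by move=> t xi /sub; exact: bd.
- by move=> t /sub /lip[].
have X1 : X t1 = x1 by rewrite XE ?lexx// vLint_ge ?lexx// addr0.
exists X; split=> //.
- move=> t /andP[h1 h2]; rewrite XE ?h1// addrC addKr; apply: vLint_norm.
  + exact: vinteg_sub iX _ _.
  + exact: integ_sub ib _ _.
  + move=> s; rewrite in_itv /= => /andP[g1 g2]; apply: bd.
    by rewrite in_itv /= (le_lt_trans t01)// (le_trans g2).
move=> b bT Xr.
have ae t : t <= b -> {ae mu, forall s, s \in `]t1, t] ->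
  H s (X s) = closed_loop s (X s)}.
  move=> tb; apply: filterS agree => s h; rewrite in_itv /= => /andP[g1 g2].
  apply: h; first by rewrite in_itv /= (le_lt_trans t01)// (le_trans g2)//
    (le_trans tb).
  by apply: Xr; rewrite ltW//= (le_trans g2).
have iXb := vinteg_sub iX (lexx t1) bT.
split; first exact: (vinteg_ae (ae b (lexx _)) iXb).1.
move=> t /andP[h1 h2].
rewrite [LHS]XE ?h1 ?(le_trans h2)// X1.
by rewrite (vinteg_ae (ae t h2) (vinteg_sub iX (lexx t1) (le_trans h2 bT))).2.
Qed.

End ClosedLoop.

(** * Uniqueness, concatenation and continuation of solutions *)

Section IntegrableUnion.
Context d (T : measurableType d) (R : realType) (mu : {measure set T -> \bar R}).

Lemma integrable_disjoint_setU (A B : set T) (g : T -> \bar R) :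
  measurable A -> measurable B -> [disjoint A & B] ->
  mu.-integrable A g -> mu.-integrable B g -> mu.-integrable (A `|` B) g.
Proof.
move=> mA mB AB /integrableP[m1 f1] /integrableP[m2 f2].
have mU : measurable_fun (A `|` B) g by apply/measurable_funU.
apply/integrableP; split => //.
rewrite ge0_integral_setU//; first exact: lte_add_pinfty.
exact: measurableT_comp.
Qed.

End IntegrableUnion.

Section Solutions.
Context {R : realType} {n m me p : nat} (S : lure R n m me p).
Notation lR := (lebesgueR R).
Notation mu := (@leb R).
Notation f := (lf S).
Notation F := (lF S).
Variable v : R -> 'cV[R]_me.
Notation solution := (solution S v).
Notation closed_loop := (closed_loop S v).
Implicit Types x X : R -> 'cV[R]_n.

Lemma solution_ac x a b : solution x a b -> abs_continuous `[a, b]%classic x /\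
  {ae mu, forall t, t \in `]a, b[ -> is_derive t 1 x (closed_loop t (x t))}.
Proof. by move=> [ix xE]; apply: derivative_of_integral ix xE. Qed.

Lemma solution_measurable x a b : solution x a b -> vmeasurable `]a, b]%classic x.
Proof.
move=> /solution_ac[/abs_continuousP rx _] i.
have := scalar_ac_measurable (rx i); apply: measurable_funS; first exact: mitv.
by apply: subset_itvr; rewrite bnd_simp.
Qed.

Lemma solution_increment x a b : solution x a b -> exists beta : R -> R,
  [/\ integ beta a b, forall t, 0 <= beta t &
   forall s t, a <= s -> s <= t -> t <= b -> `|x t - x s| <= Lint beta s t].
Proof.
move=> [ix xE]; exists (fun t => enorm (closed_loop t (x t))); split.
- by apply: L1_enorm; exact: vinteg_L1.
- by move=> t; exact: enorm_ge0.
move=> s t as_ st tb.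
have at_ := le_trans as_ st; have sb := le_trans st tb.
rewrite (xE t) ?at_// (xE s) ?as_//.
rewrite (vLint_split as_ st (vinteg_sub ix (lexx _) tb)).
rewrite opprD addrACA subrr add0r addrC addKr; apply: vLint_norm.
- exact: vinteg_sub ix _ _.
- by apply: L1_enorm; apply: vinteg_L1; exact: vinteg_sub ix _ _.
- by move=> u _; exact: norm_enorm.
Qed.

Lemma solution_bounded x a b : solution x a b ->
  exists2 r : R, 0 <= r & forall t, a <= t <= b -> `|x t| <= r.
Proof.
move=> /solution_increment[beta [ib b0 hb]]; exists (`|x a| + Lint beta a b).
  by rewrite addr_ge0// Lint_ge0.
move=> t /andP[at_ tb]; rewrite -(subrK (x a) (x t)).
rewrite (le_trans (ler_normD _ _))// addrC lerD// (le_trans (hb a t _ _ _))//.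
by apply: Lint_mono.
Qed.

Lemma solution_sub x a b a' b' : solution x a b -> a <= a' -> b' <= b ->
  solution x a' b'.
Proof.
move=> [ix xE] aa bb; split; first exact: vinteg_sub ix _ _.
move=> t /andP[at_ tb].
have a't := le_trans aa at_; have t'b := le_trans tb bb.
have tab : a <= t <= b by rewrite a't.
have a'ab : a <= a' <= b by rewrite aa (le_trans at_).
rewrite (xE t tab) (xE a' a'ab) (vLint_split aa at_) ?addrA//.
exact: vinteg_sub ix _ _.
Qed.

Lemma solution_eq x X a b : (forall t, a <= t <= b -> x t = X t) -> solution x a b ->
  solution X a b.
Proof.
move=> xX [ix xE]; have [ab|ba] := leP a b; last first.
  split=> [i|t /andP[at_ tb]]; last first.
    by move: (lt_le_trans ba (le_trans at_ tb)); rewrite ltxx.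
  by rewrite /integ set_itv_ge ?bnd_simp -?leNgt ?(ltW ba)//; exact: integrable_set0.
have ae t : t <= b -> {ae mu, forall s, s \in `]a, t] ->
  closed_loop s (x s) = closed_loop s (X s)}.
  move=> tb; apply: aeW => s; rewrite in_itv /= => /andP[h1 h2].
  by rewrite xX// (ltW h1) (le_trans h2).
split; first exact: (vinteg_ae (ae b (lexx _)) ix).1.
move=> t tab; have /andP[h1 h2] := tab.
have aab : a <= a <= b by rewrite lexx ab.
have [_ E1] := vinteg_ae (ae t h2) (vinteg_sub ix (lexx _) h2).
exact: (etrans (esym (xX t tab)) (etrans (xE t tab) (f_equal2 +%R (xX a aab) E1))).
Qed.

Lemma solution_concat x X a c b : a <= c -> c <= b -> solution x a c ->
  solution X c b ->
  X c = x c -> solution (fun t => if t <= c then x t else X t) a b.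
Proof.
move=> ac cb sx sX Xc; set z := fun t => _.
have z1 : solution z a c.
  by apply: solution_eq sx => t /andP[_ tc]; rewrite /z tc.
have z2 : solution z c b.
  apply: solution_eq sX => t /andP[ct _]; rewrite /z; case: ifP => // tc.
  by rewrite (_ : t = c)//; apply/eqP; rewrite eq_le tc.
have iz : vinteg (fun t => closed_loop t (z t)) a b.
  move=> i; have [h1 _] := z1; have [h2 _] := z2.
  have E : `]a, b]%classic = `]a, c]%classic `|` `]c, b]%classic :> set R.
    apply/seteqP; split => t /=; rewrite !in_itv /=.
      by case/andP => at_ tb; case: (leP t c) => tc; [left|right]; rewrite ?at_ ?tb.
    case=> /andP[g1 g2]; first by rewrite g1 (le_trans g2).
    by rewrite g2 (le_lt_trans ac).
  rewrite /integ E; apply: (integrable_disjoint_setU (mitv _) (mitv _) _ (h1 i) (h2 i)).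
  apply/disj_set2P; apply/seteqP; split => // t [] /=; rewrite !in_itv /=.
  by move=> /andP[_ g1] /andP[/(le_lt_trans g1)]; rewrite ltxx.
split => // t /andP[at_ tb]; have [tc|/ltW ct] := leP t c.
  by apply: z1.2; rewrite at_.
rewrite (vLint_split ac ct (vinteg_sub iz (lexx _) tb)) addrA.
by rewrite -z1.2 ?ac ?lexx// -z2.2// ct.
Qed.

Hypothesis hint : exists xi0 : 'cV[R]_p, locally L1 Rplus (fun t => f t xi0).
Hypothesis hrad : radially_unbounded_loc_unif F.
Hypothesis hlip : locally_bilipschitz S.
Hypothesis hv : locally Linfty Rplus v.

(** Both solutions stay in one ball, on which the closed loop coincides almost
    everywhere with a truncated, hence Lipschitz field; their distance satisfies
    the hypothesis of [gronwall0]. *)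
Lemma solution_unique x X a b : 0 <= a -> solution x a b -> solution X a b ->
  x a = X a ->
  forall t, a <= t <= b -> x t = X t.
Proof.
move=> a0 sx sX xXa t /andP[at_ tb]; have ab := le_trans at_ tb.
have [r1 r10 hr1] := solution_bounded sx; have [r2 r20 hr2] := solution_bounded sX.
pose r := r1 + r2; have r0 : 0 <= r by rewrite addr_ge0.
have [H [kap [beta [[ik _] mH lip _ [agree _]]]]] :=
  truncated_field hint hrad hlip hv b a0 r0.
have itvE s : s \in `]a, b] -> a <= s <= b.
  by rewrite in_itv /= => /andP[/ltW -> ->].
pose u s := `|x s - X s|.
have mu_ : measurable_fun (`]a, b]%classic : set lR) u.
  apply: vmeasurable_norm; first exact: mitv.
  by apply: vmeasurableB; exact: solution_measurable.
have u0 s : s \in `]a, b] -> 0 <= u s <= r.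
  move=> /itvE sab; rewrite normr_ge0 /=.
  by apply: le_trans (ler_normB _ _) _; rewrite lerD// ?hr1 ?hr2.
have xr s : a <= s <= b -> `|x s| <= r by move=> /hr1 h; rewrite (le_trans h)// lerDl.
have Xr s : a <= s <= b -> `|X s| <= r by move=> /hr2 h; rewrite (le_trans h)// lerDr.
have ineq s : s \in `]a, b] -> u s <= Lint (fun q => kap q * u q) a s.
  move=> sab; have /andP[as_ sb] := itvE _ sab.
  have sub q : q \in `]a, s] -> q \in `]a, b].
    by rewrite !in_itv /= => /andP[-> /le_trans]; apply.
  have aeH y : (forall q, a <= q <= b -> `|y q| <= r) ->
      {ae mu, forall q, q \in `]a, s] -> closed_loop q (y q) = H q (y q)}.
    move=> yr; apply: filterS agree => q h /sub qab.
    by rewrite h// yr// itvE.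
  have [i1 e1] := vinteg_ae (aeH x xr) (vinteg_sub sx.1 (lexx _) sb).
  have [i2 e2] := vinteg_ae (aeH X Xr) (vinteg_sub sX.1 (lexx _) sb).
  rewrite /u sx.2 ?as_// sX.2 ?as_// xXa e1 e2.
  rewrite opprD addrACA subrr add0r -vLintB//.
  apply: vLint_norm.
  - exact: vintegB.
  - apply: (@integ_mul_bounded _ _ _ _ _ r).
    + exact: integ_sub ik _ _.
    + apply: measurable_funS mu_; first exact: mitv.
      by apply: subset_itvl; rewrite bnd_simp.
    + by move=> q /sub /u0 /andP[h1 h2]; rewrite ger0_norm.
  - by move=> q /sub /lip[_]; exact.
move: at_; rewrite le_eqVlt => /predU1P[<-//|at_].
have /eqP := gronwall0 ab ik (fun s h => (lip s h).1) mu_ u0 ineq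
  (t := t) ltac:(by rewrite in_itv /= at_ tb).
by rewrite normr_eq0 subr_eq0 => /eqP.
Qed.

(** By uniqueness the solution follows the truncated one for radius [M + 1], as
    long as the latter stays in its ball; near [tau] the increments of the
    truncated solution have integral bound less than one, uniformly in the
    initial state. *)
Lemma solution_short (t0 tau M : R) : 0 <= t0 -> t0 < tau -> 0 <= M ->
  exists2 d : R, 0 < d & forall t1 x, t0 <= t1 -> t1 < tau -> tau - t1 < d ->
    (forall b, b < tau -> solution x t1 b) -> `|x t1| <= M ->
    forall t, t1 <= t -> t < tau -> `|x t| <= M + 1.
Proof.
move=> a0 t0tau M0; have M1 : 0 <= M + 1 by rewrite addr_ge0.
have [beta [ib b0 hb]] := truncated_solution hint hrad hlip hv tau a0 M1.
have [d d0 hd] := Lint_small ib b0 ltr01.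
exists d => // t1 x t01 t1tau dt sx xM t t1t ttau.
have [X [X1 Xd Xs]] := hb t1 (x t1) t01 (ltW t1tau).
have XM s : t1 <= s <= tau -> `|X s| <= M + 1.
  move=> /andP[h1 h2]; rewrite -(subrK (x t1) (X s)) addrC.
  rewrite (le_trans (ler_normD _ _))// lerD//.
  rewrite (le_trans (Xd s _)) ?h1//; apply/ltW/hd => //.
  by apply: le_lt_trans dt; rewrite lerB.
have sX : solution X t1 t.
  apply: Xs; first exact: ltW.
  by move=> s /andP[h1 h2]; apply: XM; rewrite h1 (le_trans h2)// ltW.
have t10 : 0 <= t1 by exact: le_trans t01.
have tt : t1 <= t <= t by rewrite t1t lexx.
have xX := solution_unique t10 (sx t ttau) sX (esym X1) tt.
by rewrite xX; apply: XM; rewrite t1t ltW.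
Qed.

Lemma solution_local (t0 : R) (x0 : 'cV[R]_n) : 0 <= t0 ->
  exists (b : R) X, [/\ t0 < b, X t0 = x0 & solution X t0 b].
Proof.
move=> a0; have r0 : 0 <= `|x0| + 1 by rewrite addr_ge0.
have [beta [ib b0 hb]] := truncated_solution hint hrad hlip hv (t0 + 1) a0 r0.
have [d d0 hd] := Lint_small ib b0 ltr01.
have t01 : t0 <= t0 + 1 by rewrite lerDl.
have [X [X1 Xd Xs]] := hb t0 x0 (lexx _) t01.
pose b := t0 + Num.min 1 (d / 2).
have b1 : b <= t0 + 1 by rewrite lerD2l ge_min lexx.
exists b, X; split => //.
  by rewrite ltrDl lt_min ltr01 divr_gt0.
apply: Xs => // t /andP[h1 h2]; have tb1 := le_trans h2 b1.
rewrite -(subrK x0 (X t)) addrC (le_trans (ler_normD _ _))// lerD//.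
rewrite (le_trans (Xd t _)) ?h1//; apply/ltW/hd => //.
rewrite ltrBlDl (le_lt_trans h2)// ltrD2l gt_min; apply/orP; right.
by rewrite ltr_pdivrMr// ltr_pMr// ltr1n.
Qed.

(** Restart the truncated equation slightly before [tau].  As the bound on the
    increments is uniform in the starting time, starting close enough to [tau]
    makes the new solution live beyond [tau]; glue it to [x]. *)
Lemma solution_extend (t0 tau r : R) x : 0 <= t0 -> t0 < tau -> 0 <= r ->
  (forall b, b < tau -> solution x t0 b) ->
  (forall t, t0 <= t -> t < tau -> `|x t| <= r) ->
  exists (b : R) X, [/\ tau < b, solution X t0 b &
    forall t, t0 <= t -> t < tau -> X t = x t].
Proof.
move=> a0 t0tau r0 sx xr; have r1 : 0 <= r + 1 by rewrite addr_ge0.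
have [beta [ib b0 hb]] := truncated_solution hint hrad hlip hv (tau + 1) a0 r1.
have [d d0 hd] := Lint_small ib b0 ltr01.
pose t1 := Num.max t0 (tau - d / 2).
have t01 : t0 <= t1 by rewrite le_max lexx.
have t1tau : t1 < tau by rewrite gt_max t0tau ltrBlDr ltrDl divr_gt0.
have t1T : t1 <= tau + 1 by rewrite (le_trans (ltW t1tau))// lerDl.
have [X [X1 Xd Xs]] := hb t1 (x t1) t01 t1T.
(* from t1 to b less than d elapses: d / 2 before tau and d / 4 after it *)
pose b := tau + Num.min 1 (d / 4).
have b1 : b <= tau + 1 by rewrite lerD2l ge_min lexx.
have taub : tau < b by rewrite ltrDl lt_min ltr01 divr_gt0.
have bt1 : b - t1 < d.
  have h1 : tau - d / 2 <= t1 by rewrite le_max lexx orbT.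
  have h2 : Num.min 1 (d / 4) <= d / 4 by rewrite ge_min lexx orbT.
  rewrite /b; lra.
have sX : solution X t1 b.
  apply: Xs => // t /andP[h1 h2]; have tb1 := le_trans h2 b1.
  rewrite -(subrK (x t1) (X t)) addrC (le_trans (ler_normD _ _))// lerD//.
    exact: xr.
  rewrite (le_trans (Xd t _)) ?h1//; apply/ltW/hd => //.
  by apply: le_lt_trans bt1; rewrite lerD2r.
exists b, (fun t => if t <= t1 then x t else X t); split => //.
  by apply: solution_concat => //; [rewrite ltW// (lt_trans t1tau)|exact: sx].
move=> t t0t ttau; case: ifPn => // tt1; rewrite -ltNge in tt1.
have t10 : 0 <= t1 by exact: le_trans t01.
have s1 : solution x t1 t by apply: solution_sub (sx t ttau) _ _.
have s2 : solution X t1 t by apply: solution_sub sX _ _;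
  rewrite ?lexx// ltW// (lt_trans ttau).
have tt : t1 <= t <= t by rewrite (ltW tt1) lexx.
exact: (esym (solution_unique t10 s1 s2 (esym X1) tt)).
Qed.

End Solutions.

(** * Trajectories of the Lur'e system *)

Section Restriction.
Context {R : realType} {k : nat}.
Notation lR := (lebesgueR R).
Notation mu := (@leb R).
Implicit Types (g : R -> 'cV[R]_k) (D E : set R).

Lemma abs_continuousS D E g : E `<=` D -> abs_continuous D g -> abs_continuous E g.
Proof.
move=> ED h e e0; have [d d0 hd] := h e e0; exists d => // N a b ab.
by apply: hd => i; have [/ED ? /ED ? ?] := ab i; split.
Qed.

Lemma L1S D E g : measurable (D : set lR) -> measurable (E : set lR) ->
  E `<=` D -> L1 D g -> L1 E g.
Proof.
move=> mD mE ED [mg fin]; split; first exact: vmeasurableS ED mg.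
have me := vmeasurable_enorm mD mg.
have ee t : D t -> `|enorm (g t)| <= enorm (g t) by rewrite ger0_norm ?enorm_ge0.
have iD := dominated_integrable mD me me ee fin.
exact: integral_finite mE (integrableS mD mE ED iD).
Qed.

Lemma vinteg_norm g a b : vinteg g a b -> integ (fun t => `|g t|) a b.
Proof.
move=> ig; have mg : vmeasurable `]a, b]%classic g.
  by move=> i; exact: integ_measurable (ig i).
apply: integ_le (L1_enorm (vinteg_L1 ig)).
  by apply: vmeasurable_norm => //; exact: mitv.
by move=> t _; rewrite normr_id norm_enorm.
Qed.

Lemma vinteg_bound g (M a b : R) : vmeasurable `]a, b]%classic g -> 0 <= M ->
  {ae mu, forall t, t \in `]a, b] -> `|g t| <= M} -> vinteg g a b.
Proof.
move=> mg M0 gM.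
have ae : {ae mu, forall t, t \in `]a, b] -> clip M (g t) = g t}.
  by apply: filterS gM => t h tab; rewrite clip_id// h.
apply: (vinteg_ae ae _).1; apply: (vinteg_bounded (M := M)).
  by apply: vmeasurable_clip => //; exact: mitv.
by move=> t _; exact: clip_norm.
Qed.

(** Rational end points [b] suffice, and countably many null sets have a null
    union. *)
Lemma ae_time_interval (t0 : R) (tau : \bar R) (P : R -> Prop) :
  (forall b : R, (b%:E < tau)%E -> {ae mu, forall t, t \in `]t0, b[ -> P t}) ->
  {ae mu, forall t, time_interval t0 tau t -> P t}.
Proof.
move=> h.
pose N q : set R := [set t : R | ((ratr q)%:E < tau)%E /\ ~ (t \in `]t0,
  (ratr q)[ -> P t)].
pose N' i := if unpickle i is Some q then N q else set0.
have nN' : mu.-negligible (\bigcup_i N' i).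
  apply: negligible_bigcup => i; rewrite /N'; case: unpickle => [q|]; last first.
    exact: negligible_set0.
  have [qt|qt] := pselect ((ratr q)%:E < tau)%E; last first.
    apply: (negligibleS _ (@negligible_set0 _ _ _ mu)) => t [].
    by move=> /qt.
  have := h _ qt; apply: negligibleS => t [_ Pt] /= H.
  exact: Pt.
have nU : mu.-negligible ((\bigcup_i N' i) `|` [set t0]).
  apply: negligibleU => //; exists [set t0]; split => //.
    exact: measurable_pt.
  exact: leb_pt.
apply: negligibleS nU => t /= /not_implyP[[t0t ttau] Pt].
have [->|tt0] := eqVneq t t0; first by right.
left.
have lt0 : t0 < t by rewrite lt_neqAle eq_sym tt0.
have [q tq qtau] : exists2 q : rat, t < ratr q & ((ratr q)%:E < tau)%E.
  move: ttau; clear; case: tau => [r| |] //.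
    rewrite lte_fin => /rat_in_itvoo[q]; rewrite in_itv /= => /andP[h1 h2].
    by exists q.
  move=> _; have /rat_in_itvoo[q] : t < t + 1 by rewrite ltrDl.
  by rewrite in_itv /= => /andP[h1 h2]; exists q => //; rewrite ltry.
exists (pickle q); [exact: I|rewrite /N' pickleK; split; first exact: qtau].
by move=> h'; apply: Pt; apply: h'; rewrite in_itv /= lt0.
Qed.

End Restriction.

Section Trajectories.
Context {R : realType} {n m me p : nat} (S : lure R n m me p).
Notation lR := (lebesgueR R).
Notation mu := (@leb R).
Notation f := (lf S).
Notation F := (lF S).
Implicit Types (v : R -> 'cV[R]_me) (x X : R -> 'cV[R]_n) (y : R -> 'cV[R]_p).
Hypothesis hint : exists xi0 : 'cV[R]_p, locally L1 Rplus (fun t => f t xi0).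
Hypothesis hrad : radially_unbounded_loc_unif F.
Hypothesis hlip : locally_bilipschitz S.

Lemma solution_empty v x a b : b < a -> solution S v x a b.
Proof.
move=> ba; split=> [i|t /andP[at_ tb]]; last first.
  by move: (lt_le_trans ba (le_trans at_ tb)); rewrite ltxx.
by rewrite /integ set_itv_ge ?bnd_simp -?leNgt ?(ltW ba)//; exact: integrable_set0.
Qed.

Lemma itv_time (t0 b : R) (tau : \bar R) : (b%:E < tau)%E ->
  `[t0, b]%classic `<=` time_interval t0 tau.
Proof.
move=> btau t /=; rewrite in_itv /= => /andP[t0t tb]; split => //.
by apply: le_lt_trans btau; rewrite lee_fin.
Qed.

(** The output equation says [F_t (y t) = C x + De v]. *)
Lemma pretrajectory_output v (t0 : R) tau x y : pretrajectory S t0 tau v x y ->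
  {ae mu, forall t, time_interval t0 tau t -> y t = output_map S v t (x t)}.
Proof.
move=> [[a0 _] _ _ _ ae]; apply: filterS ae => t /= h Jt.
have [_ yE] := h Jt; have t0_ : 0 <= t by apply: le_trans a0 _; case: Jt.
apply/esym; apply: (lF_invE hrad hlip) => //; rewrite /lF {1}yE.
by rewrite [X in X - _]addrAC addrK.
Qed.

(** With the output eliminated, the differential equation holds almost everywhere
    with an integrable right-hand side, and integrates to the integral equation. *)
Lemma pretrajectory_solution v (t0 : R) tau x y : pretrajectory S t0 tau v x y ->
  forall b, (b%:E < tau)%E -> solution S v x t0 b.
Proof.
move=> pt b btau; have [bt0|t0b] := ltP b t0; first exact: solution_empty.
have yE := pretrajectory_output pt.
move: pt => [[a0 t0tau] hv acx [L1y L1f] ae].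
have subJ c : c <= b -> `[t0, c]%classic `<=` time_interval t0 tau.
  by move=> cb; apply: itv_time; apply: le_lt_trans btau; rewrite lee_fin.
pose phi t := lA S *m x t + lB S *m f t (y t) + lBe S *m v t.
have rx := (abs_continuousP _ _ _).1 (acx t0 b (subJ b (lexx _))).
have mx : vmeasurable `]t0, b]%classic x.
  move=> i; have := scalar_ac_measurable (rx i); apply: measurable_funS;
    first exact: mitv.
  by apply: subset_itvr; rewrite bnd_simp.
have ix : vinteg x t0 b.
  move=> i; have [M hM] := scalar_ac_bounded (rx i).
  apply: (integ_le (mx i) _ (integ_cst M t0 b)) => t.
  by rewrite in_itv /= => /andP[/ltW h1 h2]; apply: hM; rewrite h1.
have if_ : vinteg (fun t => f t (y t)) t0 b.
  by apply: L1_vinteg; apply: L1f; exact: subJ.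
have [M M0 [mv vM]] := input_bound hv b a0.
have iv : vinteg v t0 b by exact: vinteg_bound vM.
have mf : vmeasurable `]t0, b]%classic (fun t => f t (y t)).
  by move=> i; exact: integ_measurable (if_ i).
have iphi : vinteg phi t0 b.
  apply: (vinteg_le (g := fun t => op_bound (lA S) * `|x t| + op_bound (lB S) * `|f t
    (y t)|
     + op_bound (lBe S) * `|v t|)).
  - apply: vmeasurableD; last exact: vmeasurable_mulmx.
    by apply: vmeasurableD; exact: vmeasurable_mulmx.
  - move=> t _; rewrite (le_trans (ler_normD _ _))// lerD ?norm_mulmx//.
    by rewrite (le_trans (ler_normD _ _))// lerD ?norm_mulmx.
  - apply: integD; last by apply: integZ; exact: vinteg_norm.
    by apply: integD; apply: integZ; exact: vinteg_norm.
have phivf c : c <= b -> {ae mu, forall t, t \in `]t0, c] ->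
  phi t = closed_loop S v t (x t)}.
  move=> cb; apply: filterS yE => t h; rewrite in_itv /= => /andP[h1 h2].
  rewrite /phi /closed_loop -h//; apply: (subJ c cb); rewrite /= in_itv /= (ltW h1) //.
split; first exact: (vinteg_ae (phivf b (lexx _)) iphi).1.
move=> t /andP[t0t tb].
have iphit := vinteg_sub iphi (lexx _) tb.
rewrite -(vinteg_ae (phivf t tb) iphit).2.
apply: integral_of_derivative => //.
  by apply: acx; exact: subJ.
apply: filterS ae => s /= h; rewrite in_itv /= => /andP[h1 h2].
by have [] := h (subJ t tb s ltac:(by rewrite /= in_itv /= !ltW)).
Qed.

(** The integrability of the output and of the nonlinearity comes from
    [truncated_field], with a radius that bounds the solution on the compact
    interval in question. *)
Lemma solution_pretrajectory v (t0 : R) tau x : 0 <= t0 -> (t0%:E < tau)%E ->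
  locally Linfty Rplus v -> (forall b, (b%:E < tau)%E -> solution S v x t0 b) ->
  pretrajectory S t0 tau v x (fun t => output_map S v t (x t)).
Proof.
move=> a0 t0tau hv hx.
have sub a b : `[a, b]%classic `<=` time_interval t0 tau ->
    exists2 c : R, (c%:E < tau)%E & `[a, b]%classic `<=` (`[t0, c]%classic : set R).
  move=> abJ; have [ab|ba] := leP a b.
    have [|t0a _] := abJ a; first by rewrite /= in_itv /= lexx.
    have [|t0b btau] := abJ b; first by rewrite /= in_itv /= lexx ab.
    by exists b => //; apply: subset_itvr; rewrite bnd_simp.
  by exists t0 => //; rewrite set_itv_ge// bnd_simp -ltNge.
have L1c c : (c%:E < tau)%E -> L1 `[t0, c]%classic (fun t => output_map S v t (x t)) /\
    L1 `[t0, c]%classic (fun t => f t (output_map S v t (x t))).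
  move=> ctau; have sx := hx c ctau.
  have [r r0 hr] := solution_bounded sx.
  have [H [kap [beta [_ _ _ _ [_ hb]]]]] := truncated_field hint hrad hlip hv c a0 r0.
  have [|i1 i2] := hb x (solution_measurable sx).
    by move=> t; rewrite in_itv /= => /andP[h1 h2]; apply: hr; rewrite ltW.
  by split; apply: vinteg_L1.
split => //.
- move=> a b /sub[c ctau abc]; apply: abs_continuousS abc _.
  by have [] := solution_ac (hx c ctau).
- split=> a b /sub[c ctau abc]; have [h1 h2] := L1c c ctau.
    exact: L1S (mitv _) (mitv _) abc h1.
  exact: L1S (mitv _) (mitv _) abc h2.
- apply: ae_time_interval => b btau; have [_ d] := solution_ac (hx b btau).
  apply: filterS d => t h tab; split; first exact: h.
  have t0_ : 0 <= t by move: tab; rewrite in_itv /= => /andP[/ltW/(le_trans a0)].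
  have := lF_invK hrad hlip (lC S *m x t + lDe S *m v t) t0_.
  rewrite /lF => /eqP; rewrite subr_eq => /eqP E.
  by rewrite [LHS]E addrAC.
Qed.

Lemma solution_coincide v (t0 : R) tau tau' x y x' y' :
  (tau <= tau')%E -> pretrajectory S t0 tau v x y ->
  pretrajectory S t0 tau' v x' y' -> x t0 = x' t0 -> coincide t0 tau x y x' y'.
Proof.
move=> tt' h h' xx'.
have [[a0 _] hv _ _ _] := h.
have xE t : time_interval t0 tau t -> x t = x' t.
  move=> [t0t ttau].
  have s1 := pretrajectory_solution h ttau.
  have s2 := pretrajectory_solution h' (lt_le_trans ttau tt').
  by apply: (solution_unique hint hrad hlip hv a0 s1 s2 xx'); rewrite t0t lexx.
split => //.
apply: filterS2 (pretrajectory_output h) (pretrajectory_output h') => t e1 e2 Jt.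
rewrite e1// e2; first by rewrite xE.
by case: Jt => t0t ttau; split => //; exact: lt_le_trans tt'.
Qed.

(** A bounded solution continues beyond [tau], against maximality. *)
Lemma maximal_unbounded v (t0 tau : R) x y : maximal_trajectory S t0 tau%:E v x y ->
  forall r, ~ (forall t, t0 <= t -> t < tau -> `|x t| <= r).
Proof.
move=> [pt mx] r xr; apply: mx.
have [[a0 t0tau] hv _ _ _] := pt; rewrite lte_fin in t0tau.
have r0 : 0 <= r by exact: le_trans (normr_ge0 _) (xr t0 (lexx _) t0tau).
have sx b : b < tau -> solution S v x t0 b by move=> btau;
  exact: pretrajectory_solution pt _ _.
have [b [X [taub sX Xx]]] := solution_extend hint hrad hlip hv a0 t0tau r0 sx xr.
exists b%:E, X, (fun t => output_map S v t (X t)); split; first by rewrite lte_fin.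
  apply: solution_pretrajectory => //; first by rewrite lte_fin (lt_trans t0tau).
  by move=> c; rewrite lte_fin => /ltW cb; exact: solution_sub sX _ _.
have XE t : time_interval t0 tau%:E t -> X t = x t.
  by move=> [t0t ttau]; apply: Xx => //; rewrite -lte_fin.
split => //; apply: filterS (pretrajectory_output pt) => t e Jt.
by rewrite e// XE.
Qed.

(** Take the supremum of the existence times of all trajectories from [x0]; they
    agree pairwise by uniqueness, so the value at time [t] of any solution that
    exists up to [t] defines one trajectory up to the supremum. *)
Lemma exists_maximal v (t0 : R) (x0 : 'cV[R]_n) : locally Linfty Rplus v -> 0 <= t0 ->
  exists tau x y, maximal_trajectory S t0 tau v x y /\ x t0 = x0.
Proof.
move=> hv a0.
pose E : set (\bar R) :=
  [set tau | exists x y, pretrajectory S t0 tau v x y /\ x t0 = x0].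
pose tau := ereal_sup E.
have lt_sup b : (b%:E < tau)%E -> exists x, solution S v x t0 b /\ x t0 = x0.
  move=> /ereal_sup_gt[tau' [x [y [pt xx0]]] btau'].
  by exists x; split => //; exact: pretrajectory_solution pt _ _.
have t0tau : (t0%:E < tau)%E.
  have [b [X [t0b X0 sX]]] := solution_local hint hrad hlip hv x0 a0.
  apply: (@lt_le_trans _ _ b%:E); first by rewrite lte_fin.
  apply: ereal_sup_ubound; exists X, (fun t => output_map S v t (X t)); split => //.
  apply: solution_pretrajectory => //.
  by move=> c; rewrite lte_fin => /ltW cb; exact: solution_sub sX _ _.
pose xs (b : R) : R -> 'cV[R]_n :=
  xget (fun=> x0) [set x | solution S v x t0 b /\ x t0 = x0].
have xsP b : (b%:E < tau)%E -> solution S v (xs b) t0 b /\ xs b t0 = x0.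
  move=> /lt_sup[x hx]; rewrite /xs; case: xgetP => [z _ //|h].
  by have := h x hx.
pose x t := xs t t.
have xE b : (b%:E < tau)%E -> forall t, t0 <= t <= b -> xs b t = x t.
  move=> btau t /andP[t0t tb].
  have ttau : (t%:E < tau)%E by apply: le_lt_trans btau; rewrite lee_fin.
  have [s1 e1] := xsP b btau; have [s2 e2] := xsP t ttau.
  have s1' := solution_sub s1 (lexx _) tb.
  apply: (solution_unique hint hrad hlip hv a0 s1' s2); first by rewrite e1 e2.
  by rewrite t0t lexx.
have sx b : (b%:E < tau)%E -> solution S v x t0 b.
  by move=> btau; apply: solution_eq (xE b btau) (xsP b btau).1.
have x00 : x t0 = x0 by exact: (xsP t0 t0tau).2.
exists tau, x, (fun t => output_map S v t (x t)); split => //.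
split; first exact: solution_pretrajectory.
move=> [tau' [x' [y' [tt' pt [xx' _]]]]].
have : (tau' <= tau)%E.
  apply: ereal_sup_ubound; exists x', y'; split => //.
  by rewrite xx'//; split.
by rewrite leNgt tt'.
Qed.

End Trajectories.

(** * Behaviour at a finite end point *)

Section AeDominated.
Context d (T : measurableType d) (R : realType) (mu : {measure set T -> \bar R}).
Implicit Types (D E : set T) (g G : T -> R).

Lemma ae_dominated_integrable D g G : measurable D -> measurable_fun D g ->
  (forall t, D t -> 0 <= g t) -> {ae mu, forall t, D t -> g t <= G t} ->
  mu.-integrable D (EFin \o G) -> mu.-integrable D (EFin \o g).
Proof.
move=> mD mg g0 gG iG.
have mG : measurable_fun D G by apply/measurable_EFinP; exact: measurable_int iG.
have mm : measurable_fun D (g \min G) by exact: measurable_minr.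
apply: (@ae_eq_integrable _ _ _ _ _ (g \min G)) => //.
  by apply: filterS gG => t h Dt; rewrite /= min_l// h.
apply: le_integrable iG => //; first exact/measurable_EFinP.
move=> t Dt /=; rewrite lee_fin; have [h|//] := leP (g t) (G t).
by rewrite (ger0_norm (g0 t Dt)) (le_trans h)// ler_norm.
Qed.

Lemma ge0_subset_Rintegral D E g : measurable D -> measurable E -> D `<=` E ->
  (forall t, E t -> 0 <= g t) -> mu.-integrable E (EFin \o g) ->
  (\int[mu]_(t in D) g t <= \int[mu]_(t in E) g t)%R.
Proof.
move=> mD mE DE g0 ig; have igD := integrableS mE mD DE ig.
rewrite /Rintegral fine_le//; [exact: integrable_fin_num|exact: integrable_fin_num|].
apply: ge0_subset_integral => //; exact: measurable_int ig.
Qed.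

End AeDominated.

Section BlowUp.
Context {R : realType} {n m me p : nat} (S : lure R n m me p).
Notation lR := (lebesgueR R).
Notation mu := (@leb R).
Notation f := (lf S).
Notation F := (lF S).
Implicit Types (v : R -> 'cV[R]_me) (x X : R -> 'cV[R]_n) (y : R -> 'cV[R]_p).
Hypothesis hint : exists xi0 : 'cV[R]_p, locally L1 Rplus (fun t => f t xi0).
Hypothesis hrad : radially_unbounded_loc_unif F.
Hypothesis hlip : locally_bilipschitz S.

(** On the compact interval before [s] every solution is bounded. *)
Lemma maximal_unbounded_near v (t0 tau s r : R) x y :
  maximal_trajectory S t0 tau%:E v x y -> t0 <= s -> s < tau ->
  ~ (forall t, s <= t -> t < tau -> `|x t| <= r).
Proof.
move=> mx t0s stau xr.
have [pt _] := mx; have [[a0 _] hv _ _ _] := pt.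
have [r1 r10 hr1] := solution_bounded (pretrajectory_solution hrad hlip pt stau).
have r0 : 0 <= r by exact: le_trans (normr_ge0 _) (xr s (lexx _) stau).
apply: (maximal_unbounded hint hrad hlip mx (r := r1 + r)) => t t0t ttau.
have [ts|/ltW st] := leP t s.
  by apply: (le_trans (hr1 t _)); [rewrite t0t|rewrite lerDl].
by apply: (le_trans (xr t st ttau)); rewrite lerDr.
Qed.

(** If the norm were below [A] at some time close to [tau], the state would stay
    below [|A| + 1] from then on by [solution_short], against
    [maximal_unbounded_near]. *)
Lemma maximal_norm_diverges v (t0 tau : R) x y :
  maximal_trajectory S t0 tau%:E v x y -> enorm (x t) @[t --> tau^'-] --> +oo.
Proof.
move=> mx; have [pt _] := mx; have [[a0 t0tau] hv _ _ _] := pt.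
rewrite lte_fin in t0tau.
apply/cvgryPge => A.
have [d d0 hd] := solution_short hint hrad hlip hv a0 t0tau (normr_ge0 A).
have key t1 : t0 <= t1 -> t1 < tau -> tau - t1 < d -> A <= enorm (x t1).
  move=> t01 t1tau td; rewrite leNgt; apply/negP => xA.
  apply: (maximal_unbounded_near mx t01 t1tau (r := `|A| + 1)).
  apply: hd => //.
    move=> b btau; have [bt1|t1b] := ltP b t1; first exact: solution_empty.
    by apply: solution_sub (pretrajectory_solution hrad hlip pt btau) _ _.
  by rewrite (le_trans (norm_enorm _))// (le_trans (ltW xA))// ler_norm.
near=> t; apply: key.
- by rewrite ltW//; near: t; exact: nbhs_left_gt.
- by near: t; exact: nbhs_left_lt.
- rewrite ltrBlDl -ltrBlDr; near: t; apply: nbhs_left_gt.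
  by rewrite ltrBlDr ltrDl.
Unshelve. all: by end_near. Qed.

Lemma nonlinearity_measurable v (t0 tau : R) x y :
  pretrajectory S t0 tau%:E v x y ->
  vmeasurable `[t0, tau[%classic (fun t => f t (y t)).
Proof.
move=> [[a0 t0tau] hv _ [_ L1f] _] i.
have E : `[t0, tau[%classic = \bigcup_k (`[t0, tau - k.+1%:R^-1]%classic : set R).
  apply/seteqP; split => t /=; rewrite in_itv /=.
    move=> /andP[t0t ttau]; have d0 : 0 < tau - t by rewrite subr_gt0.
    have [k hk] := ltr_add_invr ttau.
    by exists k => //=; rewrite in_itv /= t0t lerBrDr ltW.
  move=> [k _ /=]; rewrite in_itv /= => /andP[-> /le_lt_trans]; apply.
  by rewrite ltrBlDr ltrDl invr_gt0.
rewrite E; apply/(@measurable_fun_bigcup _ _ lR).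
  by move=> k; exact: mitv.
move=> k; have ktau : ((tau - k.+1%:R^-1)%:E < tau%:E)%E.
  by rewrite lte_fin ltrBlDr ltrDl invr_gt0.
by have [mf _] := L1f t0 _ (itv_time ktau); exact: mf.
Qed.

(** If the integral were finite, equal to [W], choose [s] so close to [tau] that
    the linear part contributes at most half of the maximum of [|x|].  Then a
    bound [B0] for [|x|] on [[s, t]] improves to [c + B0 / 2] with [c]
    independent of [t]; iterating gives [|x| <= 2 c] up to [tau], against
    [maximal_unbounded_near]. *)
Lemma maximal_integral_infinite v (t0 tau : R) x y :
  maximal_trajectory S t0 tau%:E v x y ->
  (\int[mu]_(t in `[t0, tau[%classic) (enorm (lB S *m f t (y t)))%:E = +oo)%E.
Proof.
move=> mx; have [pt _] := mx; have [[a0 t0tau] hv _ _ _] := pt.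
rewrite lte_fin in t0tau.
apply: contrapT => /eqP; rewrite -ltey => fin.
have sx b : b < tau -> solution S v x t0 b.
  by move=> btau; exact: (pretrajectory_solution hrad hlip pt).
pose D : set R := `[t0, tau[%classic.
have mD : measurable (D : set lR) by exact: mitv.
pose g t := enorm (lB S *m f t (y t)).
(* y is known only up to a null set; replacing it by the output map gives a
   function that bounds the right-hand side of the integral equation everywhere *)
pose h t := enorm (lB S *m f t (output_map S v t (x t))).
have mg : measurable_fun (D : set lR) g.
  apply: (vmeasurable_enorm mD); apply: vmeasurable_mulmx.
  exact: nonlinearity_measurable pt.
have pt' : pretrajectory S t0 tau%:E v x (fun t => output_map S v t (x t)).
  by apply: solution_pretrajectory => //; rewrite lte_fin.
have mh : measurable_fun (D : set lR) h.
  apply: (vmeasurable_enorm mD); apply: vmeasurable_mulmx.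
  exact: nonlinearity_measurable pt'.
have ig : mu.-integrable D (EFin \o g).
  apply: (dominated_integrable mD mg mg _ fin) => t _.
  by rewrite ger0_norm// enorm_ge0.
have gh : {ae mu, forall t, D t -> g t = h t}.
  apply: filterS (pretrajectory_output hrad hlip pt) => t e.
  rewrite /D /= in_itv /= => /andP[t0t ttau]; rewrite /g /h e//.
have ih : mu.-integrable D (EFin \o h) := ae_eq_integrable mD mh gh ig.
pose W := (\int[mu]_(t in D) h t)%R.
have subD s t : t0 <= s -> t < tau -> `]s, t]%classic `<=` D.
  move=> t0s ttau q; rewrite /D /= !in_itv /= => /andP[/ltW sq qt].
  by rewrite (le_trans t0s sq) (le_lt_trans qt).
have ih' s t : t0 <= s -> t < tau -> integ h s t.
  move=> t0s ttau; exact: (integrableS mD (mitv _) (subD s t t0s ttau) ih).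
have hW s t : t0 <= s -> t < tau -> Lint h s t <= W.
  move=> t0s ttau; apply: (ge0_subset_Rintegral (mitv _) mD (subD s t t0s ttau) _ ih)
    => q _.
  exact: enorm_ge0.
have [M M0 [mv vM]] := input_bound hv tau a0.
have iv : integ (fun t => `|v t|) t0 tau.
  by apply: vinteg_norm; exact: vinteg_bound vM.
pose V := Lint (fun t => `|v t|) t0 tau.
have V0 : 0 <= V by exact: Lint_ge0.
have W0 : 0 <= W by apply: Rintegral_ge0 => t _; exact: enorm_ge0.
(* the summand 1 keeps al positive even if A vanishes *)
pose al := op_bound (lA S) + 1.
have al0 : 0 < al by rewrite ltr_wpDl// op_bound_ge0.
pose s := Num.max t0 (tau - (2 * al)^-1).
have t0s : t0 <= s by rewrite le_max lexx.
have i2al : 0 < (2 * al)^-1 by rewrite invr_gt0 mulr_gt0.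
have stau : s < tau by rewrite gt_max t0tau ltrBlDr ltrDl.
pose c := `|x s| + W + op_bound (lBe S) * V.
have c0 : 0 <= c by rewrite addr_ge0 ?mulr_ge0 ?op_bound_ge0// addr_ge0.
have half t B0 : t < tau -> (forall q, s <= q <= t -> `|x q| <= B0) ->
    forall q, s <= q <= t -> `|x q| <= c + B0 / 2.
  move=> ttau xB q /andP[sq qt]; have qtau := le_lt_trans qt ttau.
  have [isol xE] := solution_sub (sx q qtau) t0s (lexx q).
  have B00 : 0 <= B0 by apply: le_trans (normr_ge0 _) (xB s _);
    rewrite lexx (le_trans sq).
  have mx' : vmeasurable `]s, q]%classic x.
    exact: solution_measurable (solution_sub (sx q qtau) t0s (lexx q)).
  have xB' r : r \in `]s, q] -> `|x r| <= B0.
    by rewrite in_itv /= => /andP[/ltW sr rq]; apply: xB; rewrite sr (le_trans rq).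
  have iv' : integ (fun t => `|v t|) s q by apply: integ_sub iv _ _ => //; exact: ltW.
  have ihs : integ h s q := ih' s q t0s qtau.
  rewrite xE ?sq ?lexx// (le_trans (ler_normD _ _))//.
  apply: (@le_trans _ _ (`|x s| + Lint
    (fun r => al * B0 + (h r + op_bound (lBe S) * `|v r|)) s q)).
    rewrite lerD2l; apply: vLint_norm => //.
      apply: integD; first exact: integ_cst.
      by apply: integD => //; exact: integZ.
    move=> r rsq; rewrite /closed_loop
      (le_trans (ler_normD _ _))// addrA lerD ?norm_mulmx//.
    rewrite (le_trans (ler_normD _ _))// lerD ?norm_enorm//.
    rewrite (le_trans (norm_mulmx _ _))//.
    by apply: ler_pM; rewrite ?op_bound_ge0 ?xB'// lerDl.
  have iZ := integZ (op_bound (lBe S)) iv'.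
  rewrite (LintD (integ_cst _ _ _) (integD ihs iZ)) (LintD ihs iZ) (LintZ _ iv').
  rewrite Lint_cst//.
  have e1 : al * B0 * (q - s) <= B0 / 2.
    have h1 : q - s <= (2 * al)^-1.
      have : tau - (2 * al)^-1 <= s by rewrite le_max lexx orbT.
      by move=> ?; lra.
    apply: (@le_trans _ _ (al * B0 * (2 * al)^-1)).
      by rewrite ler_wpM2l// mulr_ge0// ltW.
    have -> // : al * B0 * (2 * al)^-1 = B0 / 2.
    by field; rewrite gt_eqF.
  have e2 := hW s q t0s qtau.
  have e3 : op_bound (lBe S) * Lint (fun t => `|v t|) s q <= op_bound (lBe S) * V.
    by rewrite ler_wpM2l ?op_bound_ge0//; apply: Lint_mono => //; exact: ltW.
  by rewrite /c; lra.
(* B1 is any bound on [s, t]; the iteration removes its influence *)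
apply: (maximal_unbounded_near mx t0s stau (r := 2 * c)) => t st ttau.
have [B1 B10 hB1] := solution_bounded (solution_sub (sx t ttau) t0s (lexx t)).
have iter_ k q : s <= q <= t -> `|x q| <= 2 * c + B1 * (1 / 2) ^+ k.
  elim: k q => [|k IH] q sqt.
    by rewrite expr0 mulr1 (le_trans (hB1 q sqt))// lerDr mulr_ge0.
  apply: le_trans (half t _ ttau IH q sqt) _.
  by rewrite exprSr; lra.
rewrite -subr_le0; apply: (@geometric_le0 _ _ B1 (1 / 2)).
  by rewrite ger0_norm//; lra.
by move=> k; rewrite lerBlDl; apply: iter_; rewrite st lexx.
Qed.

(** On a ball containing [xi0] and the values of [y], the nonlinearity is
    dominated by [|f t xi0| + lam t * r], which is integrable on the bounded
    interval; this contradicts [maximal_integral_infinite]. *)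
Lemma maximal_output_unbounded v (t0 tau : R) x y :
  maximal_trajectory S t0 tau%:E v x y -> ~ Linfty `[t0, tau[%classic y.
Proof.
move=> mx [my [M yM]].
have [pt _] := mx; have [[a0 t0tau] hv _ _ _] := pt.
have := maximal_integral_infinite mx.
pose D : set R := `[t0, tau[%classic.
have mD : measurable (D : set lR) by exact: mitv.
pose g t := enorm (lB S *m f t (y t)).
have mg : measurable_fun (D : set lR) g.
  apply: (vmeasurable_enorm mD); apply: vmeasurable_mulmx.
  exact: nonlinearity_measurable pt.
have [xi0 hxi0] := hint.
pose r := `|M| + `|xi0|.
have [lam [eps [l0 li _ lip _]]] := lipschitz_ball hlip tau r.
pose G t := n%:R * (op_bound (lB S) * (lam t * r + enorm (f t xi0))).
have iG : integ G t0 tau.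
  apply: integZ; apply: integZ; apply: integD.
    have := integZ r (li t0 tau a0); congr integ.
    by apply/funext => t; rewrite mulrC.
  by apply: L1_enorm; apply: hxi0; exact: itv_Rplus.
have iGD : mu.-integrable D (EFin \o G).
  have mGt : measurable_fun (`]t0, tau]%classic : set lR) G := integ_measurable iG.
  have sub : D `\` [set t0] `<=` `]t0, tau]%classic.
    move=> t []; rewrite /D /= !in_itv /= => /andP[h1 /ltW ->] tt0.
    by rewrite andbT lt_neqAle h1 andbT; apply/eqP => e; apply: tt0.
  have mGD : measurable_fun (D : set lR) G.
    apply: (@measurable_funS _ _ lR _ ([set t0] `|` `]t0, tau]%classic)).
    - by apply: measurableU; [exact: measurable_pt|exact: mitv].
    - move=> t; rewrite /D /= !in_itv /= le_eqVlt => /andP[/predU1P[->|->] /ltW ->].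
        by left.
      by right.
    - apply/measurable_funU; [exact: measurable_pt|exact: mitv|split].
        exact: measurable_fun_set1.
      exact: mGt.
  apply/(@negligible_integrable _ lR R mu _ [set t0]).
  - exact: measurable_pt.
  - exact: mD.
  - exact/measurable_EFinP.
  - exact: leb_pt.
  apply: integrableS iG => //; first exact: mitv.
  by apply: measurableD => //; exact: measurable_pt.
have gG : {ae mu, forall t, D t -> g t <= G t}.
  apply: filterS yM => t h Dt; have := h Dt => yt.
  have t0_ : 0 <= t.
    by move: Dt; rewrite /D /= in_itv /= => /andP[/(le_trans a0)].
  have yr : `|y t| <= `|M|.
    by rewrite (le_trans (norm_enorm _))// (le_trans yt)// ler_norm.
  rewrite /g /G (le_trans (enorm_norm _))// ler_wpM2l//.
  rewrite (le_trans (norm_mulmx _ _))// ler_wpM2l ?op_bound_ge0//.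
  rewrite -(subrK (f t xi0) (f t (y t))) (le_trans (ler_normD _ _))//.
  rewrite lerD ?norm_enorm//.
  apply: le_trans (lip t _ _ t0_ _ _) _.
  - by rewrite /r (le_trans yr)// lerDl.
  - by rewrite /r lerDr.
  - by rewrite ler_wpM2l ?l0// (le_trans (ler_normB _ _))// lerD.
have ig : mu.-integrable D (EFin \o g).
  by apply: ae_dominated_integrable gG iGD => // t _; exact: enorm_ge0.
have := integral_finite mD ig.
by move=> /[swap]; rewrite /D /g => ->; rewrite ltxx.
Qed.

Lemma maximal_blow_up : blow_up_property S.
Proof.
move=> t0 tau v x y /maximal_norm_diverges cx.
have -> : limf_esup (fun t => (enorm (x t))%:E) tau^'- = +oo%E.
  rewrite limf_esupE; apply/eqyP => A A0; apply: le_ereal_inf_tmp => _ [V FV <-].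
  have near_A : \forall t \near tau^'-, A <= enorm (x t) by move/cvgryPge : cx; exact.
  have [t [Vt At]] := filter_ex (filterI FV near_A).
  by apply: ereal_sup_ge; exists (enorm (x t))%:E; [exists t|rewrite lee_fin].
rewrite addye// gt_eqF// (@lt_le_trans _ _ 0%E)//.
by apply: integral_ge0 => t _; rewrite lee_fin addr_ge0// enorm_ge0.
Qed.

End BlowUp.

Theorem theorem4p4 (R : realType) (n m me p : nat)
    (hn : (0 < n)%N) (hm : (0 < m)%N) (hme : (0 < me)%N) (hp : (0 < p)%N)
    (S : lure R n m me p)
    (hint : exists xi0 : 'cV[R]_p, locally L1 Rplus (fun t => lf S t xi0))
    (hrad : radially_unbounded_loc_unif (lF S))
    (hlip : forall (T : set R) (K : set 'cV[R]_p),
       compact T -> T `<=` Rplus -> compact K ->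
       exists (lambda : R -> R) (eps : R),
         [/\ (forall t, 0 <= t -> 0 <= lambda t),
             (forall a b : R, `[a, b]%classic `<=` Rplus ->
                (@leb R).-integrable `[a, b]%classic (fun t => (lambda t)%:E)),
             0 < eps,
             (forall t xi zeta, 0 <= t -> K xi -> K zeta ->
                enorm (lf S t xi - lf S t zeta) <=
                  lambda t * enorm (xi - zeta)) &
             (forall t xi zeta, T t -> K xi -> K zeta ->
                eps * enorm (xi - zeta) <= enorm (lF S t xi - lF S t zeta))]) :
  [/\ (forall (v : R -> 'cV[R]_me) (t0 : R) (x0 : 'cV[R]_n),
         locally Linfty Rplus v -> 0 <= t0 ->
         (exists (tau : \bar R) (x : R -> 'cV[R]_n) (y : R -> 'cV[R]_p),
            maximal_trajectory S t0 tau v x y /\ x t0 = x0) /\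
         (forall (tau : R) (x : R -> 'cV[R]_n) (y : R -> 'cV[R]_p),
            maximal_trajectory S t0 tau%:E v x y ->
            [/\ (\int[leb]_(t in `[t0, tau[%classic)
                   (enorm (lB S *m lf S t (y t)))%:E = +oo)%E,
                ~ Linfty `[t0, tau[%classic y &
                enorm (x t) @[t --> tau^'-] --> +oo])),
      blow_up_property S &
      uniqueness_property S].
Proof.
split.
- move=> v t0 x0 hv a0; split; first exact: exists_maximal.
  move=> tau x y mx; split.
  + exact: maximal_integral_infinite mx.
  + exact: maximal_output_unbounded mx.
  + exact: maximal_norm_diverges mx.
- exact: maximal_blow_up.
- move=> v t0 tau tau' x y x' y'; exact: solution_coincide.
Qed.
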